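(* Let $F$ be a normalized IAP driven random distribution function with kernel $k$ and background driving process $L_A$ with Poisson intensity measure $\tilde\nu_\alpha$. Let $g:\mathbb{R}\to\mathbb{R}$ be measurable and such that $\tilde h(x):=\int_{\mathbb{R}}|g(t)|\,|k'(t,x)|\,dt<+\infty$ for every $x$ and $\int_{\mathbb{R}\times(0,+\infty)}[1-\exp(-\lambda v\tilde h(x))]\,\tilde\nu_\alpha(dx\,dv)<+\infty$ for every $\lambda>0$, where $k'(t,x):=\frac{\partial}{\partial t}k(t,x)$. Let $\mathbb{F}$ be the probability distribution function of $\int_{\mathbb{R}}g(t)\,dF(t)$ and set $h(x)=\int_{\mathbb{R}}g(t)k'(t,x)\,dt$ and $\bar k(x)=\lim_{t\to+\infty}k(t,x)$. Then for every $\sigma\in\mathbb{R}$, $$\frac12[\mathbb{F}(\sigma)+\mathbb{F}(\sigma-0)]=\frac12-\frac1\pi\lim_{T\uparrow+\infty}\int_0^T\frac1s\exp\left\{\int_{\mathbb{R}\times(0,+\infty)}[\cos(sv(h(x)-\sigma\bar k(x)))-1]\,\tilde\nu_\alpha(dx\,dv)\right\}\sin\left(\int_{\mathbb{R}\times(0,+\infty)}\sin\{sv(h(x)-\sigma\bar k(x))\}\,\tilde\nu_\alpha(dx\,dv)\right)ds.$$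
   Context: $\mathbb{F}(\sigma-0)$ denotes the left limit of $\mathbb{F}$ at $\sigma$. The integral $\int_0^T$ is understood, if necessary, as an improper integral $\lim_{\varepsilon\downarrow0}\int_\varepsilon^T$. All random objects are defined on a probability space $(\Omega,\mathcal{F},P)$. An increasing additive process (IAP) is a nondecreasing, right-continuous process with independent increments, started at $0$. Let $\alpha$ be a nondegenerate measure on $\mathscr{B}(\mathbb{R})$ with $\alpha(\mathbb{R})=a\in(0,+\infty)$ and let $A$ be its distribution function. A reparameterized IAP $L_A=\{L_A(x):x\in\mathbb{R}\}$ is obtained from an IAP $L$ on $[0,\infty)$ (without deterministic part) by the time change $y=A(x)$. It is almost surely finite and its law is determined by a family of Lévy measures $\{\nu_\alpha(x,dv):x\in\mathbb{R}\}$ through $E[e^{-\lambda L_A(x)}]=\exp[-\int_0^\infty\{1-e^{-\lambda v}\}\nu_\alpha(x,dv)]$ for $\lambda\ge0$. Its Poisson intensity measure $\tilde\nu_\alpha$ on $\mathbb{R}\times(0,+\infty)$ is defined by $\tilde\nu_\alpha((-\infty,x]\times C)=\nu_\alpha(x,C)$ for $x\in\mathbb{R}$ and $C\in\mathscr{B}((0,+\infty))$. Thus $L_A$ is a pure-jump process whose jump locations and sizes form a Poisson random measure with intensity $\tilde\nu_\alpha$. A normalized IAP driven random distribution function is $F(t)=Z(t)/\bar Z$, $t\in\mathbb{R}$, where $Z(t)=\int_{\mathbb{R}}k(t,x)\,dL_A(x)$, $\bar Z=\lim_{t\to+\infty}Z(t)$, and the measurable kernel $k:\mathbb{R}\times\mathbb{R}\to[0,+\infty)$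 and $\tilde\nu_\alpha$ satisfy, with $\bar k(x)>0$: (I) $t\mapsto k(t,x)$ is nondecreasing and right continuous with $\lim_{t\to-\infty}k(t,x)=0$ for every $x$; (II) $\int_{\mathbb{R}\times(0,+\infty)}[1-\exp\{-\lambda v\bar k(x)\}]\tilde\nu_\alpha(dx\,dv)<+\infty$ for every $\lambda>0$; (III) $\tilde\nu_\alpha(\mathbb{R}\times(0,+\infty))=+\infty$. These ensure that $F$ is almost surely a probability distribution function. It is assumed throughout that $t\mapsto k(t,x)$ is absolutely continuous for every $x$, so that $F$ has density $f(t)=\int_{\mathbb{R}}k'(t,x)\,dL_A(x)/\bar Z$. *)

(* Defs.v *)
From HB Require Import structures.
From mathcomp Require Import all_boot all_order all_algebra.
From mathcomp Require Import all_classical all_reals all_analysis.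

Set Implicit Arguments.
Unset Strict Implicit.
Unset Printing Implicit Defensive.
Import Order.TTheory GRing.Theory Num.Theory.
Import numFieldNormedType.Exports.

Local Open Scope classical_set_scope.
Local Open Scope ring_scope.

Section Stieltjes.
Context {R : realType}.

Definition is_cumulative (F : R -> R) : Prop :=
  nondecreasing_fun F /\ right_continuous F.

(* [idfun] is a dummy value for the functions that are not nondecreasing and
   right-continuous. *)
Definition to_cumulative (F : R -> R) : cumulative R R :=
  match pselect (is_cumulative F) with
  | left H => HB.pack_for (cumulative R R) F
                (isCumulative.Build R _ R F (proj1 H) (proj2 H))
  | right _ => idfun
  end.

(* The measure dF, with dF(]a, b]) = F(b) - F(a). *)
Definition stieltjes (F : R -> R) := lebesgue_stieltjes_measure (to_cumulative F).
HB.instance Definition _ (F : R -> R) := Measure.on (stieltjes F).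

Definition absolutely_continuous (f : R -> R) : Prop :=
  forall e : R, 0 < e -> exists2 d : R, 0 < d &
    forall (n : nat) (a b : 'I_n -> R),
      (forall i, a i <= b i) ->
      trivIset setT (fun i => `]a i, b i[%classic) ->
      \sum_(i < n) (b i - a i) < d ->
      \sum_(i < n) `|f (b i) - f (a i)| < e.

End Stieltjes.

Section Process.
Context {R : realType} {d : measure_display} {T : measurableType d}.
Variable P : probability T R.

(* As the [B i] may be the full line, the product rule for the whole family
   contains the one for its subfamilies. *)
Definition mutually_independent (n : nat) (X : 'I_n -> T -> R) : Prop :=
  forall B : 'I_n -> set R, (forall i, measurable (B i)) ->
    P (\bigcap_(i in [set: 'I_n]) (X i @^-1` B i)) =
    (\prod_(i < n) P (X i @^-1` B i))%E.

(* The process is indexed by [0, +oo[; its values at negative times are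
   irrelevant. *)
Record increasing_additive_process (L : R -> {RV P >-> R}) : Prop := {
  iap_start : {ae P, forall w, L 0 w = 0} ;
  iap_nondecreasing :
    {ae P, forall w, forall y z : R, 0 <= y -> y <= z -> L y w <= L z w} ;
  iap_right_continuous :
    {ae P, forall w, forall y : R, 0 <= y -> L z w @[z --> y^'+] --> L y w} ;
  iap_independent_increments :
    forall (n : nat) (t : nat -> R),
      0 <= t 0%N -> {homo t : i j / (i <= j)%N >-> i <= j} ->
      mutually_independent (fun (i : 'I_n) w => L (t i.+1) w - L (t i) w) }.

End Process.

Section ReparameterizedIAP.
Context {R : realType}.

Definition distribution_function (alpha : {measure set R -> \bar R}) (x : R) : R :=
  fine (alpha `]-oo, x]%classic).

Definition nondegenerate_measure (alpha : {measure set R -> \bar R}) : Prop :=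
  forall x : R, (alpha [set x] < alpha setT)%E.

(* Levy measures of increasing processes, which live on ]0, +oo[. *)
Definition levy_measure (nu : {measure set R -> \bar R}) : Prop :=
  (\int[nu]_(v in `]0%R, +oo[) (Num.min 1 v)%:E < +oo)%E.

(* R x ]0, +oo[, on which the Poisson intensity measure lives. *)
Definition jumps : set (R * R) := setT `*` `]0, +oo[%classic.

Definition poisson_intensity (nu : R -> {measure set R -> \bar R})
    (nut : {measure set (R * R) -> \bar R}) : Prop :=
  forall (x : R) (C : set R), measurable C -> C `<=` `]0, +oo[%classic ->
    nut (`]-oo, x]%classic `*` C) = nu x C.

(* The absence of a linear term in the exponent is the absence of a
   deterministic part. *)
Definition laplace_exponents {d : measure_display} {T : measurableType d}
    (P : probability T R) (LA : R -> T -> R)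
    (nu : R -> {measure set R -> \bar R}) : Prop :=
  forall x lambda : R, 0 <= lambda ->
    ('E_P[(fun w => expR (- (lambda * LA x w)))] =
     expeR (- \int[nu x]_(v in `]0%R, +oo[) (1 - expR (- (lambda * v)))%:E))%E.

End ReparameterizedIAP.

Section NormalizedIAP.
Context {R : realType}.

Definition kbar (k : R -> R -> R) (x : R) : R := lim (k t x @[t --> +oo]).

(* For almost every [t] only: the kernels are monotone in [t]; [derive1] is an
   arbitrary value at the other points. *)
Definition kprime (k : R -> R -> R) (t x : R) : R := derive1 (k ^~ x) t.

Record normalizing_kernel (k : R -> R -> R)
    (nut : {measure set (R * R) -> \bar R}) : Prop := {
  kernel_measurable : measurable_fun setT (fun p : R * R => k p.1 p.2) ;
  kernel_ge0 : forall t x, 0 <= k t x ;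
  kernel_nondecreasing : forall x, nondecreasing_fun (k ^~ x) ;
  kernel_right_continuous : forall x, right_continuous (k ^~ x) ;
  kernel_cvgNy : forall x, k t x @[t --> -oo] --> 0 ;
  kernel_cvgy : forall x, cvg (k t x @[t --> +oo]) ;
  kbar_gt0 : forall x, 0 < kbar k x ;
  kbar_integrable : forall lambda : R, 0 < lambda ->
    (\int[nut]_(p in jumps)
       (1 - expR (- (lambda * p.2 * kbar k p.1)))%:E < +oo)%E ;
  infinite_intensity : nut jumps = +oo%E }.

(* Below, [l] is a path of the driving process and [F] the path of the
   normalized process it defines. *)
Definition Z (k : R -> R -> R) (l : R -> R) (t : R) : \bar R :=
  (\int[stieltjes l]_x (k t x)%:E)%E.

Definition Zbar (k : R -> R -> R) (l : R -> R) : \bar R :=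
  lim (Z k l t @[t --> +oo]).

Definition normalized_df (k : R -> R -> R) (l : R -> R) (t : R) : R :=
  fine (Z k l t) / fine (Zbar k l).

Definition mean (g : R -> R) (F : R -> R) : R := \int[stieltjes F]_t g t.

Definition htilde (g : R -> R) (k : R -> R -> R) (x : R) : \bar R :=
  (\int[lebesgue_measure]_t (`|g t| * `|kprime k t x|)%:E)%E.

Definition h (g : R -> R) (k : R -> R -> R) (x : R) : R :=
  \int[lebesgue_measure]_t (g t * kprime k t x).

End NormalizedIAP.

(* Main.v *)
Require Import Defs.
From HB Require Import structures.
From mathcomp Require Import all_boot all_order all_algebra.
From mathcomp Require Import all_classical all_reals all_analysis.
From mathcomp Require Import measurable_realfun ring lra.

Set Implicit Arguments.
Unset Strict Implicit.
Unset Printing Implicit Defensive.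
Import Order.TTheory GRing.Theory Num.Theory.
Import numFieldNormedType.Exports.

Local Open Scope classical_set_scope.
Local Open Scope ring_scope.

(** The mean of the normalized process is a ratio of two integrals against the
    same jump process: exchanging integrals turns the mean of [F] into
    [int h dl / int kbar dl], where [l] is a path of the driving process and the
    denominator is almost surely positive and finite ([mean_normalized_df]).
    So the mean is at most [sigma] exactly when
    [Y = int (h - sigma * kbar) dl] is nonpositive ([mean_ratio]): the law of
    a ratio at [sigma] becomes the law at [0] of a linear functional, and a
    linear functional of a process with independent increments has an explicit
    characteristic function.

    The inversion at [0] is [gil_pelaez_inversion].  It is obtained from the tail
    [K] of the Dirichlet integral [int sin x / x]: the truncated inversion
    integral of a random variable [Y] is the increment of
    [s |-> E (sg Y * K (s * |Y|))], and [K] is bounded, tends to [pi / 2] at [0]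
    and to [0] at infinity.

    It remains to compute [E sin (s * Y)].  For a nonnegative integrand [rho],
    [E exp (- int rho dl)] is [exp (- int (1 - exp (- v * rho x)))]: for step
    functions this is the independence of the increments, bounded measurable
    functions follow by a functional monotone class argument
    ([laplace_functional_bounded]) and unbounded ones by truncation
    ([laplace_functional]).  Letting the scale of [rho] tend to [0] or to
    infinity in the same formula shows that [int rho dl] is almost surely finite,
    and almost surely positive when [rho] is positive and the intensity is
    infinite.

    Now [Y = U - V], where [U] and [V] integrate the positive and the negative
    part of [h - sigma * kbar].  These parts have disjoint supports, so the joint
    Laplace transform of [(U, V)] is a product, and [fourier_of_laplace], applied
    to each of the two variables in turn, replaces the Laplace transforms by
    Fourier transforms ([expectation_sin_path_integral]).  This last passage
    stays on the real line.  Differentiating the Laplace transform gives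
    [E (X e^(- l X)) = (int w e^(- l w)) * E e^(- l X)] for all [l], which says that
    weighting by [X] amounts to adding an independent jump.  This relation is
    linear in the test function, so it extends from exponentials to polynomials
    in [e^(- X)] and, by uniform approximation, to [e^(- X) cos (s X)]; it then
    says that the cosine and sine transforms solve a linear differential equation
    in [s].

    Two preparations make these computations legitimate.  The driving process is
    nondecreasing and right-continuous only almost surely, and
    [exists_driving_paths] modifies it on a null set into a process all of whose
    paths are distribution functions of finite measures.  The derivative [k'] is
    defined by a pointwise limit that need not exist everywhere, so it is
    replaced by a jointly measurable density ([kernel_density]) that coincides
    with it almost everywhere for each [x]. *)

(** * Dominated convergence and differentiation under the integral sign *)

Section RealValuedIntegrals.
Context {R : realType} {d : measure_display} {T : measurableType d}.
Variable mu : {measure set T -> \bar R}.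

Lemma integrable_le (D : set T) (f g : T -> R) : measurable D ->
  measurable_fun D f -> (forall x, D x -> `|f x| <= g x) ->
  mu.-integrable D (EFin \o g) -> mu.-integrable D (EFin \o f).
Proof.
move=> mD mf fg; apply: le_integrable => //; first exact/measurable_EFinP.
by move=> x Dx /=; rewrite lee_fin (le_trans (fg x Dx))// ler_norm.
Qed.

Lemma integrable_mulrl (D : set T) (k : R) (f : T -> R) : measurable D ->
  mu.-integrable D (EFin \o f) -> mu.-integrable D (EFin \o (fun x => k * f x)).
Proof. by move=> mD If; exact: (integrableZl mD k If). Qed.

Lemma integrable_mulrr (D : set T) (k : R) (f : T -> R) : measurable D ->
  mu.-integrable D (EFin \o f) -> mu.-integrable D (EFin \o (fun x => f x * k)).
Proof. by move=> mD If; exact: (integrableZr mD k If). Qed.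

Lemma integrable_addr (D : set T) (f g : T -> R) : measurable D ->
  mu.-integrable D (EFin \o f) -> mu.-integrable D (EFin \o g) ->
  mu.-integrable D (EFin \o (fun x => f x + g x)).
Proof. by move=> mD If Ig; exact: (integrableD mD If Ig). Qed.

Lemma integrable_subr (D : set T) (f g : T -> R) : measurable D ->
  mu.-integrable D (EFin \o f) -> mu.-integrable D (EFin \o g) ->
  mu.-integrable D (EFin \o (fun x => f x - g x)).
Proof. by move=> mD If Ig; exact: (integrableB mD If Ig). Qed.

Lemma dominated_cvgR (D : set T) (f_ : nat -> T -> R) (f g : T -> R) :
  measurable D -> (forall n, measurable_fun D (f_ n)) ->
  (forall x, D x -> f_ n x @[n --> \oo] --> f x) ->
  (forall n x, D x -> `|f_ n x| <= g x) ->
  mu.-integrable D (EFin \o g) ->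
  \int[mu]_(x in D) f_ n x @[n --> \oo] --> \int[mu]_(x in D) f x.
Proof.
move=> mD mf ff fg ig.
have mf0 : measurable_fun D f.
  by apply: (measurable_fun_cvg mf) => x Dx; exact: ff.
have fg0 x : D x -> `|f x| <= g x.
  move=> Dx; rewrite -(cvg_lim (@Rhausdorff R) (cvg_norm (ff x Dx))).
  apply: limr_le; first by apply: is_cvg_norm; apply/cvg_ex; exists (f x); exact: ff.
  by near=> n; exact: fg.
have if0 : mu.-integrable D (EFin \o f) by exact: integrable_le fg0 ig.
apply: fine_cvg; rewrite /Rintegral fineK; last exact: integrable_fin_num.
apply: (@dominated_cvg _ _ _ mu D mD (fun n x => (f_ n x)%:E) (EFin \o f) (EFin \o g)) => //.
- by move=> n; exact/measurable_EFinP.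
- by move=> x Dx; apply: cvg_EFin; [exact: nearW|exact: ff].
Unshelve. all: by end_near. Qed.

(** The domination is only asked for positive parameters, where the integrands
    below make sense; convergence along the filter reduces to sequences. *)
Lemma dominated_cvg_at_right0 (f_ : R -> T -> R) (f g : T -> R) (D : set T) :
  measurable D -> (forall t, 0 < t -> measurable_fun D (f_ t)) ->
  (forall x, D x -> f_ t x @[t --> 0^'+] --> f x) ->
  (forall t x, 0 < t -> D x -> `|f_ t x| <= g x) ->
  mu.-integrable D (EFin \o g) ->
  \int[mu]_(x in D) f_ t x @[t --> 0^'+] --> \int[mu]_(x in D) f x.
Proof.
move=> mD mf ff fg ig; apply/cvg_at_rightP => u [u0 ucvg].
apply: (dominated_cvgR (f_ := fun n => f_ (u n)) (g := g)) => //.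
- by move=> n; exact: mf.
- move=> x Dx; have /cvg_at_rightP := ff x Dx; exact.
- by move=> n x Dx; exact: fg.
Qed.

Lemma dominated_cvg_pinfty (f_ : R -> T -> R) (f g : T -> R) (D : set T) :
  measurable D -> (forall t, measurable_fun D (f_ t)) ->
  (forall x, D x -> f_ t x @[t --> +oo] --> f x) ->
  (forall t x, 0 < t -> D x -> `|f_ t x| <= g x) ->
  mu.-integrable D (EFin \o g) ->
  \int[mu]_(x in D) f_ t x @[t --> +oo] --> \int[mu]_(x in D) f x.
Proof.
move=> mD mf ff fg ig; apply/cvg_pinftyP => u ucvg.
have [N _ uN] : \forall n \near \oo, 0 < u n by move/cvgryPgt : ucvg; exact.
rewrite -(cvg_shiftn N).
apply: (dominated_cvgR (f_ := fun n => f_ (u (n + N)%N)) (g := g)) => //.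
- move=> x Dx; rewrite (cvg_shiftn N (fun n => f_ (u n) x)).
  by have /cvg_pinftyP := ff x Dx; exact.
- by move=> n x Dx; apply: fg => //; apply: uN => /=; rewrite leq_addl.
Qed.

(** A dominated derivative on a neighbourhood of the point suffices: integrands
    such as [W * e^(- l X)] are differentiable in [l] with a bound that blows up at
    [l = 0]. *)
Lemma is_derive_Rintegral (D : set T) (f df : R -> T -> R) (G : T -> R)
    (a u v : R) : measurable D -> u < a < v ->
  (forall x, u < x < v -> mu.-integrable D (EFin \o f x)) ->
  (forall x y, u < x < v -> D y -> is_derive x (1:R) (f ^~ y) (df x y)) ->
  (forall x y, u < x < v -> D y -> `|df x y| <= G y) ->
  mu.-integrable D (EFin \o G) ->
  is_derive a (1:R) (fun x => \int[mu]_(y in D) f x y) (\int[mu]_(y in D) df a y).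
Proof.
move=> mD uav If Df dfG iG.
pose G' (y : T) : R := `|G y|.
have iG' : mu.-integrable D (EFin \o G') by exact: integrable_norm.
have D1 x y : u < x < v -> D y -> partial1of2 f x y = df x y.
  by move=> xuv Dy; rewrite partial1of2E; have H := Df x y xuv Dy; rewrite derive_val.
have Ia : `]u, v[%classic a by rewrite /= in_itv.
have If' x : `]u, v[%classic x -> mu.-integrable D (EFin \o f x).
  by rewrite /= in_itv => /If.
have De x y : `]u, v[%classic x -> D y -> derivable (f ^~ y) x 1.
  by rewrite /= in_itv => xuv Dy; have := Df x y xuv Dy => H; exact: ex_derive.
have ub x y : `]u, v[%classic x -> D y -> `|partial1of2 f x y| <= G' y.
  rewrite /= in_itv => xuv Dy; rewrite D1// (le_trans (dfG x y xuv Dy))//.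
  exact: ler_norm.
have G'0 y : 0 <= G' y by exact: normr_ge0.
apply: DeriveDef; first exact: (derivable_under_integral mD Ia If' De G'0 iG' ub).
rewrite -derive1E (differentiation_under_integral mD Ia If' De G'0 iG' ub).
by apply: eq_Rintegral => y /set_mem Dy; exact: D1.
Qed.

End RealValuedIntegrals.

(** * Derivatives and inequalities for exp, sin and cos *)

Section Derivatives.
Context {R : realType}.
Implicit Types (f g : R -> R) (x : R).

(** These rules are stated for functions given by an expression of the variable,
    so that they compose by application. *)
Lemma is_derive1_add f g x df dg : is_derive x (1:R) f df -> is_derive x (1:R) g dg ->
  is_derive x (1:R) (fun t => f t + g t) (df + dg).
Proof. by move=> Hf Hg; exact: is_deriveD. Qed.

Lemma is_derive1_opp f x df : is_derive x (1:R) f df ->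
  is_derive x (1:R) (fun t => - f t) (- df).
Proof. by move=> Hf; exact: is_deriveN. Qed.

Lemma is_derive1_mul f g x df dg : is_derive x (1:R) f df -> is_derive x (1:R) g dg ->
  is_derive x (1:R) (fun t => f t * g t) (df * g x + f x * dg).
Proof.
move=> Hf Hg; apply: (is_derive_eq (is_deriveM Hf Hg)).
by rewrite addrC /GRing.scale /= [g x * _]mulrC.
Qed.

Lemma is_derive1_cst (c x : R) : is_derive x (1:R) (fun=> c) 0.
Proof. exact: is_derive_cst. Qed.

Lemma is_derive1_lin (c x : R) : is_derive x (1:R) (fun t => t * c) c.
Proof.
apply: (is_derive_eq (is_derive1_mul (is_derive_id x (1:R)) (is_derive1_cst c x))).
by rewrite mulr0 addr0 mul1r.
Qed.

Lemma is_derive1_exp f x df : is_derive x (1:R) f df ->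
  is_derive x (1:R) (fun t => expR (f t)) (expR (f x) * df).
Proof. by move=> Hf; exact: (is_derive1_comp (is_derive_expR (f x)) Hf). Qed.

Lemma is_derive1_sin f x df : is_derive x (1:R) f df ->
  is_derive x (1:R) (fun t => sin (f t)) (cos (f x) * df).
Proof. by move=> Hf; exact: (is_derive1_comp (is_derive_sin (f x)) Hf). Qed.

Lemma is_derive1_cos f x df : is_derive x (1:R) f df ->
  is_derive x (1:R) (fun t => cos (f t)) (- sin (f x) * df).
Proof. by move=> Hf; exact: (is_derive1_comp (is_derive_cos (f x)) Hf). Qed.

Lemma is_derive_cvg f x df : is_derive x (1:R) f df -> f t @[t --> x] --> f x.
Proof.
by move=> Hf; apply: differentiable_continuous; apply/derivable1_diffP; exact: ex_derive.
Qed.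

Lemma normr_sin_le x : `|sin x| <= `|x|.
Proof.
suff H (y : R) : 0 <= y -> `|sin y| <= y.
  have [x0|x0] := leP 0 x; first by rewrite (ger0_norm x0) H.
  by rewrite (ltr0_norm x0) -normrN -sinN H// oppr_ge0 ltW.
rewrite le_eqVlt => /predU1P[<-|y0]; first by rewrite sin0 normr0.
have cs : {within `[0, y], continuous (@sin R)}.
  by apply: continuous_subspaceT; exact: continuous_sin.
have [z _] := MVT y0 (fun t _ => is_derive_sin t) cs.
rewrite sin0 !subr0 => ->; rewrite normrM (ger0_norm (ltW y0)) ler_piMl ?(ltW y0)//.
by rewrite ler_norml cos_geN1 cos_le1.
Qed.

Lemma normr_sin_le1 x : `|sin x| <= 1.
Proof. by rewrite ler_norml sin_geN1 sin_le1. Qed.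

Lemma normr_cos_le1 x : `|cos x| <= 1.
Proof. by rewrite ler_norml cos_geN1 cos_le1. Qed.

Lemma one_sub_cos_le x : 1 - cos x <= `|x|.
Proof.
have -> : 1 - cos x = 2 * (sin (x / 2)) ^+ 2.
  have {1}-> : x = x / 2 + x / 2 by field.
  rewrite cosD -!expr2 cos2sin2; lra.
have H := normr_sin_le (x / 2); have H1 := normr_sin_le1 (x / 2).
rewrite -real_normK ?num_real// expr2.
rewrite normrM in H; rewrite [`|2^-1|]ger0_norm// in H.
have := normr_ge0 (sin (x/2)) => H0.
nra.
Qed.

(** From [1 + x <= e^x]. *)
Lemma mul_expRN_le (x : R) : x * expR (- x) <= 1.
Proof.
rewrite expRN ler_pdivrMr ?expR_gt0// mul1r.
by apply: le_trans (expR_ge1Dx x); lra.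
Qed.

Lemma expRN_le1 (x : R) : 0 <= x -> expR (- x) <= 1.
Proof. by move=> x0; rewrite -expR0 ler_expR oppr_le0. Qed.

End Derivatives.

(** * The tail of the Dirichlet integral *)

Section Dirichlet.
Context {R : realType}.
Notation mu := (@lebesgue_measure R).

Let halfline : set R := `]0, +oo[%classic.

Let m_halfline : measurable halfline. Proof. exact: measurable_itv. Qed.

Let K_integrand (s y : R) : R :=
  expR (- (s * y)) * (cos s + y * sin s) * (1 + y ^+ 2)^-1.

(** For [s > 0] this is [int_s^oo sin x / x dx]: write [1 / x] as the integral of
    [e^(- x y)] over [y > 0] and integrate in [x] first.  In this form the integral
    converges absolutely and is defined at [s = 0] too. *)
Definition dirichlet_tail (s : R) : R := \int[mu]_(y in halfline) K_integrand s y.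

Let one_sqr_gt0 (y : R) : 0 < 1 + y ^+ 2.
Proof. by rewrite ltr_wpDr ?sqr_ge0. Qed.

Lemma integrable_inv_one_sqr :
  mu.-integrable halfline (EFin \o (fun y => (1 + y ^+ 2)^-1)).
Proof.
refine (@integrableS _ _ _ mu `[0, +oo[%classic halfline _ _ _ _ _) => //.
  by move=> x; rewrite /halfline/= !in_itv/= !andbT; exact: ltW.
apply/integrableP; split.
  apply/measurable_EFinP; apply: measurable_funTS.
  by apply: continuous_measurable_fun; exact: continuous_oneDsqrV.
under eq_integral => y _ do rewrite /= ger0_norm ?invr_ge0 ?(ltW (one_sqr_gt0 _))//.
by rewrite (integral0y_oneDsqr R) ltry.
Qed.

Lemma Rintegral_inv_one_sqr : \int[mu]_(y in halfline) (1 + y ^+ 2)^-1 = pi / 2.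
Proof.
rewrite Rintegral_itv_obnd_cbnd; last exact: integrable_inv_one_sqr.
by rewrite /Rintegral (integral0y_oneDsqr R).
Qed.

Lemma integral_expRN (c : R) : 0 < c ->
  (\int[mu]_(y in halfline) (expR (- (c * y)))%:E = (c^-1)%:E)%E.
Proof.
move=> c0.
have D (x : R) : is_derive x (1:R) (fun t => - expR (- (t * c)) / c) (expR (- (x * c))).
  have H := is_derive1_mul (is_derive1_opp (is_derive1_exp (is_derive1_opp
    (is_derive1_lin c x)))) (is_derive1_cst c^-1 x).
  by apply: (is_derive_eq H); rewrite mulr0 addr0; field; rewrite gt_eqF.
have cE : continuous (fun y : R => expR (- (c * y))).
  move=> y; under eq_fun do rewrite mulrC.
  exact: is_derive_cvg (is_derive1_exp (is_derive1_opp (is_derive1_lin c y))).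
rewrite integral_itv_obnd_cbnd; last first.
  by apply: measurableT_comp => //; apply: measurable_funTS; exact: continuous_measurable_fun.
rewrite (@ge0_continuous_FTC2y _ _ (fun t => - expR (- (t * c)) / c) 0 0).
- by rewrite mul0r oppr0 expR0 mulN1r -EFinN opprK add0e.
- by move=> x _; exact: expR_ge0.
- exact: continuous_subspaceT.
- rewrite -[X in _ --> X](mul0r c^-1); apply: cvgMl.
  rewrite -[X in _ --> X]oppr0; apply: cvgN.
  apply: (@cvg_comp _ _ _ (fun t : R => t * c) (fun t => expR (- t)) _ +oo).
    by apply: gt0_cvgMly.
  exact: cvgr_expR.
- by move=> x _; have H := D x; exact: ex_derive.
- by apply: cvg_at_right_filter; exact: is_derive_cvg (D 0).
- by move=> x _; rewrite derive1E; have H := D x; rewrite derive_val mulrC.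
Qed.

Lemma integrable_expRN (c : R) : 0 < c ->
  mu.-integrable halfline (EFin \o (fun y => expR (- (c * y)))).
Proof.
move=> c0; apply/integrableP; split.
  apply/measurable_EFinP; apply: measurable_funTS.
  apply: continuous_measurable_fun => y; under eq_fun do rewrite mulrC.
  exact: is_derive_cvg (is_derive1_exp (is_derive1_opp (is_derive1_lin c y))).
under eq_integral => y _ do rewrite /= ger0_norm ?expR_ge0//.
by rewrite integral_expRN// ltry.
Qed.

Let K_meas (s : R) : measurable_fun halfline (K_integrand s).
Proof.
apply: measurable_funTS; apply: measurable_funM; last first.
  by apply: continuous_measurable_fun; exact: continuous_oneDsqrV.
apply: measurable_funM.
  apply: measurableT_comp => //; apply: measurableT_comp => //.
by apply: measurable_funD => //; by apply: measurable_funM.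
Qed.

Let K_bound (s y : R) : 0 <= s -> halfline y ->
  `|K_integrand s y| <= 2 * (1 + y ^+ 2)^-1.
Proof.
move=> s0; rewrite /halfline/= in_itv/= andbT => y0.
rewrite normrM [X in _ * X]ger0_norm ?invr_ge0 ?(ltW (one_sqr_gt0 _))//.
rewrite ler_pM2r ?invr_gt0// normrM ger0_norm ?expR_ge0//.
have sy0 : 0 <= s * y by rewrite mulr_ge0// ltW.
have e1 := expRN_le1 sy0; have e2 := mul_expRN_le (s * y).
have e0 := expR_ge0 (- (s * y)).
have H : `|cos s + y * sin s| <= 1 + s * y.
  rewrite (le_trans (ler_normD _ _))// lerD ?normr_cos_le1//.
  by rewrite normrM (gtr0_norm y0) mulrC ler_pM2r// (le_trans (normr_sin_le s))// ger0_norm.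
by have := normr_ge0 (cos s + y * sin s); nra.
Qed.

Let K_integrable (s : R) : 0 <= s -> mu.-integrable halfline (EFin \o K_integrand s).
Proof.
move=> s0; refine (integrable_le (mu := mu) m_halfline (K_meas s) (fun y => @K_bound s y s0) _).
exact: (integrableZl _ _ integrable_inv_one_sqr).
Qed.

(** The derivative in [s] of the integrand is [- sin s * e^(- s y)]: the factor
    [1 + y ^ 2] cancels, and the remaining integral is [1 / s]. *)
Lemma dirichlet_tail_derive (a : R) : 0 < a ->
  is_derive a (1:R) dirichlet_tail (- (sin a / a)).
Proof.
move=> a0.
have De (s y : R) : is_derive s (1:R) (K_integrand ^~ y) (- sin s * expR (- (s * y))).
  have H := is_derive1_mul (is_derive1_mul
     (is_derive1_exp (is_derive1_opp (is_derive1_lin y s)))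
     (is_derive1_add (is_derive_cos s)
        (is_derive1_mul (is_derive1_cst y s) (is_derive_sin s))))
     (is_derive1_cst (1 + y ^+ 2)^-1 s).
  apply: (is_derive_eq H); field.
  by rewrite gt_eqF.
have := @is_derive_Rintegral R _ _ mu halfline K_integrand
  (fun s y => - sin s * expR (- (s * y))) (fun y => expR (- ((a / 2) * y))) a (a / 2) (a * 2).
have -> : \int[mu]_(y in halfline) (- sin a * expR (- (a * y))) = - (sin a / a).
  rewrite RintegralZl//; last exact: integrable_expRN.
  by rewrite /Rintegral integral_expRN// mulNr.
apply => //.
- by apply/andP; split; lra.
- by move=> x /andP[x0 _]; apply: K_integrable; lra.
- move=> x y /andP[x0 _]; rewrite /halfline/= in_itv/= andbT => y0.
  rewrite normrM normrN (ger0_norm (expR_ge0 _)).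
  apply: (@le_trans _ _ (expR (- (x * y)))).
    by rewrite ler_piMl ?expR_ge0// normr_sin_le1.
  by rewrite ler_expR lerN2 ler_pM2r// ltW.
- by apply: integrable_expRN; lra.
Qed.

Lemma dirichlet_tail_bound (s : R) : 0 <= s -> `|dirichlet_tail s| <= pi.
Proof.
move=> s0; apply: le_trans (le_normr_Rintegral _ (K_integrable s0)) _ => //.
have -> : pi = \int[mu]_(y in halfline) (2 * (1 + y ^+ 2)^-1) :> R.
  rewrite RintegralZl//; last exact: integrable_inv_one_sqr.
  by rewrite Rintegral_inv_one_sqr; field.
apply: le_Rintegral => //.
- by apply: integrable_norm; exact: K_integrable.
- exact: (integrableZl _ _ integrable_inv_one_sqr).
- by move=> y hy; exact: K_bound.
Qed.

Lemma dirichlet_tail_cvg0 : dirichlet_tail s @[s --> 0^'+] --> pi / 2.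
Proof.
rewrite -Rintegral_inv_one_sqr.
apply: (dominated_cvg_at_right0 (mu := mu) (f_ := K_integrand) (f := fun y => (1 + y ^+ 2)^-1) (g := fun y => 2 * (1 + y ^+ 2)^-1)) => //.
- by move=> t _; exact: K_meas.
- move=> y _ /=.
  rewrite [X in _ --> X](_ : _ = K_integrand 0 y); last first.
    by rewrite /K_integrand mul0r oppr0 expR0 cos0 sin0 mulr0 addr0 !mul1r.
  apply: cvg_at_right_filter.
  have H := is_derive1_mul (is_derive1_mul
     (is_derive1_exp (is_derive1_opp (is_derive1_lin y 0)))
     (is_derive1_add (is_derive_cos (0:R))
        (is_derive1_mul (is_derive1_cst y 0) (is_derive_sin (0:R)))))
     (is_derive1_cst (1 + y ^+ 2)^-1 0).
  exact: (is_derive_cvg H).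
- by move=> t y t0 hy; apply: K_bound => //; exact: ltW.
- exact: (integrableZl _ _ integrable_inv_one_sqr).
Qed.

Lemma dirichlet_tail_cvgy : dirichlet_tail s @[s --> +oo] --> 0.
Proof.
have <- : \int[mu]_(y in halfline) (cst 0 y) = 0 :> R.
  by rewrite Rintegral_cst// mul0r.
apply: (dominated_cvg_pinfty (mu := mu) (f_ := K_integrand) (f := cst 0) (g := fun y => 2 * (1 + y ^+ 2)^-1)) => //.
- move=> y; rewrite /halfline/= in_itv/= andbT => y0; apply: norm_cvg0.
  apply: (@squeeze_cvgr _ _ _ _ (cst 0) (fun s => expR (- (s * y)) * (1 + y))).
  + near=> s; apply/andP; split; first exact: normr_ge0.
    rewrite normrM [X in _ * X]ger0_norm ?invr_ge0 ?(ltW (one_sqr_gt0 _))//.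
    have i0 : 0 <= (1 + y ^+ 2)^-1 by rewrite invr_ge0 ltW.
    rewrite -[leRHS]mulr1; apply: ler_pM => //; last first.
      by rewrite invf_le1// lerDl sqr_ge0.
    rewrite normrM (ger0_norm (expR_ge0 _)) ler_pM2l ?expR_gt0//.
    rewrite (le_trans (ler_normD _ _))// lerD ?normr_cos_le1//.
    by rewrite normrM (gtr0_norm y0) ler_piMr ?normr_sin_le1// ltW.
  + exact: cvg_cst.
  + rewrite -[X in _ --> X](mul0r (1 + y)); apply: cvgMl.
    apply: (@cvg_comp _ _ _ (fun t : R => t * y) (fun t => expR (- t)) _ +oo).
      by apply: gt0_cvgMly.
    exact: cvgr_expR.
- by move=> t y t0 hy; apply: K_bound => //; exact: ltW.
- exact: (integrableZl _ _ integrable_inv_one_sqr).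
Unshelve. all: by end_near. Qed.

End Dirichlet.

(** * The Gil-Pelaez inversion formula at zero *)

Section GilPelaez.
Context {R : realType} {d : measure_display} {T : measurableType d}.
Variables (P : probability T R) (Y : T -> R).
Hypothesis mY : measurable_fun setT Y.
Notation mu := (@lebesgue_measure R).

Let K := @dirichlet_tail R.

Let signed_tail (s : R) : R := \int[P]_w (Num.sg (Y w) * K (s * `|Y w|)).

Let P_cst (c : R) : P.-integrable setT (EFin \o (fun=> c)).
Proof. exact: finite_measure_integrable_cst. Qed.

Let sg_le1 (y : R) : `|Num.sg y| <= 1.
Proof. by rewrite normr_sg; case: (y != 0). Qed.

Let sgE (y : R) : Num.sg y = (0 < y)%R%:R - (y < 0)%R%:R.
Proof. by case: sgrP => // h; rewrite ?subrr ?subr0 ?sub0r ?(ltNge _ 0) ?(ltW h) ?h. Qed.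

Let measurable_sg : measurable_fun setT (fun w => Num.sg (Y w)).
Proof.
have -> : (fun w => Num.sg (Y w)) =
    (fun w => if 0 < Y w then 1 else if Y w < 0 then -1 else 0).
  by apply/funext => w; rewrite sgE; case: ltrgtP => //= _; rewrite ?subrr ?subr0 ?sub0r.
apply: measurable_fun_ifT => //; first by apply: measurable_fun_ltr.
by apply: measurable_fun_ifT => //; apply: measurable_fun_ltr.
Qed.

Let measurable_tail (s : R) : 0 < s ->
  measurable_fun setT (fun w => Num.sg (Y w) * K (s * `|Y w|)).
Proof.
move=> s0.
have -> : (fun w => Num.sg (Y w) * K (s * `|Y w|)) =
    (fun w => Num.sg (Y w) * (K \_ `]0, +oo[%classic) (s * `|Y w|)).
  apply/funext => w; have [->|Yw0] := eqVneq (Y w) 0; first by rewrite sgr0 !mul0r.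
  rewrite patchE; case: ifPn => //; rewrite notin_setE/= in_itv/= andbT.
  by move=> /negP; rewrite mulr_gt0// normr_gt0.
apply: measurable_funM => //.
apply: measurableT_comp; last by apply: measurable_funM => //; exact: measurableT_comp.
apply/(measurable_restrictT K) => //.
apply: open_continuous_measurable_fun; first exact: interval_open.
move=> x /set_mem; rewrite /= in_itv/= andbT => x0.
exact: is_derive_cvg (dirichlet_tail_derive x0).
Qed.

Let tail_bound (s : R) w : 0 <= s -> `|Num.sg (Y w) * K (s * `|Y w|)| <= pi.
Proof.
move=> s0; rewrite normrM -[leRHS]mul1r ler_pM//.
by apply: dirichlet_tail_bound; rewrite mulr_ge0.
Qed.

Let integrable_tail (s : R) : 0 < s ->
  P.-integrable setT (EFin \o (fun w => Num.sg (Y w) * K (s * `|Y w|))).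
Proof.
move=> s0; apply: (integrable_le (mu := P) _ (measurable_tail s0) _ (P_cst pi)) => //.
by move=> w _; apply: tail_bound; exact: ltW.
Qed.

Let measurable_sin (s : R) : measurable_fun setT (fun w => sin (s * Y w)).
Proof.
apply: measurableT_comp; last by apply: measurable_funM.
by apply: continuous_measurable_fun; exact: continuous_sin.
Qed.

Let integrable_sin (s : R) : P.-integrable setT (EFin \o (fun w => sin (s * Y w))).
Proof.
apply: (integrable_le (mu := P) _ (measurable_sin s) _ (P_cst 1)) => //.
by move=> w _; exact: normr_sin_le1.
Qed.

(** The factor [|Y|] that comes out of [K (s * |Y|)] cancels the one in the
    derivative of [K], and [sg Y * sin (s * |Y|) = sin (s * Y)]. *)
Let signed_tail_derive (a : R) : 0 < a ->
  is_derive a (1:R) signed_tail (- (a^-1 * \int[P]_w sin (a * Y w))).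
Proof.
move=> a0.
have D (s : R) w : 0 < s -> is_derive s (1:R)
    (fun s => Num.sg (Y w) * K (s * `|Y w|)) (- (s^-1 * sin (s * Y w))).
  move=> s0; have [Y0|Y0] := eqVneq (Y w) 0.
    rewrite Y0 sgr0 mulr0 sin0 mulr0 oppr0; under eq_fun do rewrite mul0r.
    exact: is_derive_cst.
  have sY : 0 < s * `|Y w| by rewrite mulr_gt0// normr_gt0.
  have H := is_derive1_mul (is_derive1_cst (Num.sg (Y w)) s)
     (@is_derive1_comp _ K (fun t => t * `|Y w|) s _ _
       (dirichlet_tail_derive sY) (is_derive1_lin `|Y w| s)).
  apply: (is_derive_eq H); rewrite mul0r add0r.
  have -> : sin (s * Y w) = Num.sg (Y w) * sin (s * `|Y w|).
    rewrite [in LHS](numEsg (Y w)); case: (ltgtP (Y w) 0) Y0 => // y0 _.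
      by rewrite (ltr0_sg y0) !mulN1r mulrN sinN.
    by rewrite (gtr0_sg y0) !mul1r.
  by field; rewrite normr_eq0 Y0 gt_eqF.
have := @is_derive_Rintegral R _ _ P setT
  (fun s w => Num.sg (Y w) * K (s * `|Y w|))
  (fun s w => - (s^-1 * sin (s * Y w))) (fun=> (a / 2)^-1) a (a / 2) (a * 2).
have -> : \int[P]_(w in setT) - (a^-1 * sin (a * Y w)) = - (a^-1 * \int[P]_w sin (a * Y w)).
  rewrite -mulNr -RintegralZl//.
  by apply: eq_Rintegral => w _; rewrite mulNr.
apply => //.
- by apply/andP; split; lra.
- by move=> x /andP[x0 _]; apply: integrable_tail; lra.
- by move=> x w /andP[x0 _] _; apply: D; lra.
- move=> x w /andP[x0 _] _; have x0' : 0 < x by lra.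
  rewrite normrN normrM ger0_norm ?invr_ge0 ?(ltW x0')//.
  rewrite -[leRHS]mulr1 ler_pM ?normr_sin_le1 ?invr_ge0 ?(ltW x0')//.
  by rewrite lef_pV2 ?posrE; lra.
Qed.

Let sine_transform_continuous : continuous (fun s : R => \int[P]_w sin (s * Y w) : R).
Proof.
move=> s; apply/(@cvg_nbhsP _ R^o) => u us.
apply: (dominated_cvgR (mu := P) (f_ := fun n w => sin (u n * Y w)) (g := fun=> 1)) => //.
- move=> w _; apply: (@cvg_comp _ _ _ (fun n => u n * Y w) sin _ (nbhs (s * Y w))).
    exact: cvgMl.
  exact: continuous_sin.
- by move=> n w _; exact: normr_sin_le1.
Qed.

Let J (eps U : R) : R :=
  \int[mu]_(s in `[eps, U]) (s^-1 * \int[P]_w sin (s * Y w)).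

(** The integrand is minus the derivative of [signed_tail]. *)
Let JE (eps U : R) : 0 < eps < U -> J eps U = signed_tail eps - signed_tail U.
Proof.
move=> /andP[e0 eU]; rewrite /J /Rintegral.
have ci (s : R) : eps <= s <= U ->
    {for s, continuous (fun s : R => s^-1 * \int[P]_w sin (s * Y w) : R)}.
  move=> /andP[es _].
  apply: cvgM; last exact: sine_transform_continuous.
  by apply: cvgV; [rewrite gt_eqF// (lt_le_trans e0)|exact: cvg_id].
rewrite (@continuous_FTC2 _ _ (fun s => - signed_tail s))//=.
- by rewrite opprK addrC.
- by apply: continuous_in_subspaceT => s /set_mem /=; rewrite in_itv/=; exact: ci.
- have cv (s : R) : 0 < s -> - signed_tail t @[t --> s] --> - signed_tail s.
    by move=> s0; exact: is_derive_cvg (is_derive1_opp (signed_tail_derive s0)).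
  split.
  + move=> s; rewrite in_itv/= => /andP[es _].
    have H := is_derive1_opp (signed_tail_derive (lt_trans e0 es)).
    exact: ex_derive.
  + exact/cvg_at_right_filter/cv.
  + exact/cvg_at_left_filter/cv/(lt_trans e0).
- move=> s; rewrite in_itv/= => /andP[es _].
  have H := is_derive1_opp (signed_tail_derive (lt_trans e0 es)).
  by rewrite derive1E derive_val opprK.
Qed.

Let measurable_Yset (p : pred R) : measurable_fun setT (fun w => p (Y w)) ->
  measurable [set w | p (Y w)].
Proof.
by move=> mp; rewrite [X in measurable X](_ : _ = (fun w => p (Y w)) @^-1` [set true]);
  [rewrite -[X in measurable X]setTI; exact: mp|apply/seteqP; split].
Qed.

Let Rintegral_sg : \int[P]_w Num.sg (Y w) =
  1 - fine (P [set w | Y w <= 0]) - fine (P [set w | Y w < 0]).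
Proof.
have mle : measurable [set w | Y w <= 0].
  by apply: (@measurable_Yset (fun y => y <= 0)); apply: measurable_fun_ler.
have mlt : measurable [set w | Y w < 0].
  by apply: (@measurable_Yset (fun y => y < 0)); apply: measurable_fun_ltr.
have -> : (fun w => Num.sg (Y w)) =
    (fun w => (1 - \1_[set w | Y w <= 0] w) - \1_[set w | Y w < 0] w :> R).
  have inb (p : pred R) w : (w \in [set w | p (Y w)]) = p (Y w).
    by apply/idP/idP => [/set_mem|h]//; exact: mem_set.
  apply/funext => w; rewrite sgE !indicE (inb (fun y => y <= 0)) (inb (fun y => y < 0)) leNgt.
  by case: ltrP; rewrite ?subr0 ?subrr.
have I (A : set T) : measurable A -> P.-integrable setT (EFin \o (\1_A : T -> R)).
  by move=> mA; exact: integrable_indic.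
have E (A : set T) : measurable A -> \int[P]_w \1_A w = fine (P A) :> R.
  by move=> mA; rewrite /Rintegral integral_indic// setIT.
rewrite RintegralB//; last 2 first.
- exact: (integrableB _ (P_cst 1) (I _ mle)).
- exact: I.
rewrite RintegralB// ?E//; last exact: I.
rewrite Rintegral_cst// mul1r; do 2 congr (_ - _).
by rewrite -[RHS]/(fine 1%E); congr fine; exact: probability_setT.
Qed.

(** Both limits are limits of [signed_tail] under the expectation, by the bound
    and the limits of [dirichlet_tail]. *)
Lemma gil_pelaez :
  let H := \int[P]_w Num.sg (Y w) * (pi / 2) in
  (forall U, 0 < U -> J eps U @[eps --> 0^'+] --> H - signed_tail U) /\
  signed_tail U @[U --> +oo] --> 0.
Proof.
move=> H; split.
  move=> U U0.
  have st : signed_tail eps @[eps --> 0^'+] --> H.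
    rewrite /H -RintegralZr//; last first.
      by apply: (integrable_le (mu := P) _ measurable_sg _ (P_cst 1)).
    apply: (dominated_cvg_at_right0 (mu := P)
      (f_ := fun s w => Num.sg (Y w) * K (s * `|Y w|)) (g := fun=> pi)) => //.
    - move=> w _; have [Y0|Y0] := eqVneq (Y w) 0.
        by rewrite Y0 sgr0 mul0r; under eq_fun do rewrite mul0r; exact: cvg_cst.
      apply: cvgMr; apply: (@cvg_comp _ _ _ (fun s => s * `|Y w|) K _ (0^'+)); last first.
        exact: dirichlet_tail_cvg0.
      rewrite -normr_gt0 in Y0 => A [e /= e0 eA].
      exists (e / `|Y w|) => /=; first by rewrite divr_gt0.
      move=> s /=; rewrite sub0r normrN => se s0; apply: eA => /=; last exact: mulr_gt0.
      by rewrite sub0r normrN normrM normr_id -ltr_pdivlMr.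
    - by move=> t w t0 _; apply: tail_bound; exact: ltW.
  apply: (cvg_trans _ (cvgB st (cvg_cst (signed_tail U)))).
  apply: near_eq_cvg; near=> e.
  rewrite JE//; apply/andP; split; first by near: e; exact: nbhs_right_gt.
  by near: e; exact: nbhs_right_lt.
apply/cvg_pinftyP => u uy.
have [N _ uN] : \forall n \near \oo, 0 < u n by move/cvgryPgt : uy; exact.
have uN0 n : 0 < u (n + N)%N by apply: uN; rewrite /= leq_addl.
rewrite -(cvg_shiftn N).
suff lim0 : signed_tail (u (n + N)%N) @[n --> \oo] --> \int[P]_w (cst 0 w).
  by rewrite Rintegral_cst// mul0r in lim0.
apply: (dominated_cvgR (mu := P) (f := cst 0)
  (f_ := fun n w => Num.sg (Y w) * K (u (n + N)%N * `|Y w|)) (g := fun=> pi)) => //.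
- by move=> n; exact: measurable_tail.
- move=> w _; have [Y0|Y0] := eqVneq (Y w) 0.
    by rewrite Y0 sgr0; under eq_fun do rewrite mul0r; exact: cvg_cst.
  rewrite -(mulr0 (Num.sg (Y w))); apply: cvgMr.
  rewrite (cvg_shiftn N (fun n => K (u n * `|Y w|))).
  have Kc : K (t * `|Y w|) @[t --> +oo] --> 0.
    apply: (@cvg_comp _ _ _ (fun t => t * `|Y w|) K _ +oo); last exact: dirichlet_tail_cvgy.
    by apply: gt0_cvgMly => //; rewrite normr_gt0.
  by move/cvg_pinftyP : Kc; exact.
- by move=> n w _; apply: tail_bound; exact: ltW.
Unshelve. all: by end_near. Qed.

Theorem gil_pelaez_inversion :
  [/\ forall U, 0 < U -> cvg (J eps U @[eps --> 0^'+]),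
      cvg (lim (J eps U @[eps --> 0^'+]) @[U --> +oo]) &
      lim (lim (J eps U @[eps --> 0^'+]) @[U --> +oo]) =
      (1 - fine (P [set w | Y w <= 0]) - fine (P [set w | Y w < 0])) * (pi / 2)].
Proof.
have [HJ HU] := gil_pelaez; rewrite -Rintegral_sg; set H := (X in _ = X).
have HL : lim (J eps U @[eps --> 0^'+]) @[U --> +oo] --> H.
  rewrite -[X in _ --> X]subr0; apply: (cvg_trans _ (cvgB (cvg_cst H) HU)).
  apply: near_eq_cvg; near=> U.
  by rewrite (cvg_lim _ (HJ U _))//; near: U; exact: nbhs_pinfty_gt.
split.
- by move=> U U0; apply/cvg_ex; eexists; exact: HJ.
- by apply/cvg_ex; exists H.
- exact: cvg_lim HL.
Unshelve. all: by end_near. Qed.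

End GilPelaez.

(** * Uniform approximation by polynomials in a decaying exponential *)

Section Bernstein.
Context {R : realType}.

(** With [phi k = g (k / n)] this is the Bernstein polynomial of [g], as the
    expectation of [phi] under the binomial law, computed by conditioning on the
    first trial; positivity and the variance are then inductions on [n]. *)
Fixpoint bernstein (n : nat) (phi : nat -> R) : {poly R} :=
  if n is n'.+1 then
    (1 - 'X) * bernstein n' phi + 'X * bernstein n' (fun k => phi k.+1)
  else (phi 0%N)%:P.

Lemma bernsteinS n (phi : nat -> R) u : (bernstein n.+1 phi).[u] =
  (1 - u) * (bernstein n phi).[u] + u * (bernstein n (fun k => phi k.+1)).[u].
Proof. by rewrite /= !hornerE. Qed.

Lemma le_bernstein n (phi psi : nat -> R) u : 0 <= u <= 1 ->
  (forall k, (k <= n)%N -> phi k <= psi k) ->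
  (bernstein n phi).[u] <= (bernstein n psi).[u].
Proof.
move=> /andP[u0 u1]; elim: n phi psi => [|n IH] phi psi le.
  by rewrite /= !hornerE; exact: le.
rewrite !bernsteinS lerD// ler_wpM2l ?subr_ge0// IH// => k kn; apply: le => //.
exact: leqW.
Qed.

Lemma bernsteinD n (phi psi : nat -> R) (a b u : R) :
  (bernstein n (fun k => a * phi k + b * psi k)).[u] =
  a * (bernstein n phi).[u] + b * (bernstein n psi).[u].
Proof.
elim: n phi psi => [|n IH] phi psi; first by rewrite /= !hornerE.
by rewrite !bernsteinS IH (IH (fun k => phi k.+1)); ring.
Qed.

Lemma bernstein_cst n (a u : R) : (bernstein n (fun=> a)).[u] = a.
Proof.
elim: n => [|n IH]; first by rewrite /= hornerE.
by rewrite bernsteinS IH; ring.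
Qed.

(** Variance of the binomial law around its mean [n * u], plus squared bias. *)
Lemma bernstein_sqr n (c u : R) :
  (bernstein n (fun k => (k%:R - c) ^+ 2)).[u] =
  n%:R * u * (1 - u) + (n%:R * u - c) ^+ 2.
Proof.
elim: n c => [|n IH] c; first by rewrite /= hornerE; ring.
rewrite bernsteinS IH.
have -> : (fun k : nat => (k.+1%:R - c) ^+ 2) = (fun k => (k%:R - (c - 1)) ^+ 2).
  by apply/funext => k; rewrite -natr1; ring.
by rewrite IH -natr1; ring.
Qed.

(** Chebyshev's argument: a Lipschitz function at distance [t] moves by at most
    [L t <= delta / 2 + L ^ 2 t ^ 2 / (2 delta)], and the mean of the square term is
    a variance. *)
Lemma bernstein_approx (g : R -> R) (L delta : R) : 0 < L -> 0 < delta ->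
  (forall x y, 0 <= x <= 1 -> 0 <= y <= 1 -> `|g x - g y| <= L * `|x - y|) ->
  exists p : {poly R}, forall u, 0 <= u <= 1 -> `|g u - p.[u]| <= delta.
Proof.
move=> L0 d0 gL.
(* For [n] this large the variance term is at most [delta / 2]. *)
pose n := (Num.trunc (L ^+ 2 / delta ^+ 2)).+1.
have n0 : 0 < n%:R :> R by rewrite ltr0n.
have nL : L ^+ 2 / delta ^+ 2 < n%:R by exact: truncnS_gt.
pose phi (k : nat) := g (k%:R / n%:R).
exists (bernstein n phi) => u u01; have /andP[u0 u1] := u01.
pose C := L ^+ 2 / (2 * delta).
pose err (k : nat) := (delta / 2) * 1 + (C / n%:R ^+ 2) * (k%:R - n%:R * u) ^+ 2.
have bnd k : (k <= n)%N -> `|g u - phi k| <= err k.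
  move=> kn.
  have k01 : 0 <= (k%:R / n%:R : R) <= 1.
    by rewrite divr_ge0//= ler_pdivrMr// mul1r ler_nat.
  apply: (le_trans (gL _ _ u01 k01)).
  set t := `|u - _|.
  have -> : err k = delta / 2 + C * t ^+ 2.
    rewrite /err /t real_normK ?num_real//; field.
    by rewrite ?gt_eqF.
  have t0 : 0 <= t by exact: normr_ge0.
  have : 0 <= (L * t - delta) ^+ 2 / (2 * delta).
    by rewrite divr_ge0 ?sqr_ge0// mulr_ge0// ltW.
  have -> : (L * t - delta) ^+ 2 / (2 * delta) = C * t ^+ 2 + delta / 2 - L * t.
    by rewrite /C; field; rewrite gt_eqF.
  by lra.
have Herr : (bernstein n err).[u] <= delta.
  rewrite /err (bernsteinD n (fun=> 1)) bernstein_cst bernstein_sqr subrr expr0n/= addr0.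
  have : C / n%:R ^+ 2 * (n%:R * u * (1 - u)) <= delta / 2.
    have -> : C / n%:R ^+ 2 * (n%:R * u * (1 - u)) = (C / n%:R) * (u * (1 - u)).
      by field; rewrite ?gt_eqF.
    have Cn : C / n%:R <= delta / 2.
      rewrite ler_pdivrMr// /C.
      move: nL; rewrite ltr_pdivrMr ?exprn_gt0// => nL.
      rewrite ler_pdivrMr ?mulr_gt0//.
      have -> : delta / 2 * n%:R * (2 * delta) = n%:R * delta ^+ 2 by field.
      exact: ltW.
    have : u * (1 - u) <= 1 by nra.
    have : 0 <= u * (1 - u) by nra.
    have : 0 <= C / n%:R by rewrite divr_ge0// divr_ge0 ?sqr_ge0// mulr_ge0// ltW.
    by nra.
  lra.
have lo : (bernstein n (fun k => g u - 1 * err k)).[u] <= (bernstein n phi).[u].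
  apply: le_bernstein => // k /bnd; rewrite ler_norml => /andP[]; lra.
have hi : (bernstein n phi).[u] <= (bernstein n (fun k => g u + 1 * err k)).[u].
  apply: le_bernstein => // k /bnd; rewrite ler_norml => /andP[]; lra.
have Eadd (a : R) : (bernstein n (fun k => g u + a * err k)).[u] =
    g u + a * (bernstein n err).[u].
  rewrite -[in LHS](mul1r (g u)) -[in RHS](mul1r (g u)).
  by rewrite (bernsteinD n (fun=> g u)) bernstein_cst.
have lo' : (bernstein n (fun k => g u - 1 * err k)).[u] = g u - (bernstein n err).[u].
  have <- : (fun k => g u + (-1) * err k) = (fun k => g u - 1 * err k).
    by apply/funext => k; rewrite mulN1r mul1r.
  by rewrite Eadd mulN1r.
rewrite lo' in lo; rewrite Eadd mul1r in hi.
by rewrite ler_norml; apply/andP; split; lra.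
Qed.

(** In the variable [v = e^(- x)] the function is [v ^ 2 * cos (- c ln v + theta)].
    The factor [v ^ 2] makes it Lipschitz on [0, 1] despite the singularity of the
    logarithm. *)
Lemma exp_cos_approx (c theta delta : R) : 0 < delta ->
  exists p : {poly R}, forall x, 0 <= x ->
    `|expR (- (x * 2)) * cos (x * c + theta) - p.[expR (- x)]| <= delta.
Proof.
move=> d0.
pose g (v : R) := if v <= 0 then 0 else v ^+ 2 * cos (- ln v * c + theta).
pose L := 2 + `|c|.
have L0 : 0 < L by rewrite ltr_pwDl.
have g0 v : 0 <= v <= 1 -> `|g v| <= L * v.
  move=> /andP[v0 v1]; rewrite /g; case: ifPn => _; first by rewrite normr0 mulr_ge0// ltW.
  rewrite normrM ger0_norm ?sqr_ge0//.
  have : v ^+ 2 * `|cos (- ln v * c + theta)| <= v ^+ 2 * 1.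
    by rewrite ler_wpM2l ?sqr_ge0// normr_cos_le1.
  have := normr_ge0 c; rewrite /L; nra.
have gpos x y : 0 < x -> x < y -> y <= 1 -> `|g x - g y| <= L * `|x - y|.
  move=> x0 xy y1.
  pose G (v : R) := v * v * cos (- ln v * c + theta).
  pose dG (v : R) := (v * 2) * cos (- ln v * c + theta)
     + v ^+ 2 * (- sin (- ln v * c + theta) * (- v^-1 * c)).
  have D (v : R) : 0 < v -> is_derive v (1:R) G (dG v).
    move=> v0.
    have H1 := is_derive1_mul (is_derive_id v (1:R)) (is_derive_id v (1:R)).
    have H2 := is_derive1_mul (is_derive1_opp (is_derive1_ln v0)) (is_derive1_cst c v).
    have H3 := is_derive1_cos (is_derive1_add H2 (is_derive1_cst theta v)).
    apply: (is_derive_eq (is_derive1_mul H1 H3)).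
    by rewrite /dG expr2; ring.
  have [||z] := @MVT _ G dG x y xy.
  - by move=> z; rewrite in_itv/= => /andP[xz _]; apply: D; exact: lt_trans xz.
  - apply: derivable_within_continuous => v; rewrite in_itv/= => /andP[xv _].
    have H := D v (lt_le_trans x0 xv); exact: ex_derive.
  rewrite in_itv/= => /andP[xz zy] E.
  have gE v : 0 < v -> g v = G v by move=> v0; rewrite /g leNgt v0 expr2.
  have z0 : 0 < z by exact: lt_trans xz.
  rewrite distrC [X in _ <= _ * X]distrC (gE _ x0) (gE _ (lt_trans x0 xy)) E normrM.
  rewrite ler_wpM2r//.
  have -> : dG z = z * (2 * cos (- ln z * c + theta) + c * sin (- ln z * c + theta)).
    by rewrite /dG; field; rewrite gt_eqF.
  rewrite normrM (gtr0_norm z0).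
  have H : `|2 * cos (- ln z * c + theta) + c * sin (- ln z * c + theta)| <= L.
    rewrite (le_trans (ler_normD _ _))// lerD//.
      by rewrite normrM ger0_norm// ler_piMr// normr_cos_le1.
    by rewrite normrM ler_piMr// normr_sin_le1.
  rewrite -[leRHS]mul1r ler_pM//; first exact: ltW.
  by rewrite ltW// (lt_le_trans zy).
have gL x y : 0 <= x <= 1 -> 0 <= y <= 1 -> `|g x - g y| <= L * `|x - y|.
  wlog : x y / x <= y.
    move=> H x01 y01; have [xy|/ltW yx] := leP x y; first exact: H.
    by rewrite distrC [X in _ <= _ * X]distrC; exact: H.
  rewrite le_eqVlt => /predU1P[->|xy] x01 y01.
    by rewrite !subrr normr0 mulr0.
  move: x01 => /andP[]; rewrite le_eqVlt => /predU1P[x0 _|x0 x1]; last first.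
    by apply: gpos => //; case/andP: y01.
  rewrite -x0 sub0r normrN (ger0_norm (andP y01).1).
  have -> : g 0 = 0 by rewrite /g lexx.
  by rewrite sub0r normrN; exact: g0.
have [p Hp] := bernstein_approx L0 d0 gL.
exists p => x x0.
have := Hp (expR (- x)); rewrite expR_ge0 expRN_le1// => /(_ isT).
suff -> : g (expR (- x)) = expR (- (x * 2)) * cos (x * c + theta) by [].
rewrite /g leNgt expR_gt0/= expRK opprK expr2 -expRD; congr (expR _ * _); ring.
Qed.

End Bernstein.

(** * Integrals against a Levy measure *)

Section MeasurableComp.
Context {R : realType} {d : measure_display} {T : measurableType d} (D : set T).
Implicit Type f : T -> R.

Lemma measurable_fun_exp f : measurable_fun D f -> measurable_fun D (fun x => expR (f x)).
Proof. exact: measurableT_comp. Qed.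

Lemma measurable_fun_opp f : measurable_fun D f -> measurable_fun D (fun x => - f x).
Proof. exact: measurableT_comp. Qed.

Lemma measurable_fun_sin f : measurable_fun D f -> measurable_fun D (fun x => sin (f x)).
Proof.
by apply: measurableT_comp; apply: continuous_measurable_fun; exact: continuous_sin.
Qed.

Lemma measurable_fun_cos f : measurable_fun D f -> measurable_fun D (fun x => cos (f x)).
Proof.
by apply: measurableT_comp; apply: continuous_measurable_fun; exact: continuous_cos.
Qed.

Lemma measurable_fun_horner (p : {poly R}) f : measurable_fun D f ->
  measurable_fun D (fun x => p.[f x]).
Proof.
by apply: measurableT_comp; apply: continuous_measurable_fun; exact: continuous_horner.
Qed.

Lemma measurable_fun_norm f : measurable_fun D f -> measurable_fun D (fun x => `|f x|).
Proof. exact: measurableT_comp. Qed.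

End MeasurableComp.

Ltac measurability :=
  lazymatch goal with
  | |- forall _, _ => intro; measurability
  | |- measurable_fun _ (fun x => expR _) => apply: measurable_fun_exp; measurability
  | |- measurable_fun _ (fun x => sin _) => apply: measurable_fun_sin; measurability
  | |- measurable_fun _ (fun x => cos _) => apply: measurable_fun_cos; measurability
  | |- measurable_fun _ (fun x => `|_|) => apply: measurable_fun_norm; measurability
  | |- measurable_fun _ (fun x => (_ - _)%R) => apply: measurable_funB; measurability
  | |- measurable_fun _ (fun x => (- _)%R) => apply: measurable_fun_opp; measurability
  | |- measurable_fun _ (fun x => (_ * _)%R) => apply: measurable_funM; measurability
  | |- measurable_fun _ (fun x => (_ + _)%R) => apply: measurable_funD; measurability
  | |- measurable_fun _ (fun x => _.[_]) => apply: measurable_fun_horner; measurability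
  | |- measurable_fun _ (fun x => _) => first [done | exact: measurable_cst | assumption]
  | |- _ => first [done | assumption]
  end.

Section LevyBounds.
Context {R : realType}.
Implicit Types x a b : R.

(** All integrability against a Levy measure is reduced to that of
    [Num.min 1 w]. *)
Lemma le_min1 (a b x y : R) : 0 <= a -> 0 <= b -> 0 <= x -> y <= a -> y <= b * x ->
  y <= (a + b) * Num.min 1 x.
Proof. by move=> a0 b0 x0 ya yb; rewrite minEle; case: ifPn => _; nra. Qed.

Lemma min1_le_exp x : 0 <= x -> Num.min 1 x <= 2 * (1 - expR (- x)).
Proof.
move=> x0.
have e1 : expR (- x) * (1 + x) <= 1.
  rewrite expRN mulrC ler_pdivrMr ?expR_gt0// mul1r; exact: expR_ge1Dx.
have e0 : 0 < expR (- x) by exact: expR_gt0.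
rewrite minEle; case: ifPn => [h|]; first by nra.
rewrite -ltNge => h.
have : 0 <= (2 * (1 - expR (- x)) - x) * (1 + x) by nra.
by rewrite pmulr_lge0 ?subr_ge0//; lra.
Qed.

Lemma one_sub_exp_le_min1 (l x : R) : 0 <= l -> 0 <= x ->
  `|1 - expR (- (l * x))| <= (1 + l) * Num.min 1 x.
Proof.
move=> l0 x0; have lx0 : 0 <= l * x by exact: mulr_ge0.
rewrite ger0_norm ?subr_ge0 ?expRN_le1//; apply: le_min1 => //.
by have := expR_ge1Dx (- (l * x)); lra.
Qed.

Lemma mul_exp_le_min1 (l x : R) : 0 < l -> 0 <= x ->
  `|x * expR (- (l * x))| <= (l^-1 + 1) * Num.min 1 x.
Proof.
move=> l0 x0; have lx0 : 0 <= l * x by apply: mulr_ge0 => //; exact: ltW.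
rewrite ger0_norm ?mulr_ge0 ?expR_ge0//; apply: le_min1 => //.
- by rewrite invr_ge0 ltW.
- rewrite -(@ler_pM2l _ l)// mulfV ?gt_eqF// mulrA; exact: mul_expRN_le.
- by rewrite mul1r ler_piMr// expRN_le1.
Qed.

Lemma sin_le_min1 (s x : R) : 0 <= x -> `|sin (s * x)| <= (1 + `|s|) * Num.min 1 x.
Proof.
move=> x0; apply: le_min1 => //; first exact: normr_sin_le1.
by rewrite (le_trans (normr_sin_le _))// normrM (ger0_norm x0).
Qed.

Lemma one_sub_cos_le_min1 (s x : R) : 0 <= x ->
  `|1 - cos (s * x)| <= (2 + `|s|) * Num.min 1 x.
Proof.
move=> x0; rewrite ger0_norm ?subr_ge0 ?cos_le1//; apply: le_min1 => //.
  by have := cos_geN1 (s * x); lra.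
by rewrite (le_trans (one_sub_cos_le _))// normrM (ger0_norm x0).
Qed.

End LevyBounds.

Section LevyIntegrals.
Context {R : realType} {d : measure_display} {T : measurableType d}.
Variables (m : {measure set T -> \bar R}) (D : set T) (w : T -> R).
Hypotheses (mD : measurable D) (mw : measurable_fun D w)
  (w0 : forall y, D y -> 0 <= w y)
  (iw : m.-integrable D (EFin \o (fun y => 1 - expR (- w y)))).

Lemma integrable_min1 : m.-integrable D (EFin \o (fun y => Num.min 1 (w y))).
Proof.
apply: (integrable_le (mu := m) (g := fun y => 2 * (1 - expR (- w y)))) => //.
- by apply: measurable_minr.
- move=> y Dy; rewrite ger0_norm ?le_min ?ler01 ?w0//.
  by apply: min1_le_exp; exact: w0.
- exact: (integrableZl _ _ iw).
Qed.

Lemma integrable_le_min1 (f : T -> R) (C : R) : measurable_fun D f ->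
  (forall y, D y -> `|f y| <= C * Num.min 1 (w y)) -> m.-integrable D (EFin \o f).
Proof.
move=> mf fC.
apply: (integrable_le (mu := m) (g := fun y => C * Num.min 1 (w y))) => //.
exact: (integrableZl _ _ integrable_min1).
Qed.

Lemma integrable_levy_exp (l : R) : 0 <= l ->
  m.-integrable D (EFin \o (fun y => 1 - expR (- (l * w y)))).
Proof.
move=> l0; apply: (@integrable_le_min1 _ (1 + l)); first by measurability.
by move=> y Dy; apply: one_sub_exp_le_min1 => //; exact: w0.
Qed.

Lemma integrable_levy_mul_exp (l : R) : 0 < l ->
  m.-integrable D (EFin \o (fun y => w y * expR (- (l * w y)))).
Proof.
move=> l0; apply: (@integrable_le_min1 _ (l^-1 + 1)); first by measurability.
by move=> y Dy; apply: mul_exp_le_min1 => //; exact: w0.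
Qed.

Lemma integrable_levy_mul (l : R) (f : T -> R) : 0 < l -> measurable_fun D f ->
  (forall y, `|f y| <= 1) ->
  m.-integrable D (EFin \o (fun y => w y * expR (- (l * w y)) * f y)).
Proof.
move=> l0 mf f1; apply: (@integrable_le_min1 _ (l^-1 + 1)); first by measurability.
move=> y Dy; rewrite normrM (le_trans _ (mul_exp_le_min1 l0 (w0 Dy)))//.
exact: ler_piMr.
Qed.

Lemma integrable_levy_sin (l s : R) : 0 <= l ->
  m.-integrable D (EFin \o (fun y => expR (- (l * w y)) * sin (s * w y))).
Proof.
move=> l0; apply: (@integrable_le_min1 _ (1 + `|s|)); first by measurability.
move=> y Dy; rewrite normrM (le_trans _ (sin_le_min1 s (w0 Dy)))//.
by rewrite ger0_norm ?expR_ge0// ler_piMl// expRN_le1// mulr_ge0// w0.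
Qed.

Lemma integrable_levy_cos (l s : R) : 0 <= l ->
  m.-integrable D (EFin \o (fun y => expR (- (l * w y)) * (1 - cos (s * w y)))).
Proof.
move=> l0; apply: (@integrable_le_min1 _ (2 + `|s|)); first by measurability.
move=> y Dy; rewrite normrM (le_trans _ (one_sub_cos_le_min1 s (w0 Dy)))//.
by rewrite ger0_norm ?expR_ge0// ler_piMl// expRN_le1// mulr_ge0// w0.
Qed.

Lemma levy_exp_derive (l : R) : 0 < l ->
  is_derive l (1:R) (fun l => \int[m]_(y in D) (1 - expR (- (l * w y))))
    (\int[m]_(y in D) (w y * expR (- (l * w y)))).
Proof.
move=> l0.
apply: (@is_derive_Rintegral _ _ _ m D _ (fun l y => w y * expR (- (l * w y)))
  (fun y => w y * expR (- (l / 2 * w y))) l (l / 2) (l * 2)) => //.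
- by apply/andP; split; lra.
- by move=> x /andP[x0 _]; apply: integrable_levy_exp; lra.
- move=> x y _ Dy.
  apply: (is_derive_eq (is_derive1_add (is_derive1_cst 1 x)
    (is_derive1_opp (is_derive1_exp (is_derive1_opp (is_derive1_lin (w y) x)))))).
  by ring.
- move=> x y /andP[x0 _] Dy; rewrite ger0_norm ?mulr_ge0 ?expR_ge0 ?w0//.
  by rewrite ler_wpM2l ?w0// ler_expR lerN2 ler_wpM2r ?w0// ltW.
- by apply: integrable_levy_mul_exp; lra.
Qed.

Lemma levy_sin_derive (l s : R) : 0 < l ->
  is_derive s (1:R) (fun s => \int[m]_(y in D) (expR (- (l * w y)) * sin (s * w y)))
    (\int[m]_(y in D) (w y * expR (- (l * w y)) * cos (s * w y))).
Proof.
move=> l0.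
apply: (@is_derive_Rintegral _ _ _ m D _
  (fun s y => w y * expR (- (l * w y)) * cos (s * w y))
  (fun y => w y * expR (- (l * w y))) s (s - 1) (s + 1)) => //.
- by apply/andP; split; lra.
- by move=> x _; apply: integrable_levy_sin; exact: ltW.
- move=> x y _ Dy.
  apply: (is_derive_eq (is_derive1_mul (is_derive1_cst (expR (- (l * w y))) x)
    (is_derive1_sin (is_derive1_lin (w y) x)))).
  by ring.
- move=> x y _ Dy; rewrite normrM [X in X * _]ger0_norm ?mulr_ge0 ?expR_ge0 ?w0//.
  by rewrite ler_piMr ?mulr_ge0 ?expR_ge0 ?w0 ?normr_cos_le1.
- exact: integrable_levy_mul_exp.
Qed.

Lemma levy_cos_derive (l s : R) : 0 < l ->
  is_derive s (1:R) (fun s => \int[m]_(y in D) (expR (- (l * w y)) * (1 - cos (s * w y))))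
    (\int[m]_(y in D) (w y * expR (- (l * w y)) * sin (s * w y))).
Proof.
move=> l0.
apply: (@is_derive_Rintegral _ _ _ m D _
  (fun s y => w y * expR (- (l * w y)) * sin (s * w y))
  (fun y => w y * expR (- (l * w y))) s (s - 1) (s + 1)) => //.
- by apply/andP; split; lra.
- by move=> x _; apply: integrable_levy_cos; exact: ltW.
- move=> x y _ Dy.
  apply: (is_derive_eq (is_derive1_mul (is_derive1_cst (expR (- (l * w y))) x)
    (is_derive1_add (is_derive1_cst 1 x)
      (is_derive1_opp (is_derive1_cos (is_derive1_lin (w y) x)))))).
  by ring.
- move=> x y _ Dy; rewrite normrM [X in X * _]ger0_norm ?mulr_ge0 ?expR_ge0 ?w0//.
  by rewrite ler_piMr ?mulr_ge0 ?expR_ge0 ?w0 ?normr_sin_le1.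
- exact: integrable_levy_mul_exp.
Qed.

End LevyIntegrals.

(** * From Laplace transforms to Fourier transforms *)

Section LaplaceToFourier.
Context {R : realType} {d : measure_display} {T : measurableType d}.
Context {d' : measure_display} {T' : measurableType d'}.
Variables (P : probability T R) (W X : T -> R) (B : R).
Hypotheses (mW : measurable_fun setT W) (WB : forall t, `|W t| <= B).
Hypotheses (mX : measurable_fun setT X) (X0 : forall t, 0 <= X t).
Variables (m : {measure set T' -> \bar R}) (D : set T') (w : T' -> R).
Hypotheses (mD : measurable D) (mw : measurable_fun D w)
  (w0 : forall y, D y -> 0 <= w y)
  (iw : m.-integrable D (EFin \o (fun y => 1 - expR (- w y)))).
Variable c : R.
Hypothesis laplaceE : forall l, 0 < l ->
  \int[P]_t (W t * expR (- (l * X t))) =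
  c * expR (- \int[m]_(y in D) (1 - expR (- (l * w y)))).

Let B0 : 0 <= B. Proof. exact: le_trans (normr_ge0 (W point)) (WB point). Qed.

Let P_cst (a : R) : P.-integrable setT (EFin \o (fun=> a)).
Proof. exact: finite_measure_integrable_cst. Qed.

Let P_bounded (f : T -> R) (C : R) : measurable_fun setT f -> (forall t, `|f t| <= C) ->
  P.-integrable setT (EFin \o f).
Proof.
by move=> mf fC; apply: (integrable_le (mu := P) _ mf _ (P_cst C)).
Qed.

Let W_bounded (f : T -> R) (C : R) : measurable_fun setT f -> (forall t, `|f t| <= C) ->
  P.-integrable setT (EFin \o (fun t => W t * f t)).
Proof.
move=> mf fC; apply: (@P_bounded _ (B * C)); first by measurability.
by move=> t; rewrite normrM ler_pM.
Qed.

Let exp_bounded (l : R) t : 0 <= l -> `|expR (- (l * X t))| <= 1.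
Proof. by move=> l0; rewrite ger0_norm ?expR_ge0// expRN_le1// mulr_ge0. Qed.

Let X_exp_bounded (l : R) t : 0 < l -> `|X t * expR (- (l * X t))| <= l^-1.
Proof.
move=> l0; rewrite ger0_norm ?mulr_ge0 ?expR_ge0//.
by rewrite -(@ler_pM2l _ l)// mulfV ?gt_eqF// mulrA mul_expRN_le.
Qed.

Let E (l : R) (f : T -> R) : R := \int[P]_t (W t * (expR (- (l * X t)) * f t)).
Let EX (l : R) (f : T -> R) : R := \int[P]_t (W t * (X t * expR (- (l * X t)) * f t)).

Let int_E (l : R) (f : T -> R) (C : R) : 0 <= l -> measurable_fun setT f -> (forall t, `|f t| <= C) ->
  P.-integrable setT (EFin \o (fun t => W t * (expR (- (l * X t)) * f t))).
Proof.
move=> l0 mf f1; apply: (@W_bounded _ C); first by measurability.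
by move=> t; rewrite normrM -[leRHS]mul1r ler_pM// exp_bounded.
Qed.

Let int_EX (l : R) (f : T -> R) (C : R) : 0 < l -> measurable_fun setT f -> (forall t, `|f t| <= C) ->
  P.-integrable setT (EFin \o (fun t => W t * (X t * expR (- (l * X t)) * f t))).
Proof.
move=> l0 mf f1; apply: (@W_bounded _ (l^-1 * C)); first by measurability.
by move=> t; rewrite normrM ler_pM// X_exp_bounded.
Qed.

Let eq_of_le_mul (x y C : R) : (forall e, 0 < e -> `|x - y| <= e * C) -> x = y.
Proof.
move=> H; apply/eqP; rewrite -subr_eq0 -normr_eq0; apply/eqP/le_anti.
rewrite normr_ge0 andbT; apply/ler_addgt0Pr => e e0; rewrite add0r.
have C1 : 0 < `|C| + 1 by rewrite ltr_wpDl.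
apply: (le_trans (H _ (divr_gt0 e0 C1))).
rewrite -mulrA ger_pMr// mulrC ler_pdivrMr// mul1r.
by rewrite (le_trans (ler_norm C))// lerDl.
Qed.

Let levy_mean (l : R) : R := \int[m]_(y in D) (w y * expR (- (l * w y))).

(** Two computations of the derivative of the Laplace transform: under the
    expectation, and from the exponential formula. *)
Lemma laplace_derivE (l : R) : 0 < l ->
  \int[P]_t (W t * (X t * expR (- (l * X t)))) =
  levy_mean l * \int[P]_t (W t * expR (- (l * X t))).
Proof.
move=> l0.
pose F l := \int[P]_t (W t * expR (- (l * X t))).
pose psi l := \int[m]_(y in D) (1 - expR (- (l * w y))).
have D1 : is_derive l (1:R) F (\int[P]_t (W t * (- X t * expR (- (l * X t))))).
  apply: (@is_derive_Rintegral _ _ _ P setT _ (fun l t => W t * (- X t * expR (- (l * X t))))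
    (fun=> B * (l / 2)^-1) l (l / 2) (l * 2)) => //.
  - by apply/andP; split; lra.
  - move=> x /andP[x0 _]; apply: (@W_bounded _ 1); first by measurability.
    by move=> t; apply: exp_bounded; lra.
  - move=> x t _ _.
    apply: (is_derive_eq (is_derive1_mul (is_derive1_cst (W t) x)
      (is_derive1_exp (is_derive1_opp (is_derive1_lin (X t) x))))).
    by ring.
  - move=> x t /andP[x0 _] _; have x0' : 0 < x by lra.
    rewrite mulNr mulrN normrN normrM ler_pM// (le_trans (X_exp_bounded t x0'))//.
    by rewrite lef_pV2 ?posrE; lra.
have D2 : is_derive l (1:R) F (- levy_mean l * F l).
  have H := is_derive1_mul (is_derive1_cst c l)
    (is_derive1_exp (is_derive1_opp (levy_exp_derive mD mw w0 iw l0))).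
  have nF : \forall z \near l, c * expR (- psi z) = F z.
    near=> z; apply/esym/laplaceE; near: z; exact: lt_nbhsr.
  have H' : is_derive l (1:R) F (- levy_mean l * (c * expR (- psi l))).
    apply: (near_eq_is_derive nF).
    by apply: (is_derive_eq H); rewrite /levy_mean /psi; ring.
  by apply: (is_derive_eq H'); rewrite /F laplaceE.
have := @derive_val _ _ _ _ _ _ _ D1; rewrite (@derive_val _ _ _ _ _ _ _ D2).
have -> : \int[P]_t (W t * (- X t * expR (- (l * X t)))) =
    - \int[P]_t (W t * (X t * expR (- (l * X t)))).
  rewrite -mulN1r -RintegralZl//.
    by apply: eq_Rintegral => t _; ring.
  by apply: (@W_bounded _ l^-1); [measurability|move=> t; exact: X_exp_bounded].
by rewrite mulNr => /oppr_inj.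
Unshelve. all: by end_near. Qed.

Let u_ (kappa t : R) : R := expR (- (kappa * t)).

(** [laplace_derivE] at [l + j * kappa] says that, against the measure
    [w e^(- l w) dm], the variable [X] is shifted by an independent jump [w]:
    [E (X e^(- l X) p (X)) = int w e^(- l w) E (e^(- l X) p (X + w))].  By linearity it
    holds for polynomials [p] in [e^(- kappa X)].  [H] is the inner expectation as a
    function of the jump; it is named because its measurability comes with the
    induction. *)
Let poly_convolution (kappa : R) (p : {poly R}) (l : R) : 0 < kappa -> 0 < l ->
  exists H : R -> R, exists C : R,
  [/\ measurable_fun setT H, forall y, 0 <= y -> `|H y| <= C,
      forall y, 0 <= y -> E l (fun t => p.[u_ kappa (X t + y)]) = H y &
      EX l (fun t => p.[u_ kappa (X t)]) =
      \int[m]_(y in D) (w y * expR (- (l * w y)) * H (w y))].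
Proof.
move=> k0; elim/poly_ind: p l => [|p a IH] l l0.
  exists (cst 0), 0; split => //.
  - by move=> y _; rewrite normr0.
  - move=> y _; rewrite /E; under eq_Rintegral do rewrite horner0 !mulr0.
    by rewrite Rintegral_cst// mul0r.
  - rewrite /EX; under eq_Rintegral do rewrite horner0 !mulr0.
    under [RHS]eq_Rintegral do rewrite mulr0.
    by rewrite !Rintegral_cst// !mul0r.
have lk0 : 0 < l + kappa by exact: addr_gt0.
have [H [C [mH HC HE HX]]] := IH (l + kappa) lk0.
have uD (x y : R) : u_ kappa (x + y) = u_ kappa x * u_ kappa y.
  by rewrite /u_ mulrDr opprD expRD.
have uE (x : R) : expR (- (l * x)) * u_ kappa x = expR (- ((l + kappa) * x)).
  by rewrite /u_ -expRD mulrDl opprD.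
have mu (y : R) : measurable_fun setT (fun t => u_ kappa (X t + y)).
  by rewrite /u_; measurability.
have mu0 : measurable_fun setT (fun t => u_ kappa (X t)).
  by rewrite /u_; measurability.
have pb : exists Cp, forall v, 0 <= v <= 1 -> `|p.[v]| <= Cp.
  elim/poly_ind: p {IH H C mH HC HE HX} => [|p b [Cp Hp]].
    by exists 0 => v _; rewrite horner0 normr0.
  exists (Cp + `|b|) => v v01; have /andP[v0 v1] := v01.
  rewrite hornerMXaddC (le_trans (ler_normD _ _))// lerD2r normrM.
  rewrite -[leRHS]mulr1 ler_pM ?Hp// ger0_norm//.
have [Cp Hp] := pb.
have ub (x : R) : 0 <= x -> 0 <= u_ kappa x <= 1.
  by move=> x0; rewrite expR_ge0 expRN_le1// mulr_ge0// ltW.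
pose Em := \int[P]_t (W t * expR (- (l * X t))).
exists (fun y => u_ kappa y * H y + a * Em), (C + `|a * Em|); split.
- by rewrite /u_; measurability.
- move=> y y0; rewrite (le_trans (ler_normD _ _))// lerD2r normrM.
  rewrite -[leRHS]mul1r ler_pM ?HC//.
  by have /andP[h0 h1] := ub _ y0; rewrite ger0_norm.
- move=> y y0; rewrite -HE// /E /Em.
  have mpy : measurable_fun setT (fun t => p.[u_ kappa (X t + y)]).
    exact: measurable_fun_horner.
  have mpb t : `|p.[u_ kappa (X t + y)]| <= Cp by apply: Hp; apply: ub; rewrite addr_ge0.
  rewrite -!RintegralZl//; last 2 first.
  + by apply: (@W_bounded _ 1); [measurability|move=> t; apply: exp_bounded; exact: ltW].
  + by apply: int_E mpb => //; exact: ltW.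
  rewrite -RintegralD//; last 2 first.
  + apply: integrable_mulrl => //.
    by apply: int_E mpb => //; exact: ltW.
  + apply: integrable_mulrl => //.
    by apply: (@W_bounded _ 1); [measurability|move=> t; apply: exp_bounded; exact: ltW].
  apply: eq_Rintegral => t _; rewrite hornerMXaddC -uE uD; ring.
rewrite /EX.
have mp : measurable_fun setT (fun t => p.[u_ kappa (X t)]) by exact: measurable_fun_horner.
have mpb t : `|p.[u_ kappa (X t)]| <= Cp by apply: Hp; apply: ub.
have -> : \int[P]_t (W t * (X t * expR (- (l * X t)) * (p * 'X + a%:P).[u_ kappa (X t)])) =
    EX (l + kappa) (fun t => p.[u_ kappa (X t)]) +
    a * \int[P]_t (W t * (X t * expR (- (l * X t)))).
  have i1 : P.-integrable setT (EFin \o (fun t => W t * (X t * expR (- (l * X t))))).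
    by apply: (@W_bounded _ l^-1); [measurability|move=> t; exact: X_exp_bounded].
  rewrite /EX -RintegralZl// -RintegralD//; last 2 first.
  + exact: int_EX mpb.
  + apply: integrable_mulrl => //.
  apply: eq_Rintegral => t _; rewrite hornerMXaddC -uE; ring.
rewrite HX laplace_derivE//.
have i2 : m.-integrable D (EFin \o (fun y => w y * expR (- ((l + kappa) * w y)) * H (w y))).
  apply: (integrable_le (mu := m)
    (g := fun y => C * (w y * expR (- ((l + kappa) * w y))))) => //.
  + by apply: measurable_funM; [measurability|exact: measurableT_comp].
  + move=> y Dy; rewrite normrM mulrC ler_pM ?HC ?w0//.
    by rewrite ger0_norm// mulr_ge0 ?expR_ge0 ?w0.
  + by apply: integrable_mulrl => //; apply: integrable_levy_mul_exp.
have i3 : m.-integrable D (EFin \o (fun y => w y * expR (- (l * w y)))).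
  exact: integrable_levy_mul_exp.
have -> : a * (levy_mean l * \int[P]_t (W t * expR (- (l * X t)))) = (a * Em) * levy_mean l.
  by rewrite /Em; ring.
rewrite /levy_mean -RintegralZl// -RintegralD//; last apply: integrable_mulrl => //.
by apply: eq_Rintegral => y _; rewrite -uE; ring.
Qed.

Let Ecos (l s theta : R) : R := E l (fun t => cos (s * X t + theta)).
Let Esin (l s theta : R) : R := E l (fun t => sin (s * X t + theta)).

Let levy_cos (l s : R) : R := \int[m]_(y in D) (w y * expR (- (l * w y)) * cos (s * w y)).
Let levy_sin (l s : R) : R := \int[m]_(y in D) (w y * expR (- (l * w y)) * sin (s * w y)).

(** Half of the exponential weight is spent on making [e^(- l X / 2) cos (s X)]
    uniformly approximable by polynomials in [e^(- l X / 4)], for which the shift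
    identity is known; the other half keeps the errors integrable.  The addition
    formula for [cos (s * (X + w) + theta)] then gives the right-hand side. *)
Lemma fourier_derivE (l s theta : R) : 0 < l ->
  EX l (fun t => cos (s * X t + theta)) =
  levy_cos l s * Ecos l s theta - levy_sin l s * Esin l s theta.
Proof.
move=> l0; pose kappa := l / 4; pose l2 := l / 2.
have k0 : 0 < kappa by rewrite /kappa; lra.
have l20 : 0 < l2 by rewrite /l2; lra.
pose G (x : R) := expR (- (l2 * x)) * cos (s * x + theta).
have GE (x : R) : expR (- (l2 * x)) * G x = expR (- (l * x)) * cos (s * x + theta).
  by rewrite /G mulrA -expRD; congr (expR _ * _); rewrite /l2; field.
have G1 (x : R) : 0 <= x -> `|G x| <= 1.
  move=> x0; rewrite /G normrM -[leRHS]mulr1 ler_pM ?normr_cos_le1//.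
  by rewrite ger0_norm ?expR_ge0// expRN_le1// mulr_ge0// ltW.
pose HG (y : R) := expR (- (l2 * y)) *
  (cos (s * y) * Ecos l s theta - sin (s * y) * Esin l s theta).
have mcos : measurable_fun setT (fun t => cos (s * X t + theta)) by measurability.
have msin : measurable_fun setT (fun t => sin (s * X t + theta)) by measurability.
have icos : P.-integrable setT (EFin \o (fun t => W t * (expR (- (l * X t)) * cos (s * X t + theta)))).
  by apply: int_E mcos (fun t => normr_cos_le1 _); exact: ltW.
have isin : P.-integrable setT (EFin \o (fun t => W t * (expR (- (l * X t)) * sin (s * X t + theta)))).
  by apply: int_E msin (fun t => normr_sin_le1 _); exact: ltW.
have HGE (y : R) : E l2 (fun t => G (X t + y)) = HG y.
  rewrite /HG mulrBr !mulrA /Ecos /Esin /E -!RintegralZl// -RintegralB//; last 2 first.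
  + apply: integrable_mulrl => //.
  + apply: integrable_mulrl => //.
  apply: eq_Rintegral => t _.
  have -> : expR (- (l * X t)) = expR (- (l2 * X t)) * expR (- (l2 * X t)).
    by rewrite -expRD; congr expR; rewrite /l2; field.
  rewrite /G mulrDr opprD expRD.
  have -> : s * (X t + y) + theta = (s * X t + theta) + s * y by ring.
  by rewrite cosD; ring.
have iHG : m.-integrable D (EFin \o (fun y => w y * expR (- (l2 * w y)) * HG (w y))).
  apply: (integrable_le (mu := m) (g := fun y =>
    (`|Ecos l s theta| + `|Esin l s theta|) * (w y * expR (- (l2 * w y))))) => //.
  + by rewrite /HG; measurability.
  + move=> y Dy; rewrite normrM mulrC ler_pM//; last first.
      by rewrite ger0_norm// mulr_ge0 ?expR_ge0 ?w0.
    rewrite /HG normrM -[leRHS]mul1r ler_pM//.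
      by rewrite ger0_norm ?expR_ge0// expRN_le1// mulr_ge0 ?w0// ltW.
    rewrite (le_trans (ler_normB _ _))// !normrM lerD// ler_piMl//.
      exact: normr_cos_le1.
    exact: normr_sin_le1.
  + by apply: integrable_mulrl => //;
      apply: integrable_levy_mul_exp.
have -> : EX l (fun t => cos (s * X t + theta)) = EX l2 (fun t => G (X t)).
  rewrite /EX; apply: eq_Rintegral => t _.
  by rewrite -[in LHS]mulrA -GE; ring.
have -> : levy_cos l s * Ecos l s theta - levy_sin l s * Esin l s theta =
    \int[m]_(y in D) (w y * expR (- (l2 * w y)) * HG (w y)).
  rewrite /levy_cos /levy_sin -!RintegralZr//; last 2 first.
  + by apply: (@integrable_levy_mul _ _ _ m D w _ _ _ _ l (fun y => sin (s * w y))) => //;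
      [measurability|move=> y; exact: normr_sin_le1].
  + by apply: (@integrable_levy_mul _ _ _ m D w _ _ _ _ l (fun y => cos (s * w y))) => //;
      [measurability|move=> y; exact: normr_cos_le1].
  rewrite -RintegralB//; last 2 first.
  + apply: integrable_mulrr => //.
    by apply: (@integrable_levy_mul _ _ _ m D w _ _ _ _ l (fun y => cos (s * w y))) => //;
      [measurability|move=> y; exact: normr_cos_le1].
  + apply: integrable_mulrr => //.
    by apply: (@integrable_levy_mul _ _ _ m D w _ _ _ _ l (fun y => sin (s * w y))) => //;
      [measurability|move=> y; exact: normr_sin_le1].
  apply: eq_Rintegral => y _.
  have -> : expR (- (l * w y)) = expR (- (l2 * w y)) * expR (- (l2 * w y)).
    by rewrite -expRD; congr expR; rewrite /l2; field.
  by rewrite /HG; ring.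
apply: (@eq_of_le_mul _ _ (B * l2^-1 + B * levy_mean l2)) => e e0.
have [p Hp] := exp_cos_approx (s / kappa) theta e0.
have {}Hp x : 0 <= x -> `|G x - p.[u_ kappa x]| <= e.
  move=> x0; have := Hp (kappa * x); rewrite mulr_ge0 ?(ltW k0)// => /(_ isT).
  rewrite /G /u_; congr (`|expR _ * cos _ - _| <= _); rewrite /kappa /l2; field;
    by rewrite ?gt_eqF.
have [H [C [mH HC HE HX]]] := poly_convolution p k0 l20.
have mG : measurable_fun setT (fun t => G (X t)) by rewrite /G; measurability.
have mp : measurable_fun setT (fun t => p.[u_ kappa (X t)]) by rewrite /u_; measurability.
have pB (x : R) : 0 <= x -> `|p.[u_ kappa x]| <= 1 + e.
  move=> x0; rewrite -[p.[_]](subrK (G x)) (le_trans (ler_normD _ _))// addrC.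
  by rewrite lerD ?G1// distrC Hp.
have iH : m.-integrable D (EFin \o (fun y => w y * expR (- (l2 * w y)) * H (w y))).
  apply: (integrable_le (mu := m) (g := fun y => C * (w y * expR (- (l2 * w y))))) => //.
  + by apply: measurable_funM; [measurability|exact: measurableT_comp].
  + move=> y Dy; rewrite normrM mulrC ler_pM ?HC ?w0//.
    by rewrite ger0_norm// mulr_ge0 ?expR_ge0 ?w0.
  + by apply: integrable_mulrl => //; apply: integrable_levy_mul_exp.
have d1 : `|EX l2 (fun t => G (X t)) - EX l2 (fun t => p.[u_ kappa (X t)])| <= e * (B * l2^-1).
  have iG : P.-integrable setT (EFin \o (fun t => W t * (X t * expR (- (l2 * X t)) * G (X t)))).
    by apply: (int_EX (C := 1)) => // t; exact: G1.
  have ip : P.-integrable setT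
      (EFin \o (fun t => W t * (X t * expR (- (l2 * X t)) * p.[u_ kappa (X t)]))).
    by apply: (int_EX (C := 1 + e)) => // t; exact: pB.
  rewrite /EX -RintegralB//.
  apply: (le_trans (le_normr_Rintegral _ (integrableB _ iG ip))) => //.
  have -> : e * (B * l2^-1) = \int[P]_t (cst (e * (B * l2^-1)) t).
    by rewrite Rintegral_cst// [fine _](_ : _ = fine 1%E) ?mulr1//; congr fine; exact: probability_setT.
  apply: le_Rintegral => //.
  + by apply: integrable_norm => //; exact: (integrableB _ iG ip).
  + exact: P_cst.
  + move=> t _; rewrite -mulrBr -mulrBr !normrM.
    have := Hp _ (X0 t); have := X_exp_bounded t l20; rewrite normrM => h1 h2.
    have h3 : `|W t| * (`|X t| * `|expR (- (l2 * X t))|) <= B * l2^-1.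
      by apply: ler_pM => //; rewrite mulr_ge0.
    rewrite mulrA [leLHS]mulrC; apply: ler_pM => //.
have d2 : `|\int[m]_(y in D) (w y * expR (- (l2 * w y)) * H (w y)) -
    \int[m]_(y in D) (w y * expR (- (l2 * w y)) * HG (w y))| <= e * (B * levy_mean l2).
  rewrite -RintegralB//.
  apply: (le_trans (le_normr_Rintegral _ (integrableB _ iH iHG))) => //.
  have i3 : m.-integrable D (EFin \o (fun y => w y * expR (- (l2 * w y)))).
    exact: integrable_levy_mul_exp.
  rewrite mulrA /levy_mean -RintegralZl//.
  apply: le_Rintegral => //.
  + by apply: integrable_norm => //; exact: (integrableB _ iH iHG).
  + apply: integrable_mulrl => //.
  + move=> y Dy; rewrite -mulrBr normrM mulrC.
    rewrite [X in _ * X]ger0_norm ?mulr_ge0 ?expR_ge0 ?w0//.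
    rewrite ler_wpM2r ?mulr_ge0 ?expR_ge0 ?w0//.
    have wy0 := w0 Dy.
    have mGy : measurable_fun setT (fun t => G (X t + w y)) by rewrite /G; measurability.
    have mpy : measurable_fun setT (fun t => p.[u_ kappa (X t + w y)]) by rewrite /u_; measurability.
    have iG : P.-integrable setT (EFin \o (fun t => W t * (expR (- (l2 * X t)) * G (X t + w y)))).
      by apply: (int_E (C := 1)) => //; [exact: ltW|move=> t; apply: G1; rewrite addr_ge0].
    have ip : P.-integrable setT
        (EFin \o (fun t => W t * (expR (- (l2 * X t)) * p.[u_ kappa (X t + w y)]))).
      by apply: (int_E (C := 1 + e)) => //; [exact: ltW|move=> t; apply: pB; rewrite addr_ge0].
    rewrite -HE// -HGE /E -RintegralB//.
    apply: (le_trans (le_normr_Rintegral _ (integrableB _ ip iG))) => //.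
    have -> : e * B = \int[P]_t (cst (e * B) t).
      by rewrite Rintegral_cst// [fine _](_ : _ = fine 1%E) ?mulr1//; congr fine; exact: probability_setT.
    apply: le_Rintegral => //.
    * by apply: integrable_norm => //; exact: (integrableB _ ip iG).
    * exact: P_cst.
    * move=> t _; rewrite -mulrBr -mulrBr !normrM distrC.
      have h2 : `|G (X t + w y) - p.[u_ kappa (X t + w y)]| <= e by apply: Hp; rewrite addr_ge0.
      have h3 : `|W t| * `|expR (- (l2 * X t))| <= B.
        by rewrite -[leRHS]mulr1; apply: ler_pM => //; apply: exp_bounded; exact: ltW.
      by rewrite mulrA [leLHS]mulrC; apply: ler_pM.
rewrite mulrDr -HX in d2 *.
rewrite -(subrKA (EX l2 (fun t => p.[u_ kappa (X t)]))).
by rewrite (le_trans (ler_normD _ _))// lerD.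
Qed.

(** With [theta = 0] and [theta = pi / 2], [fourier_derivE] is a linear system of
    differential equations in [s] for the cosine and sine transforms.  Undoing the
    rotation by [b] and the scaling by [e^A] makes both components constant, with
    value at [s = 0] given by the Laplace transform. *)
Let tilted_fourier (l r : R) : 0 < l ->
  let A := \int[m]_(y in D) (expR (- (l * w y)) * (1 - cos (r * w y))) in
  let b := \int[m]_(y in D) (expR (- (l * w y)) * sin (r * w y)) in
  let k := c * expR (- \int[m]_(y in D) (1 - expR (- (l * w y)))) in
  E l (fun t => cos (r * X t)) = k * expR (- A) * cos b /\
  E l (fun t => sin (r * X t)) = k * expR (- A) * sin b.
Proof.
move=> l0.
pose Cf s := E l (fun t => cos (s * X t)).
pose Sf s := E l (fun t => sin (s * X t)).
pose A s := \int[m]_(y in D) (expR (- (l * w y)) * (1 - cos (s * w y))).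
pose b s := \int[m]_(y in D) (expR (- (l * w y)) * sin (s * w y)).
have mcos (s : R) : measurable_fun setT (fun t => cos (s * X t)) by measurability.
have msin (s : R) : measurable_fun setT (fun t => sin (s * X t)) by measurability.
have isinX s : P.-integrable setT
    (EFin \o (fun t => W t * (X t * expR (- (l * X t)) * sin (s * X t)))).
  by apply: (int_EX (C := 1)) => // t; exact: normr_sin_le1.
have icosX s : P.-integrable setT
    (EFin \o (fun t => W t * (X t * expR (- (l * X t)) * cos (s * X t)))).
  by apply: (int_EX (C := 1)) => // t; exact: normr_cos_le1.
have isin s : P.-integrable setT (EFin \o (fun t => W t * (expR (- (l * X t)) * sin (s * X t)))).
  by apply: (int_E (C := 1)) => //; [exact: ltW|move=> t; exact: normr_sin_le1].
have icos s : P.-integrable setT (EFin \o (fun t => W t * (expR (- (l * X t)) * cos (s * X t)))).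
  by apply: (int_E (C := 1)) => //; [exact: ltW|move=> t; exact: normr_cos_le1].
have EXcos s : EX l (fun t => cos (s * X t)) = levy_cos l s * Cf s - levy_sin l s * Sf s.
  have := fourier_derivE s 0 l0; rewrite /Ecos /Esin.
  have -> : (fun t => cos (s * X t + 0)) = (fun t => cos (s * X t)).
    by apply/funext => t; rewrite addr0.
  have -> // : (fun t => sin (s * X t + 0)) = (fun t => sin (s * X t)).
  by apply/funext => t; rewrite addr0.
have EXsin s : EX l (fun t => sin (s * X t)) = levy_cos l s * Sf s + levy_sin l s * Cf s.
  have := fourier_derivE s (pi / 2) l0; rewrite /Ecos /Esin.
  have -> : (fun t => cos (s * X t + pi / 2)) = (fun t => - sin (s * X t)).
    by apply/funext => t; rewrite cosDpihalf.
  have -> : (fun t => sin (s * X t + pi / 2)) = (fun t => cos (s * X t)).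
    by apply/funext => t; rewrite sinDpihalf.
  have -> : EX l (fun t => - sin (s * X t)) = - EX l (fun t => sin (s * X t)).
    rewrite /EX -mulN1r -RintegralZl//; apply: eq_Rintegral => t _; ring.
  have -> : E l (fun t => - sin (s * X t)) = - Sf s.
    rewrite /Sf /E -mulN1r -RintegralZl//; apply: eq_Rintegral => t _; ring.
  by rewrite /Cf => H; lra.
have bound (f : R) t : `|f| <= 1 -> `|W t * (X t * expR (- (l * X t)) * f)| <= B * l^-1.
  move=> f1; rewrite normrM ler_pM// normrM -[leRHS]mulr1 ler_pM//.
  exact: X_exp_bounded.
have DC s : is_derive s (1:R) Cf (- EX l (fun t => sin (s * X t))).
  have -> : - EX l (fun t => sin (s * X t)) =
      \int[P]_t (W t * (X t * expR (- (l * X t)) * (- sin (s * X t)))).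
    rewrite /EX -mulN1r -RintegralZl//; apply: eq_Rintegral => t _; ring.
  apply: (@is_derive_Rintegral _ _ _ P setT _
    (fun s t => W t * (X t * expR (- (l * X t)) * (- sin (s * X t))))
    (fun=> B * l^-1) s (s - 1) (s + 1)) => //.
  - by apply/andP; split; lra.
  - move=> x t _ _; apply: (is_derive_eq (is_derive1_mul (is_derive1_cst (W t) x)
      (is_derive1_mul (is_derive1_cst (expR (- (l * X t))) x)
        (is_derive1_cos (is_derive1_lin (X t) x))))).
    by ring.
  - by move=> x t _ _; apply: bound; rewrite normrN normr_sin_le1.
have DS s : is_derive s (1:R) Sf (EX l (fun t => cos (s * X t))).
  apply: (@is_derive_Rintegral _ _ _ P setT _
    (fun s t => W t * (X t * expR (- (l * X t)) * cos (s * X t)))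
    (fun=> B * l^-1) s (s - 1) (s + 1)) => //.
  - by apply/andP; split; lra.
  - move=> x t _ _; apply: (is_derive_eq (is_derive1_mul (is_derive1_cst (W t) x)
      (is_derive1_mul (is_derive1_cst (expR (- (l * X t))) x)
        (is_derive1_sin (is_derive1_lin (X t) x))))).
    by ring.
  - by move=> x t _ _; apply: bound; exact: normr_cos_le1.
have DA s : is_derive s (1:R) A (levy_sin l s) by exact: levy_cos_derive.
have Db s : is_derive s (1:R) b (levy_cos l s) by exact: levy_sin_derive.
pose Phi1 s := expR (A s) * (Cf s * cos (b s) + Sf s * sin (b s)).
pose Phi2 s := expR (A s) * (Sf s * cos (b s) + - (Cf s * sin (b s))).
have D1 s : is_derive s (1:R) Phi1 0.
  apply: (is_derive_eq (is_derive1_mul (is_derive1_exp (DA s))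
    (is_derive1_add (is_derive1_mul (DC s) (is_derive1_cos (Db s)))
                    (is_derive1_mul (DS s) (is_derive1_sin (Db s)))))).
  by rewrite EXcos EXsin; ring.
have D2 s : is_derive s (1:R) Phi2 0.
  apply: (is_derive_eq (is_derive1_mul (is_derive1_exp (DA s))
    (is_derive1_add (is_derive1_mul (DS s) (is_derive1_cos (Db s)))
       (is_derive1_opp (is_derive1_mul (DC s) (is_derive1_sin (Db s))))))).
  by rewrite EXcos EXsin; ring.
have A0 : A 0 = 0.
  rewrite /A; under eq_Rintegral do rewrite mul0r cos0 subrr mulr0.
  by rewrite Rintegral_cst// mul0r.
have b0 : b 0 = 0.
  rewrite /b; under eq_Rintegral do rewrite mul0r sin0 mulr0.
  by rewrite Rintegral_cst// mul0r.
have S0 : Sf 0 = 0.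
  rewrite /Sf /E; under eq_Rintegral do rewrite mul0r sin0 !mulr0.
  by rewrite Rintegral_cst// mul0r.
have C0 : Cf 0 = c * expR (- \int[m]_(y in D) (1 - expR (- (l * w y)))).
  rewrite -laplaceE// /Cf /E; apply: eq_Rintegral => t _.
  by rewrite mul0r cos0 mulr1.
have E1 := is_derive_0_is_cst r 0 D1; have E2 := is_derive_0_is_cst r 0 D2.
rewrite /Phi1 A0 b0 S0 expR0 cos0 mul0r addr0 mulr1 mul1r in E1.
rewrite /Phi2 A0 b0 S0 expR0 sin0 mul0r mulr0 oppr0 addr0 mulr0 in E2.
have eA : expR (- A r) * expR (A r) = 1 by rewrite -expRD addNr expR0.
move=> A' b' k.
have {}E1 : Cf r * cos b' + Sf r * sin b' = k * expR (- A').
  by rewrite /k -C0 -E1 [RHS]mulrC [RHS]mulrA eA mul1r.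
have {}E2 : Sf r * cos b' - Cf r * sin b' = 0.
  by rewrite -[LHS]mul1r -eA -mulrA E2 mulr0.
have cs := cos2Dsin2 b'; rewrite !expr2 in cs.
rewrite -E1 -[E l (fun t => cos _)]/(Cf r) -[E l (fun t => sin _)]/(Sf r); split.
  transitivity (Cf r * (cos b' * cos b' + sin b' * sin b')
     + sin b' * (Sf r * cos b' - Cf r * sin b')); first by rewrite cs E2; ring.
  by ring.
transitivity (Sf r * (cos b' * cos b' + sin b' * sin b')
   - cos b' * (Sf r * cos b' - Cf r * sin b')); first by rewrite cs E2; ring.
by ring.
Qed.

Let levy_cvg0 (f : R -> T' -> R) (g : T' -> R) (C : R) : (forall l, 0 < l -> measurable_fun D (f l)) ->
  (forall l y, 0 < l <= 1 -> D y -> `|f l y| <= C * Num.min 1 (w y)) ->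
  (forall y, D y -> f n.+1%:R^-1 y @[n --> \oo] --> g y) ->
  \int[m]_(y in D) f n.+1%:R^-1 y @[n --> \oo] --> \int[m]_(y in D) g y.
Proof.
move=> mf fC fg.
have n0 n : 0 < n.+1%:R^-1 :> R by rewrite invr_gt0.
apply: (dominated_cvgR (mu := m) (f_ := fun n => f n.+1%:R^-1)
  (g := fun y => C * Num.min 1 (w y))) => //.
- by move=> n; exact: mf.
- move=> n y Dy; apply: fC => //; rewrite n0/=.
  by rewrite invf_le1// ler1n.
- by apply: integrable_mulrl => //; apply: integrable_min1.
Qed.

(** Limit [l -> 0] in [tilted_fourier], where all integrals are dominated.
    The bounded weight [W] is what allows the theorem to be applied to one
    variable while the other one is kept inside the expectation. *)
Lemma fourier_of_laplace (s : R) :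
  let A := \int[m]_(y in D) (1 - cos (s * w y)) in
  let b := \int[m]_(y in D) sin (s * w y) in
  \int[P]_t (W t * cos (s * X t)) = c * expR (- A) * cos b /\
  \int[P]_t (W t * sin (s * X t)) = c * expR (- A) * sin b.
Proof.
move=> A b.
pose u (n : nat) : R := n.+1%:R^-1.
have u0 n : 0 < u n by rewrite invr_gt0.
have uc : u n @[n --> \oo] --> 0 by exact: cvg_harmonic.
have expc (x : R) : expR (- (u n * x)) @[n --> \oo] --> (1 : R).
  rewrite -[X in _ --> X]expR0; apply: continuous_cvg; first exact: continuous_expR.
  by rewrite -oppr0; apply: cvgN; rewrite -[X in _ --> X](mul0r x); exact: cvgMl.
have Ec (f : T -> R) : measurable_fun setT f -> (forall t, `|f t| <= 1) ->
    E (u n) f @[n --> \oo] --> \int[P]_t (W t * f t).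
  move=> mf f1.
  apply: (dominated_cvgR (mu := P)
    (f_ := fun n t => W t * (expR (- (u n * X t)) * f t)) (g := fun=> B)) => //.
  - by move=> n; measurability.
  - move=> t _; apply: cvgMr; rewrite -[X in _ --> X]mul1r; exact: cvgMl.
  - move=> n t _; rewrite normrM -[leRHS]mulr1 ler_pM// normrM -[leRHS]mul1r ler_pM//.
    by apply: exp_bounded; exact: ltW.
have ic : \int[m]_(y in D) (1 - expR (- (u n * w y))) @[n --> \oo] --> \int[m]_(y in D) cst 0 y.
  apply: (levy_cvg0 (f := fun l y => 1 - expR (- (l * w y))) (g := cst 0) (C := 2)).
  - by move=> l l0; measurability.
  - move=> l y /andP[l0 l1] Dy; apply: (le_trans (one_sub_exp_le_min1 (ltW l0) (w0 Dy))).
    by rewrite ler_wpM2r ?le_min ?ler01 ?w0//; lra.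
  - move=> y Dy; rewrite -[X in _ --> X](subrr 1); apply: cvgB; [exact: cvg_cst|exact: expc].
rewrite Rintegral_cst// mul0r in ic.
have kc : expR (- \int[m]_(y in D) (1 - expR (- (u n * w y)))) @[n --> \oo] --> (1 : R).
  rewrite -[X in _ --> X]expR0; apply: continuous_cvg; first exact: continuous_expR.
  by rewrite -oppr0; exact: cvgN.
have Ac : \int[m]_(y in D) (expR (- (u n * w y)) * (1 - cos (s * w y))) @[n --> \oo] --> A.
  apply: (levy_cvg0 (f := fun l y => expR (- (l * w y)) * (1 - cos (s * w y)))
    (C := 2 + `|s|)).
  - by move=> l l0; measurability.
  - move=> l y /andP[l0 l1] Dy; rewrite normrM (le_trans _ (one_sub_cos_le_min1 s (w0 Dy)))//.
    by rewrite ger0_norm ?expR_ge0// ler_piMl// expRN_le1// mulr_ge0 ?w0// ltW.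
  - by move=> y Dy; rewrite -[X in _ --> X]mul1r; apply: cvgMl; exact: expc.
have bc : \int[m]_(y in D) (expR (- (u n * w y)) * sin (s * w y)) @[n --> \oo] --> b.
  apply: (levy_cvg0 (f := fun l y => expR (- (l * w y)) * sin (s * w y))
    (C := 1 + `|s|)).
  - by move=> l l0; measurability.
  - move=> l y /andP[l0 l1] Dy; rewrite normrM (le_trans _ (sin_le_min1 s (w0 Dy)))//.
    by rewrite ger0_norm ?expR_ge0// ler_piMl// expRN_le1// mulr_ge0 ?w0// ltW.
  - by move=> y Dy; rewrite -[X in _ --> X]mul1r; apply: cvgMl; exact: expc.
have eAc : expR (- \int[m]_(y in D) (expR (- (u n * w y)) * (1 - cos (s * w y))))
    @[n --> \oo] --> expR (- A).
  by apply: continuous_cvg; [exact: continuous_expR|exact: cvgN].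
have kAc : c * expR (- \int[m]_(y in D) (1 - expR (- (u n * w y)))) *
    expR (- \int[m]_(y in D) (expR (- (u n * w y)) * (1 - cos (s * w y))))
    @[n --> \oo] --> c * expR (- A).
  by apply: cvgM => //; rewrite -[X in _ --> X]mulr1; exact: cvgMr.
split.
- have mf : measurable_fun setT (fun t => cos (s * X t)) by measurability.
  apply: (cvg_unique (@Rhausdorff R) (Ec _ mf (fun t => normr_cos_le1 _))).
  have -> : (fun n => E (u n) (fun t => cos (s * X t))) = (fun n => 
      c * expR (- \int[m]_(y in D) (1 - expR (- (u n * w y)))) *
      expR (- \int[m]_(y in D) (expR (- (u n * w y)) * (1 - cos (s * w y)))) *
      cos (\int[m]_(y in D) (expR (- (u n * w y)) * sin (s * w y)))).
    by apply/funext => n; have [-> _] := tilted_fourier s (u0 n).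
  by apply: cvgM => //; apply: continuous_cvg => //; exact: continuous_cos.
- have mf : measurable_fun setT (fun t => sin (s * X t)) by measurability.
  apply: (cvg_unique (@Rhausdorff R) (Ec _ mf (fun t => normr_sin_le1 _))).
  have -> : (fun n => E (u n) (fun t => sin (s * X t))) = (fun n => 
      c * expR (- \int[m]_(y in D) (1 - expR (- (u n * w y)))) *
      expR (- \int[m]_(y in D) (expR (- (u n * w y)) * (1 - cos (s * w y)))) *
      sin (\int[m]_(y in D) (expR (- (u n * w y)) * sin (s * w y)))).
    by apply/funext => n; have [_ ->] := tilted_fourier s (u0 n).
  by apply: cvgM => //; apply: continuous_cvg => //; exact: continuous_sin.
Qed.

End LaplaceToFourier.

(** * Grids and Stieltjes measures *)

Section Grid.
Context {R : realType}.

(** Mesh [1 / (n + 1)] on [[- n, n]], so that both the mesh and the range improve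
    with [n]. *)
Definition grid (n i : nat) : R := - n%:R + i%:R / n.+1%:R.
Definition grid_size (n : nat) : nat := (2 * n * n.+1)%N.
Definition grid_cell (n i : nat) : set R := `]grid n i, grid n i.+1]%classic.

Lemma grid_step n i : grid n i.+1 = grid n i + n.+1%:R^-1.
Proof. by rewrite /grid -[i.+1%:R]natr1 mulrDl mul1r addrA. Qed.

Lemma le_grid n : {homo grid n : i j / (i <= j)%N >-> i <= j}.
Proof. by move=> i j ij; rewrite lerD2l ler_pM2r ?invr_gt0// ler_nat. Qed.

Lemma grid0 n : grid n 0 = - n%:R.
Proof. by rewrite /grid mul0r addr0. Qed.

Lemma grid_last n : grid n (grid_size n) = n%:R.
Proof.
rewrite /grid /grid_size !natrM mulfK ?gt_eqF//.
by rewrite mulr2n mulrDl !mul1r; lra.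
Qed.

Lemma mem_grid_cell n x : - n%:R < x <= n%:R ->
  exists2 i, (i < grid_size n)%N & grid_cell n i x.
Proof.
rewrite -grid0 -[X in _ && (_ <= X)]grid_last => /andP[x0].
elim: (grid_size n) => [|N IH]; first by rewrite leNgt x0.
have [xN _|Nx xN] := leP x (grid n N).
  by have [i iN ix] := IH xN; exists i => //; exact: ltnW.
by exists N => //; rewrite /grid_cell/= in_itv/= Nx.
Qed.

Lemma trivIset_grid_cell n : trivIset setT (grid_cell n).
Proof.
move=> i j _ _ [x]; rewrite /grid_cell/= !in_itv/= => -[/andP[ix xi] /andP[jx xj]].
case: (ltngtP i j) => // ij.
- by have := le_lt_trans (le_trans xi (le_grid n ij)) jx; rewrite ltxx.
- by have := le_lt_trans (le_trans xj (le_grid n ij)) ix; rewrite ltxx.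
Qed.

Lemma near_grid_range (x : R) : \forall n \near \oo, - n%:R < x <= n%:R.
Proof.
near=> n; apply/andP; split; last by near: n; exact: nbhs_infty_ger.
by rewrite ltrNl; near: n; exact: nbhs_infty_gtr.
Unshelve. all: by end_near. Qed.

End Grid.

Section StieltjesMeasure.
Context {R : realType}.
Implicit Types F : R -> R.

Lemma to_cumulativeE F : is_cumulative F -> (to_cumulative F : R -> R) = F.
Proof. by move=> cF; rewrite /to_cumulative; case: pselect. Qed.

Lemma stieltjes_itv F a b : is_cumulative F -> a <= b ->
  stieltjes F `]a, b]%classic = (F b - F a)%:E.
Proof.
move=> cF ab; rewrite /stieltjes /lebesgue_stieltjes_measure /measure_extension/=.
rewrite measurable_mu_extE/= ?wlength_itv_bnd//; last exact: is_ocitv.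
by rewrite to_cumulativeE.
Qed.

Lemma stieltjes_unique F (mu : {measure set (measurableTypeR R) -> \bar R}) :
  is_cumulative F -> (forall a b, a <= b -> mu `]a, b]%classic = (F b - F a)%:E) ->
  forall A, measurable A -> stieltjes F A = mu A.
Proof.
move=> cF muE A mA; apply: lebesgue_stieltjes_measure_unique => // X [[a b]/= _ <-].
have [ab|ba] := leP a b; first by rewrite muE//; exact: stieltjes_itv.
by rewrite set_itv_ge ?measure0// bnd_simp -leNgt ltW.
Qed.

Lemma stieltjes_itvNy F b : is_cumulative F -> F t @[t --> -oo] --> 0 ->
  stieltjes F `]-oo, b]%classic = (F b)%:E.
Proof.
move=> cF F0.
rewrite itvNybndEbigcup.
have c1 : stieltjes F `]-n%:R, b]%classic @[n --> \oo] --> (F b)%:E.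
  have : ((F b)%:E - (F (-n%:R))%:E)%E @[n --> \oo] --> (F b)%:E.
    rewrite -[X in _ --> X](sube0 (F b)%:E); apply: (cvgeB _ (cvg_cst _ )) => //.
    apply: cvg_EFin; first exact: nearW.
    apply: (cvg_comp _ _ _ F0) => //; apply: (cvg_comp _ _ cvgr_idn).
    by rewrite ninfty.
  apply: cvg_trans; apply: near_eq_cvg; near=> n.
  rewrite stieltjes_itv// lerNl; near: n; exact: nbhs_infty_ger.
have c2 : stieltjes F `]-n%:R, b] @[n --> \oo] --> stieltjes F (\bigcup_n `]-n%:R, b]%classic).
  apply: nondecreasing_cvg_mu => //; first exact: bigcup_measurable.
  by move=> *; apply/subsetPset/subset_itv; rewrite leBSide//= lerN2 ler_nat.
exact: cvg_unique c2 c1.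
Unshelve. all: by end_near. Qed.

Lemma stieltjes_setT_le F (M : R) : is_cumulative F -> F t @[t --> -oo] --> 0 ->
  (forall t, F t <= M) -> (stieltjes F setT <= M%:E)%E.
Proof.
move=> cF F0 FM.
have -> : [set: R] = \bigcup_n `]-oo, n%:R]%classic.
  apply/seteqP; split => // x _.
  near \oo => n; exists n => //=; rewrite in_itv/=; near: n; exact: nbhs_infty_ger.
have : stieltjes F `]-oo, n%:R]%classic @[n --> \oo] -->
    stieltjes F (\bigcup_n `]-oo, n%:R]%classic).
  apply: nondecreasing_cvg_mu => //; first exact: bigcup_measurable.
  by move=> i j ij; apply/subsetPset/subset_itv; rewrite ?leBSide//= ler_nat.
move=> /cvg_lim <-//; apply: lime_le.
  apply: ereal_nondecreasing_is_cvgn => i j ij; apply: le_measure; rewrite ?inE//.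
  by apply: subset_itv; rewrite ?leBSide//= ler_nat.
by apply: nearW => n; rewrite stieltjes_itvNy// lee_fin.
Unshelve. all: by end_near. Qed.

End StieltjesMeasure.

(** * Densities of absolutely continuous distribution functions *)

Section AbsolutelyContinuous.
Context {R : realType}.
Notation leb := (@lebesgue_measure R).
Variables (G : R -> R) (M : R).
Hypotheses (cG : is_cumulative G) (acG : absolutely_continuous G)
  (G0 : G t @[t --> -oo] --> 0) (GM : forall t, G t <= M).

Let mu := stieltjes G.

Let muT_fin : (mu setT < +oo)%E.
Proof. by apply: le_lt_trans (stieltjes_setT_le cG G0 GM) _; rewrite ltry. Qed.

Let nu : {finite_measure set (measurableTypeR R) -> \bar R} :=
  mfrestr (@measurableT _ (measurableTypeR R)) muT_fin.

Let nuE A : nu A = mu A.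
Proof. by rewrite /nu/= /mfrestr /mrestr setIT. Qed.

Let inner_cell (U : set R) n i : set (measurableTypeR R) :=
  if `[< grid_cell n i `<=` U >] then grid_cell n i else set0.

(** Finitely many disjoint intervals inside [U], increasing to [U] when it is open:
    absolute continuity controls such families. *)
Let inner_cells (U : set R) n : set (measurableTypeR R) :=
  \big[setU/set0]_(i < grid_size n) inner_cell U n i.

Let inner_cells_measurable (U : set R) n : measurable (inner_cells U n).
Proof.
apply: bigsetU_measurable => i _; rewrite /inner_cell; case: ifP => // _; exact: measurable_itv.
Qed.

Let inner_cells_measure (U : set R) n (F : R -> R) : is_cumulative F ->
  stieltjes F (inner_cells U n) = (\sum_(i < grid_size n)
    (F (if `[< grid_cell n i `<=` U >] then grid n i.+1 else grid n i) - F (grid n i)))%:E.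
Proof.
move=> cF.
have mC i : measurable (inner_cell U n i).
  by rewrite /inner_cell; case: ifP => // _; exact: measurable_itv.
have tC : trivIset setT (inner_cell U n).
  move=> i j _ _ [x []]; rewrite /inner_cell; case: ifP => // _ xi; case: ifP => // _ xj.
  by apply: (@trivIset_grid_cell R n) => //; exists x.
rewrite /inner_cells; have -> := @measure_bigsetU _ _ _ (stieltjes F) _ mC tC (grid_size n).
rewrite -sumEFin; apply: eq_bigr => i _; rewrite /inner_cell; case: ifP => _.
  by apply: stieltjes_itv => //; exact: le_grid.
by rewrite measure0 subrr.
Qed.

Let cvg_inner_cells (U : set R) (x : R) : open U ->
  (\1_(inner_cells U n) x : R) @[n --> \oo] --> (\1_U x : R).
Proof.
move=> oU; have [Ux|nUx] := pselect (U x); last first.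
  have sub n : ~ inner_cells U n x.
    rewrite /inner_cells -bigcup_mkord /inner_cell => -[i _ /=].
    by case: ifPn => // /asboolP sU /sU.
  by apply: cvg_near_cst; near=> n; rewrite !indicE !memNset.
apply: cvg_near_cst.
have [e /= e0 eU] : nbhs x U by move: oU; rewrite openE => /(_ _ Ux).
near=> n; rewrite !indicE (mem_set Ux) mem_set//.
have [|i iN xi] := @mem_grid_cell R n x; first by near: n; exact: near_grid_range.
have en : n.+1%:R^-1 < e by near: n; exact: near_infty_natSinv_lt (PosNum e0).
rewrite /inner_cells -bigcup_mkord; exists i => //=.
rewrite /inner_cell asboolT// => y; move: xi; rewrite /grid_cell/= !in_itv/= !grid_step => /andP[xl xr] /andP[yl yr].
move: (grid n i) xl xr yl yr => gi xl xr yl yr; move: (n.+1%:R^-1) en xr yr => hn en xr yr.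
have h1 : - e < (x - y : R) by lra.
have h2 : (x - y : R) < e by lra.
by apply: eU; rewrite /ball_/= ltr_norml h1 h2.
Unshelve. all: by end_near. Qed.

(** A null set lies in an open set [U] of small Lebesgue measure, and the measure of
    [U] is the limit of the measures of its inner cells, each at most [e]. *)
Lemma absolutely_continuous_dominates : nu `<< leb.
Proof.
apply/null_content_dominatesP => N mN N0.
apply/eqP; rewrite eq_le measure_ge0 andbT; apply/lee_addgt0Pr => e e0.
rewrite add0e nuE.
have [d d0 Hd] := acG e0.
have [|U [oU NU UN]] := @lebesgue_regularity_outer R N d mN _ d0; first by rewrite N0.
have mU : measurable U by exact: open_measurable.
have Ud : (leb U < d%:E)%E.
  rewrite -(setDUK NU) measureU//; last 2 first.
  - exact: measurableD.
  - by apply/seteqP; split => // x [? []].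
  by rewrite N0 add0e.
apply: (@le_trans _ _ (mu U)).
  by apply: le_measure; rewrite ?inE.
have intU (A : set R) : measurable A -> mu A = (\int[nu]_x \1_A x)%:E.
  move=> mA; rewrite /Rintegral integral_indic// setIT fineK//.
    by rewrite -nuE.
  exact: fin_num_measure.
have cid : is_cumulative (@idfun R).
  by split => // x; apply: cvg_at_right_filter; exact: cvg_id.
have lebE (A : set (measurableTypeR R)) : measurable A -> stieltjes (@idfun R) A = leb A.
  apply: stieltjes_unique => // a b ab.
  rewrite [LHS](lebesgue_measure_itv `]a, b])/= lte_fin; case: ltgtP ab => //= -[->] _.
  by rewrite subrr.
have Un n : (mu (inner_cells U n) <= e%:E)%E.
  rewrite [leLHS](inner_cells_measure U n cG) lee_fin.
  pose a (i : 'I_(grid_size n)) := grid n i : R.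
  pose b (i : 'I_(grid_size n)) :=
    if `[< grid_cell n i `<=` U >] then grid n i.+1 else grid n i : R.
  have ab i : a i <= b i by rewrite /a /b; case: ifP => // _; exact: le_grid.
  have tab : trivIset setT (fun i => `]a i, b i[%classic).
    move=> i j _ _ [x []]; rewrite /a /b/= !in_itv/=.
    case: ifP => _ /andP[xi1 xi2]; last by have := lt_trans xi1 xi2; rewrite ltxx.
    case: ifP => _ /andP[xj1 xj2]; last by have := lt_trans xj1 xj2; rewrite ltxx.
    apply: val_inj; apply: (@trivIset_grid_cell R n) => //; exists x.
    by rewrite /grid_cell/= !in_itv/= xi1 xj1 !ltW.
  have : \sum_i (b i - a i) < d.
    have E : (\sum_i (b i - a i))%:E = leb (inner_cells U n).
      by rewrite -lebE//; exact/esym/(inner_cells_measure U n cid).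
    rewrite -lte_fin E.
    apply: le_lt_trans Ud; apply: le_measure; rewrite ?inE// => x.
    rewrite /inner_cells -bigcup_mkord /inner_cell => -[i _ /=].
    by case: ifPn => // /asboolP sU /sU.
  move=> /(Hd _ a b ab tab) /ltW; apply: le_trans.
  by apply: ler_sum => i _; exact: ler_norm.
have cU : (\int[nu]_x \1_(inner_cells U n) x) @[n --> \oo] --> (\int[nu]_x \1_U x : R).
  apply: (dominated_cvgR (mu := nu) (f_ := fun n => \1_(inner_cells U n)) (g := cst 1)) => //.
  - by move=> x _; exact: cvg_inner_cells.
  - by move=> n x _; rewrite indicE; case: (_ \in _); rewrite ?normr1 ?normr0.
  - exact: finite_measure_integrable_cst.
rewrite intU// lee_fin -(cvg_lim (@Rhausdorff R) cU).
apply: limr_le; first by apply/cvg_ex; eexists; exact: cU.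
by apply: nearW => n; rewrite -lee_fin -intU; [exact: Un|exact: inner_cells_measurable].
Qed.

(** The density is the Radon-Nikodym derivative; Lebesgue differentiation
    identifies it almost everywhere with the derivative of [G]. *)
Theorem absolutely_continuous_density : exists phi : R -> R,
  [/\ measurable_fun setT phi, forall t, 0 <= phi t,
      {ae leb, forall t, derivable G t 1 /\ derive1 G t = phi t} &
      forall a b, a <= b ->
        (\int[leb]_(t in `]a, b]) (phi t)%:E = (G b - G a)%:E)%E].
Proof.
have [f [f0 ffin fint fE]] := radon_nikodym_sigma_finite absolutely_continuous_dominates.
pose phi t := fine (f t).
have fphi : EFin \o phi = f by apply/funext => t; rewrite /= fineK.
have mphi : measurable_fun setT phi.
  by apply/measurable_EFinP; rewrite fphi; exact: measurable_int fint.
have iphi : leb.-integrable setT (EFin \o phi) by rewrite fphi.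
exists phi; split => //.
- by move=> t; exact/fine_ge0.
- have i1 y : leb.-integrable `]-oo, y] (EFin \o phi).
    exact: (@integrableS _ _ _ leb setT).
  have i2 : locally_integrable [set: R] phi by apply: open_integrable_locally => //; exact: openT.
  have := FTC1Ny i1 i2.
  have -> : (fun x => \int[leb]_(t in [set` `]-oo, x]]) phi t) = G.
    apply/funext => x; rewrite /Rintegral.
    transitivity (fine (nu `]-oo, x]%classic)).
      by rewrite fE//; congr fine; apply: eq_integral => t _; rewrite -fphi.
    rewrite nuE -[RHS]/(fine (G x)%:E); congr fine; exact: stieltjes_itvNy.
  exact.
- move=> a b ab.
  transitivity (nu `]a, b]%classic).
    by rewrite fE//; apply: eq_integral => t _; rewrite -fphi.
  by rewrite nuE; exact: stieltjes_itv.
Qed.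

End AbsolutelyContinuous.

(** * A measurable version of the derivative of the kernel *)

Section AeNonMeasurable.
Local Open Scope ereal_scope.
Context {R : realType} {d : measure_display} {T : measurableType d}.
Variable mu : {measure set T -> \bar R}.
Import HBNNSimple.

Let ge0_le (f g : T -> \bar R) : (forall x, 0 <= f x) -> (forall x, 0 <= g x) ->
  {ae mu, forall x, f x = g x} -> \int[mu]_x f x <= \int[mu]_x g x.
Proof.
move=> f0 g0 [N [mN N0 fgN]].
rewrite ge0_integralTE// [leRHS]ge0_integralTE//.
apply: ge_ereal_sup => _ [h /= hf <-].
apply: ereal_sup_ubound; exists (proj_nnsfun h (measurableC mN)) => /=.
  move=> x; rewrite mindicE; have [xN|xN] := pselect (N x).
    by rewrite memNset ?mulr0//=; exact.
  rewrite mem_set// mulr1; have [<-//|ne] := pselect (f x = g x).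
  by exfalso; apply: xN; exact: fgN.
rewrite -!integralT_nnsfun; apply: ae_eq_integral => //.
- by apply/measurable_EFinP.
- by apply/measurable_EFinP.
exists N; split => // x /= h1; apply: contrapT => nN; apply: h1 => _.
by rewrite mindicE mem_set ?mulr1.
Qed.

(** The integral of a nonnegative function is a supremum over simple functions below
    it, and a simple function can be set to [0] on a null set.  No measurability is
    available for [t |-> kprime k t x], which is an arbitrary value where the
    derivative does not exist. *)
Lemma ge0_ae_eq_integral_nonmeasurable (f g : T -> \bar R) :
  (forall x, 0 <= f x) -> (forall x, 0 <= g x) ->
  {ae mu, forall x, f x = g x} -> \int[mu]_x f x = \int[mu]_x g x.
Proof.
move=> f0 g0 fg; apply/eqP; rewrite eq_le !ge0_le//.
by apply: filterS fg => x ->.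
Qed.

Lemma ae_eq_integral_nonmeasurable (f g : T -> \bar R) :
  {ae mu, forall x, f x = g x} -> \int[mu]_x f x = \int[mu]_x g x.
Proof.
move=> fg; rewrite [LHS]integralE [RHS]integralE; congr (_ - _);
  apply: ge0_ae_eq_integral_nonmeasurable => //; apply: filterS fg => x h.
  by rewrite !funeposE h.
by rewrite !funenegE h.
Qed.

End AeNonMeasurable.

(** Lebesgue measure is defined on a type of its own, at which the filter structure
    of almost everywhere statements is not inferred. *)
#[local] Instance lebesgue_ae_filter (R : realType) :
  Filter (nbhs (almost_everywhere (@lebesgue_measure R))).
Proof. exact: (ae_filter_ringOfSetsType (@lebesgue_measure R)). Qed.

Section KernelDerivative.
Context {R : realType}.
Notation leb := (@lebesgue_measure R).
Notation BR := (measurableTypeR R).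
Variable k : R -> R -> R.
Hypotheses (mk : measurable_fun setT (fun p : R * R => k p.1 p.2))
  (k_ge0 : forall t x, 0 <= k t x)
  (k_nd : forall x, nondecreasing_fun (k ^~ x))
  (k_rc : forall x, right_continuous (k ^~ x))
  (k_Ny : forall x, k t x @[t --> -oo] --> 0)
  (k_y : forall x, cvg (k t x @[t --> +oo]))
  (k_ac : forall x, absolutely_continuous (k ^~ x)).

Lemma le_kbar t x : k t x <= kbar k x.
Proof.
apply: limr_ge; first exact: k_y.
by near=> s; apply: k_nd; near: s; apply: nbhs_pinfty_ge; rewrite num_real.
Unshelve. all: by end_near. Qed.

Lemma kernel_cumulative x : is_cumulative (k ^~ x).
Proof. by split; [exact: k_nd|exact: k_rc]. Qed.

Lemma cvg_kbar x : k n%:R x @[n --> \oo] --> kbar k x.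
Proof.
by apply: (@cvg_comp _ _ _ (fun n : nat => n%:R : R) (fun t => k t x) \oo +oo); [exact: cvgr_idn|exact: k_y].
Qed.

Let quotient (n : nat) (p : BR * BR) : \bar R :=
  (n.+1%:R * (k (p.1 + n.+1%:R^-1) p.2 - k p.1 p.2))%:E.

(** An upper limit of difference quotients is measurable in both variables, which
    [kprime] need not be. *)
Definition kernel_density (p : BR * BR) : R := fine (limn_esup (quotient ^~ p)).

Lemma measurable_kernel_shift (c : R) :
  measurable_fun setT (fun p : BR * BR => k (p.1 + c) p.2).
Proof.
apply: (@measurableT_comp _ _ _ _ _ _ (fun p : R * R => k p.1 p.2) _
  (fun p : BR * BR => (p.1 + c, p.2))) => //.
apply/measurable_fun_pairP; split => //=.
by apply: measurable_funD.
exact: measurable_snd.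
Qed.

Lemma measurable_kernel_density : measurable_fun setT kernel_density.
Proof.
apply: measurableT_comp => //.
apply: measurable_fun_limn_esup => n.
apply/measurable_EFinP; apply: measurable_funM => //.
apply: measurable_funB; first exact: measurable_kernel_shift.
have := measurable_kernel_shift 0.
by under eq_fun do rewrite addr0.
Qed.

Lemma kernel_density_ge0 p : 0 <= kernel_density p.
Proof.
apply: fine_ge0; rewrite /limn_esup /limf_esup.
apply: le_ereal_inf_tmp => _ [V FV <-]; have [n Vn] := filter_ex FV.
apply: (@le_trans _ _ (quotient n p)); last by apply: ereal_sup_ubound; exists n.
by rewrite lee_fin mulr_ge0// subr_ge0 k_nd// lerDl invr_ge0.
Qed.

Lemma kernel_densityP x : exists phi : R -> R, [/\ measurable_fun setT phi,
  {ae leb, forall t, kprime k t x = phi t}, {ae leb, forall t, kernel_density (t, x) = phi t} &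
  forall a b, a <= b -> (\int[leb]_(t in `]a, b]) (phi t)%:E = (k b x - k a x)%:E)%E].
Proof.
have [phi [mphi phi0 Dphi intphi]] := absolutely_continuous_density
  (kernel_cumulative x) (k_ac x) (k_Ny x) (fun t => le_kbar t x).
exists phi; split => //.
  by apply: filterS Dphi => t [].
apply: filterS Dphi => t [Dt <-]; rewrite /kernel_density.
have cq : quotient n (t, x) @[n --> \oo] --> (derive1 (k ^~ x) t)%:E.
  apply: cvg_EFin; first exact: nearW.
  have : derivable (k ^~ x) t 1 by [].
  rewrite /derivable => /cvg_ex[l]; under eq_fun do rewrite scaler1.
  move=> Hl.
  have -> : derive1 (k ^~ x) t = l by exact: cvg_lim.
  have /cvgr_dnbhsP/(_ (fun n => n.+1%:R^-1)) := Hl.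
  have hc : (forall n, n.+1%:R^-1 != 0 :> R) /\ n.+1%:R^-1 @[n --> \oo] --> (0 : R).
    by split; [move=> n; rewrite invr_eq0|exact: cvg_harmonic].
  move=> /(_ hc); apply: cvg_trans; apply: near_eq_cvg; apply: nearW => n.
  by rewrite /quotient/= invrK [_ + t]addrC.
by rewrite (cvg_limn_einf_sup cq).2.
Qed.

Lemma kprime_ae x : {ae leb, forall t, kprime k t x = kernel_density (t, x)}.
Proof.
have [phi [_ H1 H2 _]] := kernel_densityP x.
by apply: filterS2 H1 H2 => t -> ->.
Qed.

Let mkd x : measurable_fun setT (fun t : BR => kernel_density (t, x)).
Proof.
apply: (measurableT_comp measurable_kernel_density).
exact: measurable_pair2.
Qed.

Lemma kernel_density_integral x a b : a <= b ->
  (\int[leb]_(t in `]a, b]) (kernel_density (t, x))%:E = (k b x - k a x)%:E)%E.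
Proof.
move=> ab; have [phi [mphi _ H2 Hint]] := kernel_densityP x.
rewrite -Hint//; apply: ae_eq_integral => //.
- by apply/measurable_EFinP; apply: measurable_funTS; exact: mkd.
- by apply/measurable_EFinP; exact: measurable_funTS.
by apply: filterS H2 => t /= -> _.
Qed.

Lemma measurable_kbar : measurable_fun setT (kbar k).
Proof.
apply: (measurable_fun_cvg (h := fun n x => k n%:R x)); last by move=> x _; exact: cvg_kbar.
by move=> n; exact: (measurable_fun_pair2 (n%:R : R) mk).
Qed.

Variable g : R -> R.
Hypothesis mg : measurable_fun setT g.

Lemma htildeE x : htilde g k x = (\int[leb]_t (`|g t| * kernel_density (t, x))%:E)%E.
Proof.
apply: ge0_ae_eq_integral_nonmeasurable.
- by move=> t; rewrite lee_fin mulr_ge0.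
- by move=> t; rewrite lee_fin mulr_ge0// kernel_density_ge0.
by apply: filterS (kprime_ae x) => t ->; rewrite (ger0_norm (kernel_density_ge0 _)).
Qed.

Lemma hE x : h g k x = \int[leb]_t (g t * kernel_density (t, x)).
Proof.
congr fine; apply: ae_eq_integral_nonmeasurable.
by apply: filterS (kprime_ae x) => t /= ->.
Qed.

Lemma measurable_weighted (f : R -> R) : measurable_fun setT f ->
  measurable_fun setT (fun p : BR * BR => f p.1 * kernel_density p).
Proof.
move=> mf; apply: measurable_funM; last exact: measurable_kernel_density.
exact: (measurableT_comp mf).
Qed.

Let pos_part (x : BR) := (\int[leb]_t (Num.max (g t) 0 * kernel_density (t, x))%:E)%E.
Let neg_part (x : BR) := (\int[leb]_t (Num.max (- g t) 0 * kernel_density (t, x))%:E)%E.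

Lemma measurable_ge0_weighted (f : R -> R) : measurable_fun setT f -> (forall t, 0 <= f t) ->
  measurable_fun setT (fun x : BR => (\int[leb]_t (f t * kernel_density (t, x))%:E)%E).
Proof.
move=> mf f0.
apply: (@measurable_fun_fubini_tonelli_G _ _ BR BR R leb
   (fun p => (f p.1 * kernel_density p)%:E)).
- by apply/measurable_EFinP; exact: measurable_weighted.
- by move=> p; rewrite lee_fin mulr_ge0// kernel_density_ge0.
Qed.

Lemma measurable_htilde : measurable_fun setT (htilde g k).
Proof.
rewrite (funext htildeE).
by apply: measurable_ge0_weighted => //; exact: measurableT_comp.
Qed.

Hypothesis hfin : forall x, (htilde g k x < +oo)%E.

Lemma integrable_weighted x :
  leb.-integrable setT (EFin \o (fun t => g t * kernel_density (t, x))).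
Proof.
apply/integrableP; split.
  by apply/measurable_EFinP; apply: measurable_funM => //; exact: mkd.
apply: le_lt_trans (hfin x); rewrite htildeE.
apply: ge0_le_integral => //.
- by apply: measurableT_comp => //; apply/measurable_EFinP; apply: measurable_funM => //; exact: mkd.
- by apply/measurable_EFinP; apply: measurable_funM; [exact: measurableT_comp|exact: mkd].
- by move=> t _; rewrite /= lee_fin normrM (ger0_norm (kernel_density_ge0 _)).
Qed.

Lemma measurable_h : measurable_fun setT (h g k).
Proof.
have mp : measurable_fun setT (fun t => Num.max (g t) 0) by exact: measurable_maxr.
have mn : measurable_fun setT (fun t => Num.max (- g t) 0).
  by apply: measurable_maxr => //; exact: measurableT_comp.
have E : h g k = (fun x => fine (pos_part x - neg_part x)%E).
  apply/funext => x; rewrite hE /Rintegral integralE; congr (fine (_ - _)%E);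
    apply: eq_integral => t _.
    rewrite funeposE /= -EFin_max -[X in Num.max _ X](mul0r (kernel_density (t, x))).
    by rewrite maxr_pMl// kernel_density_ge0.
  rewrite funenegE /= -EFin_max -mulNr -[X in Num.max _ X](mul0r (kernel_density (t, x))).
  by rewrite maxr_pMl// kernel_density_ge0.
rewrite E; apply: measurableT_comp => //; apply: emeasurable_funB.
  by apply: measurable_ge0_weighted => // t; rewrite le_max lexx orbT.
by apply: measurable_ge0_weighted => // t; rewrite le_max lexx orbT.
Qed.

Lemma normr_h_le x : `|h g k x| <= fine (htilde g k x).
Proof.
rewrite hE htildeE (le_trans (le_normr_Rintegral _ (integrable_weighted x)))//.
rewrite /Rintegral; under eq_integral do rewrite normrM (ger0_norm (kernel_density_ge0 _)).
exact: lexx.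
Qed.

End KernelDerivative.

(** * The mean of a normalized path *)

Section DensityMeasure.
Local Open Scope ereal_scope.
Context {R : realType} {d : measure_display} {T : measurableType d}.
Variable mu : {measure set T -> \bar R}.

Definition density_measure (f : T -> \bar R) (mf : measurable_fun setT f)
  (f0 : forall x, 0 <= f x) (A : set T) : \bar R := \int[mu]_(x in A) f x.

Section Instance.
Variables (f : T -> \bar R) (mf : measurable_fun setT f) (f0 : forall x, 0 <= f x).

Let dens := density_measure mf f0.

Let dens0 : dens set0 = 0. Proof. exact: integral_set0. Qed.

Let dens_ge0 A : 0 <= dens A. Proof. exact: integral_ge0. Qed.

Let dens_sigma_additive : semi_sigma_additive dens.
Proof.
move=> F mF tF mUF.
rewrite /dens /density_measure ge0_integral_bigcup//; last exact: measurable_funTS.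
by apply: is_cvg_nneseries => n _ _; exact: integral_ge0.
Qed.

HB.instance Definition _ := isMeasure.Build _ _ _ dens dens0 dens_ge0 dens_sigma_additive.

End Instance.

End DensityMeasure.

HB.instance Definition _ (R : realType) d (T : measurableType d)
    (mu : {measure set T -> \bar R}) f (mf : measurable_fun setT f)
    (f0 : forall x, (0 <= f x)%E) :=
  Measure.on (@density_measure R d T mu f mf f0).

Section StieltjesDensity.
Local Open Scope ereal_scope.
Context {R : realType}.
Notation leb := (@lebesgue_measure R).
Notation BR := (measurableTypeR R).
Variables (F : R -> R) (M : R) (phi : BR -> \bar R).
Hypotheses (cF : is_cumulative F) (F0 : F t @[t --> -oo%R] --> (0 : R)%R)
  (FM : (forall t, F t <= M)%R) (mphi : measurable_fun setT phi)
  (phi0 : forall t, 0 <= phi t)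
  (Fphi : forall a b, (a <= b)%R -> \int[leb]_(t in `]a, b]) phi t = (F b - F a)%:E).

Let muT_fin : stieltjes F setT < +oo.
Proof. by apply: le_lt_trans (stieltjes_setT_le cF F0 FM) _; rewrite ltry. Qed.

Let nu : {finite_measure set BR -> \bar R} := mfrestr (@measurableT _ BR) muT_fin.

Let nuE A : nu A = stieltjes F A.
Proof. by rewrite /nu/= /mfrestr /mrestr setIT. Qed.

Let stE (A : set BR) : measurable A -> nu A = \int[leb]_(t in A) phi t.
Proof.
move=> mA; rewrite nuE.
exact: (stieltjes_unique (mu := density_measure leb mphi phi0)).
Qed.

Let nu_dom : nu `<< leb.
Proof.
apply/null_content_dominatesP => A mA A0; rewrite stE//.
by apply: null_set_integral => //; exact: measurable_funTS.
Qed.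

Lemma integral_stieltjes_density (u : BR -> \bar R) : measurable_fun setT u ->
  (forall t, 0 <= u t) ->
  \int[stieltjes F]_t u t = \int[leb]_t (u t * phi t).
Proof.
move=> mu u0.
transitivity (\int[nu]_t u t).
  by apply: eq_measure_integral => A mA _; first [exact: nuE|exact/esym/nuE].
rewrite -(Radon_Nikodym_SigmaFinite.change_of_variables nu_dom)//.
apply: ae_eq_integral => //.
- apply: emeasurable_funM => //.
  exact: measurable_int (Radon_Nikodym_SigmaFinite.f_integrable nu_dom).
- exact: emeasurable_funM.
have : ae_eq leb setT (Radon_Nikodym_SigmaFinite.f nu leb) phi.
  apply: integral_ae_eq => //; first exact: Radon_Nikodym_SigmaFinite.f_integrable.
  by move=> E _ mE; rewrite -Radon_Nikodym_SigmaFinite.f_integral// stE.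
by apply: filterS => t /= + _ => ->.
Qed.

End StieltjesDensity.

Section PathMean.
Context {R : realType}.
Notation leb := (@lebesgue_measure R).
Notation BR := (measurableTypeR R).
Variables (k : R -> R -> R) (nut : {measure set (R * R) -> \bar R}) (g : R -> R).
Hypotheses (hk : normalizing_kernel k nut) (hac : forall x, absolutely_continuous (k ^~ x))
  (hg : measurable_fun setT g) (hfin : forall x, (htilde g k x < +oo)%E).
Variables (l : R -> R) (C : R).
Hypotheses (cl : is_cumulative l) (l0 : l t @[t --> -oo] --> (0:R)) (lC : forall t, l t <= C).

Let lT : (stieltjes l setT < +oo)%E.
Proof. by apply: le_lt_trans (stieltjes_setT_le cl l0 lC) _; rewrite ltry. Qed.

Let lam : {finite_measure set BR -> \bar R} := mfrestr (@measurableT _ BR) lT.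

Let lamE (A : set BR) : measurable A -> A `<=` setT -> stieltjes l A = lam A.
Proof. by move=> mA _; rewrite /lam/= /mfrestr /mrestr setIT. Qed.

Let lam_integral (f : BR -> \bar R) : (\int[stieltjes l]_x f x = \int[lam]_x f x)%E.
Proof.
by apply: eq_measure_integral => A mA _; first [exact: lamE|exact/esym/lamE].
Qed.

Hypotheses (S_gt0 : (0 < \int[stieltjes l]_x (kbar k x)%:E)%E)
  (S_fin : (\int[stieltjes l]_x (kbar k x)%:E < +oo)%E)
  (H_fin : (\int[stieltjes l]_x htilde g k x < +oo)%E).

Let mk := kernel_measurable hk.
Let k_nd := kernel_nondecreasing hk.
Let k_y := kernel_cvgy hk.
Let k_rc := kernel_right_continuous hk.
Let k_Ny := kernel_cvgNy hk.

Let kd := kernel_density k.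
Let mkd : measurable_fun setT kd. Proof. exact: measurable_kernel_density. Qed.
Let kd0 p : 0 <= kd p. Proof. exact: kernel_density_ge0. Qed.

Let mkt (t : R) : measurable_fun setT (k t : BR -> R).
Proof. exact: (measurable_fun_pair2 (t : R) mk). Qed.

Let kb_ge0 x : 0 <= kbar k x. Proof. exact/ltW/(kbar_gt0 hk). Qed.

Let S : R := \int[lam]_x kbar k x.

Let ikb : lam.-integrable setT (EFin \o kbar k).
Proof.
apply/integrableP; split; first by apply/measurable_EFinP; exact: (measurable_kbar mk k_y).
apply: le_lt_trans S_fin; rewrite lam_integral.
by under eq_integral do rewrite /= (ger0_norm (kb_ge0 _)).
Qed.

Let SE : (\int[stieltjes l]_x (kbar k x)%:E)%E = S%:E.
Proof. by rewrite lam_integral /S /Rintegral fineK//; exact: integrable_fin_num. Qed.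

Let S0 : 0 < S. Proof. by rewrite -lte_fin -SE. Qed.

Let kt_bound t x : `|k t x| <= kbar k x.
Proof. by rewrite ger0_norm ?(kernel_ge0 hk)//; exact: le_kbar. Qed.

Let ik t : lam.-integrable setT (EFin \o k t).
Proof.
by apply: (integrable_le (mu := lam) (g := kbar k)) => // x _; exact: kt_bound.
Qed.

Let Zr (t : R) : R := \int[lam]_x k t x.

Let ZE t : Z k l t = (Zr t)%:E.
Proof. by rewrite /Z lam_integral /Zr /Rintegral fineK//; exact: (integrable_fin_num measurableT (ik t)). Qed.

Let ZbarE : Zbar k l = S%:E.
Proof.
have cZ : Zr t @[t --> +oo] --> S.
  apply: (dominated_cvg_pinfty (mu := lam) (f_ := k) (g := kbar k)) => //.
rewrite /Zbar (_ : Z k l = EFin \o Zr); last by apply/funext => t; rewrite ZE.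
by apply: cvg_lim => //; apply: cvg_EFin => //; exact: nearW.
Qed.

Let F (t : R) : R := Zr t / S.

Let normalized_dfE : normalized_df k l = F.
Proof. by apply/funext => t; rewrite /normalized_df ZE ZbarE. Qed.

Let Zr_nd : nondecreasing_fun Zr.
Proof. by move=> s t st; apply: le_Rintegral => // x _; exact: k_nd. Qed.

Let cF : is_cumulative F.
Proof.
split; first by move=> s t st; rewrite /F ler_pM2r ?invr_gt0//; exact: Zr_nd.
move=> t; apply: cvgMl; apply/cvg_at_rightP => u [ut uc].
apply: (dominated_cvgR (mu := lam) (f_ := fun n => k (u n)) (g := kbar k)) => //.
by move=> x _; have /cvg_at_rightP := k_rc (x := x) (x0 := t); exact.
Qed.

Let F0 : F t @[t --> -oo] --> (0:R).
Proof.
rewrite -[X in _ --> X](mul0r S^-1); apply: cvgMl; apply/cvgNy_compNP.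
suff : Zr (- t) @[t --> +oo] --> \int[lam]_x cst 0 x by rewrite Rintegral_cst// mul0r.
apply: (dominated_cvg_pinfty (mu := lam) (f_ := fun t => k (- t)) (f := cst 0) (g := kbar k)) => //.
by move=> x _; apply/(cvgNy_compNP (k ^~ x)); exact: k_Ny.
Qed.

Let F1 t : F t <= 1.
Proof.
by rewrite ler_pdivrMr// mul1r; apply: le_Rintegral => // x _; exact: le_kbar.
Qed.

Let psi (t : BR) : \bar R := (\int[lam]_x (kd (t, x))%:E)%E.

Let mpsi : measurable_fun setT psi.
Proof.
apply: (@measurable_fun_fubini_tonelli_F _ _ BR BR R lam (fun p => (kd p)%:E)).
  exact/measurable_EFinP.
by move=> p; rewrite lee_fin.
Qed.

Let psi0 t : (0 <= psi t)%E. Proof. by apply: integral_ge0 => x _; rewrite lee_fin. Qed.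

Let tonelli (u : BR -> R) : measurable_fun setT u -> (forall t, 0 <= u t) ->
  (\int[leb]_t ((u t)%:E * psi t) = \int[lam]_x \int[leb]_t (u t * kd (t, x))%:E)%E.
Proof.
move=> mu u0.
have := @fubini_tonelli _ _ BR BR R leb lam (fun p => (u p.1 * kd p)%:E).
move=> <- //=.
- apply: eq_integral => t _; rewrite /psi -ge0_integralZl//.
  + by apply/measurable_EFinP; exact: (measurable_fun_pair2 t mkd).
  + by move=> x _; rewrite lee_fin.
  + by rewrite lee_fin.
- by apply/measurable_EFinP; apply: measurable_funM => //; exact: (measurableT_comp mu).
- by move=> p; rewrite lee_fin mulr_ge0.
Qed.

Let phi (t : BR) : \bar R := ((S^-1)%:E * psi t)%E.

Let phi0 t : (0 <= phi t)%E.
Proof. by rewrite mule_ge0// lee_fin invr_ge0 ltW. Qed.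

Let mphi : measurable_fun setT phi. Proof. exact: measurable_funeM. Qed.

Let Fphi a b : a <= b -> (\int[leb]_(t in `]a, b]) phi t = (F b - F a)%:E)%E.
Proof.
move=> ab; rewrite ge0_integralZl//; last 2 first.
- exact: measurable_funTS.
- by rewrite lee_fin invr_ge0 ltW.
have -> : (\int[leb]_(t in `]a, b]) psi t = \int[leb]_t ((\1_`]a, b] t)%:E * psi t))%E.
  rewrite integral_mkcond; apply: eq_integral => t _.
  by rewrite epatch_indic muleC.
rewrite tonelli//.
have -> : (\int[lam]_x \int[leb]_t (\1_`]a, b] t * kd (t, x))%:E =
    \int[lam]_x (k b x - k a x)%:E)%E.
  apply: eq_integral => x _.
  rewrite -(kernel_density_integral mk k_nd k_rc k_Ny k_y hac x ab).
  rewrite [RHS]integral_mkcond; apply: eq_integral => t _.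
  by rewrite epatch_indic muleC.
rewrite integralB_EFin//.
have E t : (\int[lam]_x (k t x)%:E)%E = (Zr t)%:E.
  by rewrite /Zr /Rintegral fineK//; exact: (integrable_fin_num measurableT (ik t)).
rewrite !E -EFinB -EFinM /F -mulrBl; congr (_%:E); exact: mulrC.
Qed.

(** By [kernel_density_integral] and Tonelli, [dF] has the density
    [t |-> S^-1 * int kernel_density (t, x) dl (x)]; a second use of Tonelli puts the
    integral in [t] inside. *)
Let dFE (u : R -> R) : measurable_fun setT u -> (forall t, 0 <= u t) ->
  (\int[stieltjes F]_t (u t)%:E = (S^-1)%:E * \int[lam]_x \int[leb]_t (u t * kd (t, x))%:E)%E.
Proof.
move=> mu u0.
have meu : measurable_fun setT (fun t : BR => (u t)%:E) by apply/measurable_EFinP.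
have u0' t : (0 <= (u t)%:E)%E by rewrite lee_fin.
transitivity (\int[leb]_t ((u t)%:E * phi t))%E.
  exact: (integral_stieltjes_density cF F0 F1 mphi phi0 Fphi meu u0').
rewrite -(tonelli mu u0).
transitivity (\int[leb]_t ((S^-1)%:E * ((u t)%:E * psi t)))%E.
  by apply: eq_integral => t _; rewrite /phi muleCA.
apply: ge0_integralZl => //.
- by apply: emeasurable_funM => //; exact/measurable_EFinP.
- by move=> t _; rewrite mule_ge0// lee_fin.
- by rewrite lee_fin invr_ge0 ltW.
Qed.

Let gp (t : R) := Num.max (g t) 0.
Let gn (t : R) := Num.max (- g t) 0.

Let mgp : measurable_fun setT gp. Proof. exact: measurable_maxr. Qed.
Let mgn : measurable_fun setT gn.
Proof. by apply: measurable_maxr => //; exact: measurableT_comp. Qed.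
Let gp0 t : 0 <= gp t. Proof. by rewrite le_max lexx orbT. Qed.
Let gn0 t : 0 <= gn t. Proof. by rewrite le_max lexx orbT. Qed.

Let inner (u : R -> R) (x : BR) : \bar R := (\int[leb]_t (u t * kd (t, x))%:E)%E.

Let inner_le (u : R -> R) x : measurable_fun setT u -> (forall t, 0 <= u t <= `|g t|) ->
  (inner u x <= htilde g k x)%E.
Proof.
move=> mu u0; rewrite (htildeE k_nd k_rc k_Ny k_y hac) /inner; apply: ge0_le_integral => //.
- by move=> t _; rewrite lee_fin mulr_ge0//; case/andP: (u0 t).
- apply/measurable_EFinP; apply: measurable_funM => //.
  exact: (measurable_fun_pair1 (x : BR) mkd).
- apply/measurable_EFinP; apply: measurable_funM; first exact: measurableT_comp.
  exact: (measurable_fun_pair1 (x : BR) mkd).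
- by move=> t _; rewrite lee_fin ler_wpM2r//; case/andP: (u0 t).
Qed.

Let gp_le t : 0 <= gp t <= `|g t|.
Proof. by rewrite gp0/= ge_max ler_norm normr_ge0. Qed.
Let gn_le t : 0 <= gn t <= `|g t|.
Proof. by rewrite gn0/= ge_max -normrN ler_norm normr_ge0. Qed.

Let inner_ge0 u x : (forall t, 0 <= u t) -> (0 <= inner u x)%E.
Proof. by move=> u0; apply: integral_ge0 => t _; rewrite lee_fin mulr_ge0. Qed.

Let minner (u : R -> R) : measurable_fun setT u -> (forall t, 0 <= u t) ->
  measurable_fun setT (inner u).
Proof. by move=> mu u0; exact: (measurable_ge0_weighted mk k_nd mu u0). Qed.

Let inner_fin (u : R -> R) x : measurable_fun setT u -> (forall t, 0 <= u t <= `|g t|) ->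
  inner u x \is a fin_num.
Proof.
move=> mu u0; rewrite ge0_fin_numE; last by apply: inner_ge0 => t; case/andP: (u0 t).
exact: le_lt_trans (inner_le x mu u0) (hfin x).
Qed.

Let inner_int (u : R -> R) : measurable_fun setT u -> (forall t, 0 <= u t <= `|g t|) ->
  lam.-integrable setT (inner u).
Proof.
move=> mu u0; have u0' t : 0 <= u t by case/andP: (u0 t).
apply/integrableP; split; first exact: minner.
have E : (\int[lam]_x `|inner u x| = \int[lam]_x inner u x)%E.
  by apply: eq_integral => x _; apply: gee0_abs; exact: inner_ge0.
have H : (\int[lam]_x htilde g k x < +oo)%E.
  by rewrite -(lam_integral (htilde g k)); exact: H_fin.
rewrite E; apply: le_lt_trans H.
apply: (@ge0_le_integral _ BR R lam setT measurableT (inner u) (htilde g k)).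
- by move=> x _; exact: inner_ge0.
- exact: minner.
- exact: (measurable_htilde mk k_nd k_rc k_Ny k_y hac hg).
- by move=> x _; exact: inner_le.
Qed.

Let fine_scaleB (c : R) (x y : \bar R) : x \is a fin_num -> y \is a fin_num ->
  fine (c%:E * x - c%:E * y)%E = fine (x - y)%E * c.
Proof.
move=> xfin yfin; rewrite -(fineK xfin) -(fineK yfin).
by move: (fine x) (fine y) => p q; rewrite -!EFinM -!EFinB /= -mulrBr mulrC.
Qed.

(** The positive and the negative part of [g] are treated separately by [dFE] and
    recombined inside the integral in [x], where they give [h]. *)
Lemma mean_normalized_df : mean g (normalized_df k l) =
  (\int[stieltjes l]_x h g k x) / (\int[stieltjes l]_x kbar k x).
Proof.
rewrite normalized_dfE.
have -> : \int[stieltjes l]_x kbar k x = S by rewrite /Rintegral SE.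
have hx x : (h g k x)%:E = (inner gp x - inner gn x)%E.
  rewrite (hE k_nd k_rc k_Ny k_y hac g x) -[RHS]fineK; last first.
    by rewrite fin_numB !inner_fin.
  congr (_%:E); rewrite /Rintegral integralE; congr (fine (_ - _)%E);
    apply: eq_integral => t _.
    rewrite funeposE /= -EFin_max -[X in Num.max _ X](mul0r (kd (t, x))).
    by rewrite maxr_pMl.
  rewrite funenegE /= -EFin_max -mulNr -[X in Num.max _ X](mul0r (kd (t, x))).
  by rewrite maxr_pMl.
have -> : \int[stieltjes l]_x h g k x =
    fine (\int[lam]_x inner gp x - \int[lam]_x inner gn x)%E.
  rewrite /Rintegral lam_integral; congr fine.
  by under eq_integral do rewrite hx; rewrite integralB// inner_int.
rewrite /mean /Rintegral.
have ep (t : R) : ((fun t => (g t)%:E)^\+ t = (gp t)%:E)%E by rewrite funeposE -EFin_max.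
have en (t : R) : ((fun t => (g t)%:E)^\- t = (gn t)%:E)%E.
  by rewrite funenegE -EFinN -EFin_max.
have gE : (\int[stieltjes F]_t (g t)%:E =
    \int[stieltjes F]_t (gp t)%:E - \int[stieltjes F]_t (gn t)%:E)%E.
  rewrite [LHS]integralE; congr (_ - _)%E; apply: eq_integral => t _.
    exact: ep.
  exact: en.
pose Ip := (\int[lam]_x inner gp x)%E; pose In := (\int[lam]_x inner gn x)%E.
transitivity (fine ((S^-1)%:E * Ip - (S^-1)%:E * In)%E).
  congr fine; apply: (etrans gE); congr (_ - _)%E.
    exact: (dFE mgp gp0).
  exact: (dFE mgn gn0).
have fp : Ip \is a fin_num.
  exact: (integrable_fin_num measurableT (inner_int mgp gp_le)).
have fn : In \is a fin_num.
  exact: (integrable_fin_num measurableT (inner_int mgn gn_le)).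
exact: (fine_scaleB S^-1 fp fn).
Qed.

End PathMean.

(** * Classes of functions closed under bounded pointwise limits *)

Section StepApproximation.
Context {R : realType}.

Definition step_approx (n : nat) (v : R -> R) (y : R) : R :=
  \sum_(i < grid_size n) v (grid n i.+1) * \1_(grid_cell n i : set R) y.

Lemma step_approx_in n v y i : (i < grid_size n)%N -> grid_cell n i y ->
  step_approx n v y = v (grid n i.+1).
Proof.
move=> iN yi; rewrite /step_approx (bigD1 (Ordinal iN))//= indicE mem_set// mulr1.
rewrite big1 ?addr0// => j ji; rewrite indicE memNset ?mulr0// => yj.
move/eqP : ji; apply; apply/val_inj => /=.
by apply: (@trivIset_grid_cell R n) => //; exists y.
Qed.

Lemma step_approx_out n v y : ~~ (- n%:R < y <= n%:R) -> step_approx n v y = 0.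
Proof.
move=> yn; rewrite /step_approx big1// => i _; rewrite indicE memNset ?mulr0//.
rewrite /grid_cell/= in_itv/= => /andP[y1 y2]; apply/negP : yn; rewrite negbK.
rewrite -grid0 -[X in _ && (_ <= X)]grid_last.
by rewrite (le_lt_trans (le_grid n (leq0n i)) y1)/= (le_trans y2)// le_grid.
Qed.

Lemma step_approx_cases n v y : (exists2 i, (i < grid_size n)%N & grid_cell n i y) \/
  step_approx n v y = 0.
Proof.
have [h|h] := boolP (- n%:R < y <= n%:R); first by left; exact: mem_grid_cell.
by right; exact: step_approx_out.
Qed.

Lemma grid_cell_dist n i (y : R) : grid_cell n i y -> `|grid n i.+1 - y| <= n.+1%:R^-1.
Proof.
rewrite /grid_cell/= in_itv/= grid_step => /andP[].
move: (grid n i) (n.+1%:R^-1) => a b h1 h2.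
by rewrite ger0_norm; lra.
Qed.

Lemma step_approx_cvg v y : {for y, continuous v} -> step_approx n v y @[n --> \oo] --> v y.
Proof.
move=> cv; apply/cvgrPdist_le => e e0.
have /cvgrPdist_le/(_ e e0)[d /= d0 Hd] := cv.
near=> n.
have [|i iN yi] := @mem_grid_cell R n y; first by near: n; exact: near_grid_range.
rewrite (step_approx_in _ iN yi); apply: Hd; rewrite /ball_/= distrC.
apply: le_lt_trans (grid_cell_dist yi) _.
by near: n; exact: near_infty_natSinv_lt (PosNum d0).
Unshelve. all: by end_near. Qed.

Lemma step_approx_id_bound n y : `|step_approx n idfun y| <= `|y| + 1.
Proof.
have [[i iN yi]|->] := step_approx_cases n idfun y; last by rewrite normr0 addr_ge0.
rewrite (step_approx_in _ iN yi) -[grid _ _](subrK y) (le_trans (ler_normD _ _))//.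
rewrite addrC lerD2l (le_trans (grid_cell_dist yi))// invf_le1// ler1n//.
Qed.

End StepApproximation.

Section BoundedPointwiseClasses.
Context {R : realType}.
Implicit Types (Cl : (R -> R) -> Prop) (f h v : R -> R) (A : set R).

Definition bp_closed Cl := forall (f_ : nat -> R -> R) f M, (forall n, Cl (f_ n)) ->
  (forall n x, `|f_ n x| <= M) -> (forall x, f_ n x @[n --> \oo] --> f x) -> Cl f.

(** [step_approx n idfun \o f] is a linear combination of indicators of sets
    [f @^-1` ]a, b]], and tends to [f]. *)
Lemma linear_bp_class Cl : bp_closed Cl ->
  (forall a f h, Cl f -> Cl h -> Cl (fun x => a * f x + h x)) ->
  (forall A, measurable A -> Cl (\1_A)) ->
  forall f M, measurable_fun setT f -> (forall x, `|f x| <= M) -> Cl f.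
Proof.
move=> cCl lCl iCl f M mf fM.
have Cl0 : Cl (fun=> 0).
  have -> : (fun=> 0) = (fun x : R => (-1) * \1_(set0 : set R) x + \1_(set0 : set R) x) :> (R -> R).
    by apply/funext => x; rewrite mulN1r addNr.
  by apply: lCl; exact: iCl.
apply: (cCl (fun n x => step_approx n idfun (f x)) f (M + 1)).
- move=> n; rewrite /step_approx; elim: (grid_size n) => [|N IH].
    by under eq_fun do rewrite big_ord0.
  have -> : (fun x => \sum_(i < N.+1) idfun (grid n i.+1) * \1_(grid_cell n i : set R) (f x)) =
      (fun x => grid n N.+1 * \1_(f @^-1` grid_cell n N) x +
        \sum_(i < N) idfun (grid n i.+1) * \1_(grid_cell n i : set R) (f x)) :> (R -> R).
    by apply/funext => x; rewrite big_ord_recr/= addrC.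
  apply: lCl => //; apply: iCl; rewrite -[X in measurable X]setTI; apply: mf => //.
  exact: measurable_itv.
- by move=> n x; rewrite (le_trans (step_approx_id_bound n _))// lerD2r.
- by move=> x; apply: step_approx_cvg; exact: cvg_id.
Qed.

(** The smallest class that contains the bounded continuous functions and is closed
    under bounded pointwise limits.  An arbitrary class need not be a vector space,
    but this one is, as fixing one summand at a time shows. *)
Let hull f := forall Cl, bp_closed Cl ->
  (forall v, continuous v -> (exists M, forall x, `|v x| <= M) -> Cl v) -> Cl f.

Let hull_bp : bp_closed hull.
Proof.
move=> f_ f M Hf fM ff Cl cCl Cc; apply: (cCl f_ f M) => // n.
exact: Hf.
Qed.

Let hull_cont v : continuous v -> (exists M, forall x, `|v x| <= M) -> hull v.
Proof. by move=> cv bv Cl cCl; exact. Qed.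

Let hull_bounded f : hull f -> exists M, forall x, `|f x| <= M.
Proof.
move=> /(_ (fun f => exists M, forall x, `|f x| <= M)); apply => // f_ h M _ fM fh; exists M => x.
rewrite -(cvg_lim (@Rhausdorff R) (cvg_norm (fh x))); apply: limr_le.
  by apply/cvg_ex; eexists; exact: cvg_norm (fh x).
exact: nearW.
Qed.

Let hull_linear a f h : hull f -> hull h -> hull (fun x => a * f x + h x).
Proof.
move=> Hf Hh.
have step1 v : continuous v -> (exists M, forall x, `|v x| <= M) ->
    hull (fun x => a * f x + v x).
  move=> cv [Mv vM]; apply: (Hf (fun f => hull (fun x => a * f x + v x))).
    move=> f_ f' M Hf_ fM ff.
    apply: (hull_bp (f_ := fun n x => a * f_ n x + v x) (M := `|a| * M + Mv)) => //.
      move=> n x; rewrite (le_trans (ler_normD _ _))// lerD// normrM ler_wpM2l//.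
    by move=> x; apply: cvgD; [exact: cvgMr|exact: cvg_cst].
  move=> u cu [Mu uM]; apply: hull_cont.
    move=> x; apply: cvgD; last exact: cv.
    by apply: cvgMr; exact: cu.
  exists (`|a| * Mu + Mv) => x.
  by rewrite (le_trans (ler_normD _ _))// lerD// normrM ler_wpM2l.
apply: (Hh (fun h => hull (fun x => a * f x + h x))); last exact: step1.
have [Mf fM] := hull_bounded Hf.
move=> h_ h' M Hh_ hM hh.
apply: (hull_bp (f_ := fun n x => a * f x + h_ n x) (M := `|a| * Mf + M)) => //.
  by move=> n x; rewrite (le_trans (ler_normD _ _))// lerD// normrM ler_wpM2l.
by move=> x; apply: cvgD; [exact: cvg_cst|exact: hh].
Qed.

Let hull_ray (b : R) : hull (\1_(`]-oo, b]%classic : set R)).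
Proof.
pose v (n : nat) (y : R) : R := Num.max 0 (Num.min 1 (1 - n%:R * (y - b))).
apply: (hull_bp (f_ := v) (M := 1)).
- move=> n; apply: hull_cont.
    move=> y; apply: (@continuous_max R R (cst 0) (fun y => Num.min 1 (1 - n%:R * (y - b)))).
      exact: cvg_cst.
    apply: (@continuous_min R R (cst 1) (fun y => 1 - n%:R * (y - b))); first exact: cvg_cst.
    apply: cvgB; first exact: cvg_cst.
    by apply: cvgMr; apply: cvgB; [exact: cvg_id|exact: cvg_cst].
  exists 1 => x; rewrite /v ger0_norm ?le_max ?lexx// ge_max ler01/= ge_min lexx//.
- by move=> n x; rewrite /v ger0_norm ?le_max ?lexx// ge_max ler01/= ge_min lexx.
- move=> y; apply: cvg_near_cst; have [yb|yb] := leP y b.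
    near=> n; rewrite indicE mem_set/=; last by rewrite in_itv.
    rewrite /v min_l; first by rewrite max_r.
    by rewrite lerBrDl gerDr mulr_ge0_le0// subr_le0.
  near=> n; rewrite indicE memNset/=; last by rewrite in_itv/= leNgt yb.
  rewrite /v max_l// ge_min; apply/orP; right.
  rewrite lerBlDr add0r -ler_pdivrMr ?subr_gt0// div1r.
  by near: n; exact: nbhs_infty_ger.
Unshelve. all: by end_near. Qed.

(** A Dynkin class argument: half-lines are limits of continuous ramps, and the
    intervals [`]a, b]] are stable under intersection. *)
Let hull_indic A : measurable A -> hull (\1_A).
Proof.
have h0 : hull (fun=> 0).
  by apply: hull_cont => [x|]; [exact: cvg_cst|exists 0 => x; rewrite normr0].
have h1 : hull (fun=> 1).
  by apply: hull_cont => [x|]; [exact: cvg_cst|exists 1 => x; rewrite normr1].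
apply: (@dynkin_induction _ R (@ocitv R) (fun A => hull (\1_A))) => //.
- exact: ocitvI.
- by rewrite (_ : \1_setT = (fun=> 1)) //; apply/funext => x; rewrite indicE in_setT.
- move=> _ [[a b]/= _ <-]; have [ab|ba] := leP a b.
    have -> : \1_(`]a, b]%classic : set R) =
        (fun x => (-1) * \1_(`]-oo, a]%classic : set R) x + \1_(`]-oo, b]%classic : set R) x) :> (R -> R).
      apply/funext => x; rewrite !indicE.
      have E (i : interval R) : (x \in [set` i]) = (x \in i).
        by apply/idP/idP => [/set_mem|h]//; exact: mem_set.
      rewrite !E !in_itv/=; case: (ltP a x) => ax/=; first by rewrite mulr0 add0r.
      by rewrite (le_trans ax ab) mulN1r addNr.
    by apply: hull_linear; exact: hull_ray.
  rewrite set_itv_ge ?bnd_simp -?leNgt ?(ltW ba)//.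
  by rewrite (_ : \1_set0 = (fun=> 0))//; apply/funext => x; rewrite indicE in_set0.
- move=> S mS HS.
  have -> : \1_(~` S) = (fun x => (-1) * \1_S x + 1) :> (R -> R).
    by apply/funext => x; rewrite !indicE in_setC; case: (x \in S); rewrite ?mulr1 ?mulr0 ?addNr ?add0r.
  exact: hull_linear.
- move=> F mF tF HF.
  pose s (n : nat) (x : R) : R := \sum_(i < n) \1_(F i) x.
  have sE n x : s n x = \1_(\big[setU/set0]_(i < n) F i) x.
    elim: n => [|n IH]; first by rewrite /s !big_ord0 indicE in_set0.
    rewrite /s !big_ord_recr/= -/(s n x) IH !indicE in_setU.
    case: (boolP (x \in F n)) => xn; last by rewrite orbF addr0.
    rewrite orbT memNset ?add0r// -bigcup_mkord => -[i /= iN xi].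
    have := tF i n I I; move/set_mem : xn => xn.
    by move=> /(_ (ex_intro _ x (conj xi xn))) E; rewrite E ltnn in iN.
  apply: (hull_bp (f_ := s) (M := 1)).
  + move=> n; elim: n => [|n IH]; first by rewrite /s; under eq_fun do rewrite big_ord0.
    have -> : s n.+1 = (fun x => 1 * \1_(F n) x + s n x).
      by apply/funext => x; rewrite /s big_ord_recr/= mul1r addrC.
    by apply: hull_linear => //; exact: HF.
  + by move=> n x; rewrite sE indicE; case: (_ \in _); rewrite ?normr1 ?normr0.
  + move=> x; apply: cvg_near_cst; have [[k _ xk]|nx] := pselect ((\bigcup_k F k) x).
      near=> n; rewrite sE !indicE !mem_set//; first by exists k.
      by rewrite -bigcup_mkord; exists k => //=; near: n; exact: nbhs_infty_gt.
    near=> n; rewrite sE !indicE !memNset// -bigcup_mkord => -[i _ xi].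
    by apply: nx; exists i.
Unshelve. all: by end_near. Qed.

(** The functional monotone class theorem in the form in which Laplace functionals
    need it: no linearity is asked of [Cl]. *)
Theorem bounded_measurable_class Cl : bp_closed Cl ->
  (forall v, continuous v -> (exists M, forall x, `|v x| <= M) -> Cl v) ->
  forall f M, measurable_fun setT f -> (forall x, `|f x| <= M) -> Cl f.
Proof.
move=> cCl Cc f M mf fM.
by apply: (linear_bp_class hull_bp hull_linear hull_indic mf fM).
Qed.

End BoundedPointwiseClasses.

(** * Expectation of a product of independent variables *)

Section IndependentProducts.
Context {R : realType} {d : measure_display} {T : measurableType d}.
Variable P : probability T R.

Lemma bounded_probability_integrable (f : T -> R) (C : R) : measurable_fun setT f ->
  (forall w, `|f w| <= C) -> P.-integrable setT (EFin \o f).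
Proof.
move=> mf fC; apply: (integrable_le (mu := P) (g := fun=> C)) => //.
exact: finite_measure_integrable_cst.
Qed.

(** Both sides are linear in [f] and continuous under bounded pointwise limits. *)
Let independent_extension (V X : T -> R) (c : R) :
  measurable_fun setT V -> (forall w, `|V w| <= 1) -> measurable_fun setT X ->
  (forall A, measurable A -> \int[P]_w (\1_A (X w) * V w) = c * \int[P]_w \1_A (X w)) ->
  forall f : R -> R, measurable_fun setT f -> (forall x, `|f x| <= 1) ->
  \int[P]_w (f (X w) * V w) = c * \int[P]_w f (X w).
Proof.
move=> mV V1 mX indA f mf f1.
pose Cl (f : R -> R) := [/\ measurable_fun setT f, exists M, forall x, `|f x| <= M &
  \int[P]_w (f (X w) * V w) = c * \int[P]_w f (X w)].
suff [] : Cl f by [].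
have intV (h : R -> R) M : measurable_fun setT h -> (forall x, `|h x| <= M) ->
    P.-integrable setT (EFin \o (fun w => h (X w) * V w)).
  move=> mh hM; apply: (@bounded_probability_integrable _ M).
    by apply: measurable_funM => //; exact: measurableT_comp.
  by move=> w; rewrite normrM -[leRHS]mulr1 ler_pM.
have intX (h : R -> R) M : measurable_fun setT h -> (forall x, `|h x| <= M) ->
    P.-integrable setT (EFin \o (fun w => h (X w))).
  by move=> mh hM; apply: (@bounded_probability_integrable _ M) => //; exact: measurableT_comp.
apply: (@linear_bp_class R Cl _ _ _ f 1 mf f1).
- move=> f_ h M Hf fM fh; split.
  + by apply: (measurable_fun_cvg (h := f_)) => // n; case: (Hf n).
  + exists M => x; rewrite -(cvg_lim (@Rhausdorff R) (cvg_norm (fh x))).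
    apply: limr_le; first by apply/cvg_ex; eexists; exact: cvg_norm (fh x).
    exact: nearW.
  + have l1 : \int[P]_w (f_ n (X w) * V w) @[n --> \oo] --> \int[P]_w (h (X w) * V w).
      apply: (dominated_cvgR (mu := P) (f_ := fun n w => f_ n (X w) * V w) (g := fun=> M)) => //.
      * by move=> n; have [mf_ _ _] := Hf n; apply: measurable_funM => //; exact: measurableT_comp.
      * by move=> w _; apply: cvgMl; exact: fh.
      * by move=> n w _; rewrite normrM -[leRHS]mulr1 ler_pM.
      * exact: finite_measure_integrable_cst.
    have l2 : \int[P]_w f_ n (X w) @[n --> \oo] --> \int[P]_w h (X w).
      apply: (dominated_cvgR (mu := P) (f_ := fun n w => f_ n (X w)) (g := fun=> M)) => //.
      * by move=> n; have [mf_ _ _] := Hf n; exact: measurableT_comp.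
      * exact: finite_measure_integrable_cst.
    have l3 : c * \int[P]_w f_ n (X w) @[n --> \oo] --> c * \int[P]_w h (X w) by exact: cvgMr.
    apply: (cvg_unique (@Rhausdorff R) l1).
    rewrite (_ : (fun n => \int[P]_w (f_ n (X w) * V w)) = (fun n => c * \int[P]_w f_ n (X w)))//.
    by apply/funext => n; case: (Hf n).
- move=> a u v [mu [Mu uM] Eu] [mv [Mv vM] Ev]; split.
  + by apply: measurable_funD => //; exact: measurable_funM.
  + exists (`|a| * Mu + Mv) => x.
    by rewrite (le_trans (ler_normD _ _))// lerD// normrM ler_wpM2l.
  + have -> : \int[P]_w ((a * u (X w) + v (X w)) * V w) =
        a * \int[P]_w (u (X w) * V w) + \int[P]_w (v (X w) * V w).
      rewrite -RintegralZl//; last exact: intV uM.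
      rewrite -RintegralD//; last 2 first.
      * by apply: integrable_mulrl => //; exact: intV uM.
      * exact: intV vM.
      by apply: eq_Rintegral => w _; ring.
    have -> : \int[P]_w (a * u (X w) + v (X w)) =
        a * \int[P]_w u (X w) + \int[P]_w v (X w).
      rewrite -RintegralZl//; last exact: intX uM.
      rewrite -RintegralD//; last exact: intX vM.
      by apply: integrable_mulrl => //; exact: intX uM.
    by rewrite Eu Ev; ring.
- move=> A mA; split; first exact: measurable_indic.
  + by exists 1 => x; rewrite indicE; case: (_ \in _); rewrite ?normr1 ?normr0.
  + exact: indA.
Qed.

(** The product rule for sets is the case of indicators; the factors are replaced by
    general functions one at a time, the induction [psi] keeping indicators in the
    positions not treated yet. *)
Lemma independent_expectation_prod (n : nat) (X : 'I_n -> T -> R) (phi : 'I_n -> R -> R) :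
  mutually_independent P X -> (forall i, measurable_fun setT (X i)) ->
  (forall i, measurable_fun setT (phi i)) -> (forall i x, `|phi i x| <= 1) ->
  \int[P]_w (\prod_i phi i (X i w)) = \prod_i \int[P]_w phi i (X i w).
Proof.
move=> indX mX mphi phi1.
pose psi (j : nat) (B : 'I_n -> set R) (i : 'I_n) : R -> R :=
  if (i < j)%N then phi i else \1_(B i).
suff H j : (j <= n)%N -> forall B, (forall i, measurable (B i)) ->
    \int[P]_w (\prod_i psi j B i (X i w)) = \prod_i \int[P]_w psi j B i (X i w).
  have := H n (leqnn n) (fun=> setT) (fun=> measurableT).
  by rewrite /psi; under eq_Rintegral do under eq_bigr do rewrite ltn_ord;
     under [in RHS]eq_bigr do rewrite ltn_ord.
have mpsi k B i : (forall i, measurable (B i)) -> measurable_fun setT (psi k B i).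
  by move=> mB; rewrite /psi; case: ifP => // _; exact: measurable_indic.
have psi1 k B i x : `|psi k B i x| <= 1.
  by rewrite /psi; case: ifP => // _; rewrite indicE; case: (_ \in _); rewrite ?normr1 ?normr0.
elim: j => [_ B mB|j IH jn B mB].
  rewrite /psi /=.
  have E (A : set T) : measurable A -> \int[P]_w \1_A w = fine (P A) :> R.
    by move=> mA; rewrite /Rintegral integral_indic// setIT.
  have mXB i : measurable (X i @^-1` B i) by rewrite -[X in measurable X]setTI; exact: mX.
  transitivity (\int[P]_w (\1_(\bigcap_(i in [set: 'I_n]) (X i @^-1` B i)) w : R)).
    apply: eq_Rintegral => w _; rewrite indicE.
    have [wB|nwB] := pselect ((\bigcap_(i in [set: 'I_n]) (X i @^-1` B i)) w).
      by rewrite mem_set// big1// => i _; rewrite indicE mem_set//; exact: wB.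
    rewrite memNset//; apply/eqP/prodf_eq0.
    have /existsNP[i /not_implyP[_ nB]] := nwB.
    by exists i => //; rewrite indicE memNset.
  rewrite E; last exact: fin_bigcap_measurable.
  rewrite indX//.
  have {}E i : \int[P]_w \1_(B i) (X i w) = fine (P (X i @^-1` B i)) :> R by rewrite -E.
  under [RHS]eq_bigr do rewrite E.
  suff -> : (\prod_(i < n) P (X i @^-1` B i) = (\prod_i fine (P (X i @^-1` B i)))%:E)%E by [].
  by rewrite -prodEFin; apply: eq_bigr => i _; rewrite fineK//; exact: fin_num_measure.
pose i0 := Ordinal jn.
pose V w := \prod_(i | i != i0) psi j.+1 B i (X i w).
have VE (B' : 'I_n -> set R) w : (forall i, i != i0 -> B' i = B i) ->
    \prod_(i | i != i0) psi j B' i (X i w) = V w.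
  move=> BB; apply: eq_bigr => i ii0; rewrite /psi BB//.
  rewrite [(i < j.+1)%N]ltnS [(i <= j)%N]leq_eqVlt; case: (ltnP i j) => ij; first by rewrite orbT.
  by rewrite orbF; case: eqP => // ij'; move: ii0; rewrite -val_eqE/= ij' eqxx.
have IE (B' : 'I_n -> set R) : (forall i, i != i0 -> B' i = B i) ->
    \prod_(i | i != i0) \int[P]_w psi j B' i (X i w) =
    \prod_(i | i != i0) \int[P]_w psi j.+1 B i (X i w).
  move=> BB; apply: eq_bigr => i ii0; congr Rintegral; apply/funext => w.
  rewrite /psi BB// [(i < j.+1)%N]ltnS [(i <= j)%N]leq_eqVlt; case: (ltnP i j) => ij; first by rewrite orbT.
  by rewrite orbF; case: eqP => // ij'; move: ii0; rewrite -val_eqE/= ij' eqxx.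
have psi0 : psi j.+1 B i0 = phi i0 by rewrite /psi/= ltnSn.
rewrite (bigD1 i0)//= psi0.
under eq_Rintegral do rewrite (bigD1 i0)//= psi0.
rewrite -/(V _) [RHS]mulrC.
apply: (independent_extension (V := V) (X := X i0)) => //.
- have -> : V = (fun w => \prod_i (if i != i0 then psi j.+1 B i (X i w) else 1)).
    by apply/funext => w; rewrite /V big_mkcond.
  by apply: measurable_prod => i _; case: (i != i0) => //; apply: measurableT_comp => //; exact: mpsi.
- move=> w; rewrite /V; apply: (big_ind (fun x => `|x| <= 1)) => //; rewrite ?normr1// => x y x1 y1.
  by rewrite normrM -[leRHS]mulr1 ler_pM.
move=> A mA; pose B' i := if i == i0 then A else B i.
have BB i : i != i0 -> B' i = B i by rewrite /B' => /negPf ->.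
have mB' i : measurable (B' i) by rewrite /B'; case: ifP.
have := IH (ltnW jn) B' mB'.
have psi00 : psi j B' i0 = \1_A by rewrite /psi/= ltnn /B' eqxx.
rewrite [in RHS](bigD1 i0)//= psi00 IE// [RHS]mulrC => <-.
by apply: eq_Rintegral => w _; rewrite (bigD1 i0)//= psi00 VE.
Qed.

End IndependentProducts.

(** * The Laplace functional of the driving process *)

Definition jump_ray {R : realType} (x : R) : set (R * R) :=
  `]-oo, x]%classic `*` `]0, +oo[%classic.

(** What the rest of the argument uses of the driving process.  [C] bounds the total
    mass of each path; in the application it is the value of the process at
    the end of its time scale. *)
Record driving_paths {R : realType} {d : measure_display} {T : measurableType d}
    (P : probability T R) (l : R -> T -> R) (C : T -> R)
    (nut : {measure set (R * R) -> \bar R}) : Prop := {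
  path_cumulative : forall w, is_cumulative (l ^~ w) ;
  path_cvgNy : forall w, l t w @[t --> -oo] --> (0 : R) ;
  path_le : forall t w, l t w <= C w ;
  measurable_path_bound : measurable_fun setT C ;
  measurable_path : forall t, measurable_fun setT (l t) ;
  path_independent_increments : forall (n : nat) (t : nat -> R),
    {homo t : i j / (i <= j)%N >-> i <= j} ->
    mutually_independent P (fun (i : 'I_n) w => l (t i.+1) w - l (t i) w) ;
  path_laplace_split : forall (a b lambda : R), a <= b -> 0 <= lambda ->
    \int[P]_w expR (- (lambda * l b w)) =
    \int[P]_w expR (- (lambda * l a w)) *
    \int[P]_w expR (- (lambda * (l b w - l a w))) ;
  ray_integrable : forall x lambda : R, 0 <= lambda ->
    nut.-integrable (jump_ray x)
      (EFin \o (fun p : R * R => 1 - expR (- (lambda * p.2)))) ;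
  path_laplace : forall x lambda : R, 0 <= lambda ->
    \int[P]_w expR (- (lambda * l x w)) =
    expR (- \int[nut]_(p in jump_ray x) (1 - expR (- (lambda * p.2)))) }.

Section LaplaceFunctional.
Context {R : realType} {d : measure_display} {T : measurableType d}.
Variable P : probability T R.
Variables (l : R -> T -> R) (C : T -> R) (nut : {measure set (R * R) -> \bar R}).
Hypothesis hl : driving_paths P l C nut.

Let l_cum := path_cumulative hl.
Let l_Ny := path_cvgNy hl.
Let lC := path_le hl.
Let mC := measurable_path_bound hl.
Let ml := measurable_path hl.
Let l_incr := path_independent_increments hl.
Let l_split := path_laplace_split hl.

Let jump_cell (a b : R) : set (R * R) := `]a, b]%classic `*` `]0, +oo[%classic.

Let l_int := ray_integrable hl.
Let l_laplace := path_laplace hl.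

Let m_ray (x : R) : measurable (jump_ray x).
Proof. by apply: measurableX; exact: measurable_itv. Qed.

Let m_cell a b : measurable (jump_cell a b).
Proof. by apply: measurableX; exact: measurable_itv. Qed.

Lemma measurable_jumps : measurable (@jumps R).
Proof. by apply: measurableX => //; exact: measurable_itv. Qed.

Let ray_split (a b : R) : a <= b -> jump_ray b = jump_ray a `|` jump_cell a b.
Proof.
move=> ab; apply/seteqP; split => -[x v]; rewrite /jump_ray /jump_cell/= !in_itv/= andbT.
  move=> [xb v0]; have [xa|ax] := leP x a; first by left; split.
  by right; split => //; apply/andP.
by move=> -[[xa v0]|[/andP[_ xb] v0]]; split => //; exact: le_trans xa ab.
Qed.

Let ray_disj (a b : R) : [disjoint jump_ray a & jump_cell a b].
Proof.
apply/disj_set2P/seteqP; split => // -[x v] [[/= xa _] [/= xb _]].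
by move: xa xb; rewrite /= !in_itv/= => xa /andP[ax _]; rewrite ltNge xa in ax.
Qed.

Let l_ge0 t w : 0 <= l t w.
Proof.
have nd := (l_cum w).1.
rewrite -(cvg_lim (@Rhausdorff R) (l_Ny w)); apply: limr_le.
  by apply/cvg_ex; eexists; exact: (l_Ny w).
by near=> s; apply: nd; near: s; apply: nbhs_ninfty_le; rewrite num_real.
Unshelve. all: by end_near. Qed.

(** Divide the Laplace transforms at [b] and at [a]. *)
Lemma increment_laplace a b lambda : a <= b -> 0 <= lambda ->
  \int[P]_w expR (- (lambda * (l b w - l a w))) =
  expR (- \int[nut]_(p in jump_cell a b) (1 - expR (- (lambda * p.2)))).
Proof.
move=> ab l0; have := l_split ab l0; rewrite (l_laplace b l0) (l_laplace a l0).
rewrite (ray_split ab) Rintegral_setU//; last first.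
  by rewrite -(ray_split ab); exact: l_int.
rewrite opprD expRD => /mulfI -> //.
by rewrite gt_eqF// expR_gt0.
Qed.

Let mp2 (lambda : R) (D : set (R * R)) : measurable_fun D (fun p : R * R => 1 - expR (- (lambda * p.2))).
Proof.
apply: measurable_funTS; apply: measurable_funB => //; apply: measurable_fun_exp.
by apply: measurable_fun_opp; apply: measurable_funM.
Qed.

(** The rays increase to the whole jump space, and by [path_laplace] the integral on
    each of them is at most [- ln E e^(- lambda C)]. *)
Lemma integrable_jumps lambda : 0 <= lambda ->
  nut.-integrable (@jumps R) (EFin \o (fun p => 1 - expR (- (lambda * p.2)))).
Proof.
move=> l0.
have f0 p : (@jumps R) p -> (0 <= (1 - expR (- (lambda * p.2)))%:E)%E.
  move=> [_ /=]; rewrite in_itv/= andbT => p0.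
  by rewrite lee_fin subr_ge0 expRN_le1// mulr_ge0// ltW.
apply/integrableP; split; first by apply/measurable_EFinP; exact: mp2.
rewrite (eq_integral (fun p : R * R => (1 - expR (- (lambda * p.2)))%:E)); last first.
  by move=> p; rewrite inE => pj; rewrite gee0_abs// f0.
pose c := \int[P]_w expR (- (lambda * C w)).
have mexp (f : T -> R) : measurable_fun setT f -> measurable_fun setT (fun w => expR (- (lambda * f w))).
  by move=> mf; measurability.
have C0 w : 0 <= C w by exact: le_trans (l_ge0 0 w) (lC 0 w).
have iexp (f : T -> R) : measurable_fun setT f -> (forall w, 0 <= f w) ->
    P.-integrable setT (EFin \o (fun w => expR (- (lambda * f w)))).
  move=> mf ff; apply: (@bounded_probability_integrable _ _ _ _ _ 1); first exact: mexp.
  by move=> w; rewrite ger0_norm ?expR_ge0// expRN_le1// mulr_ge0.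
have c0 : 0 < c.
  rewrite lt_neqAle Rintegral_ge0 ?andbT; last by move=> w _; exact: expR_ge0.
  apply/eqP => c0.
  have : (\int[P]_w `|(expR (- (lambda * C w)))%:E| = 0)%E.
    under eq_integral do rewrite gee0_abs ?lee_fin ?expR_ge0//.
    have fin : (\int[P]_w (expR (- (lambda * C w)))%:E)%E \is a fin_num.
      by apply: integrable_fin_num => //; exact: iexp.
    by rewrite -(fineK fin); congr (_%:E); rewrite -/(Rintegral _ _ _) -/c -c0.
  move/ae_eq_integral_abs => /(_ measurableT) H.
  have [|N [mN N0 sN]] := H; first by apply/measurable_EFinP; exact: mexp.
  have : P setT = 0%E.
    apply/eqP; rewrite -measure_le0 -N0; apply: le_measure; rewrite ?inE//.
    move=> w _; apply: sN => /= /(_ I) [] /eqP; rewrite gt_eqF//; exact: expR_gt0.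
  by have := @probability_setT _ _ _ P => -> /eqP; rewrite onee_eq0.
have bound n : (\int[nut]_(p in jump_ray (n%:R : R)) (1 - expR (- (lambda * p.2)))%:E <= (- ln c)%:E)%E.
  have fin := integrable_fin_num (m_ray n%:R) (l_int n%:R l0).
  rewrite -(fineK fin) lee_fin lerNr.
  have -> : - fine (\int[nut]_(p in jump_ray (n%:R : R)) (1 - expR (- (lambda * p.2)))%:E)%E =
     ln (\int[P]_w expR (- (lambda * l n%:R w))) by rewrite l_laplace// expRK.
  have I0 : 0 < \int[P]_w expR (- (lambda * l n%:R w)).
    by rewrite (l_laplace _ l0); exact: expR_gt0.
  rewrite (ler_ln c0 I0).
  apply: le_Rintegral => //; [exact: iexp|by apply: iexp|].
  by move=> w _; rewrite ler_expR lerN2 ler_wpM2l.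
have -> : @jumps R = \bigcup_n jump_ray (n%:R : R).
  apply/seteqP; split => -[x v] /=; last by move=> [n _ [_ ?]]; split.
  move=> [_ v0]; near \oo => n; exists n => //; split => //=.
  by rewrite in_itv/=; near: n; exact: nbhs_infty_ger.
have nd : nondecreasing_seq (fun n : nat => jump_ray (n%:R : R)).
  move=> m n mn; apply/subsetPset => -[x v] [/= xm v0]; split => //=.
  by move: xm; rewrite /= !in_itv/= => /le_trans; apply; rewrite ler_nat.
have cv : (\int[nut]_(p in jump_ray (n%:R : R)) (1 - expR (- (lambda * p.2)))%:E)%E @[n --> \oo] -->
   (\int[nut]_(p in \bigcup_n jump_ray (n%:R : R)) (1 - expR (- (lambda * p.2)))%:E)%E.
  apply: ge0_nondecreasing_set_cvg_integral => //.
  - by move=> n; exact/measurable_EFinP.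
  - by move=> n p [_ pv]; apply: f0; split.
apply: (@le_lt_trans _ _ (- ln c)%:E); last by rewrite ltry.
rewrite -(cvg_lim _ cv)//; apply: lime_le; first by apply/cvg_ex; eexists; exact: cv.
exact: nearW.
Unshelve. all: by end_near. Qed.

Let path_fin w : (stieltjes (l ^~ w) setT < +oo)%E.
Proof.
by apply: le_lt_trans (stieltjes_setT_le (l_cum w) (l_Ny w) (fun t => lC t w)) _; rewrite ltry.
Qed.

Lemma path_integrable w (f : R -> R) (M : R) : measurable_fun setT f ->
  (forall x, `|f x| <= M) -> (stieltjes (l ^~ w)).-integrable setT (EFin \o f).
Proof.
move=> mf fM.
apply: (integrable_le (mu := stieltjes (l ^~ w)) (g := cst `|M|)) => //.
  by move=> x _; rewrite (le_trans (fM x))// ler_norm.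
apply/integrableP; split; first exact/measurable_EFinP.
rewrite (eq_integral (cst `|M|%:E)); last by move=> x _; rewrite /= normr_id.
rewrite integral_cst//; apply: lte_mul_pinfty; rewrite ?lee_fin//; exact: path_fin.
Qed.

Definition path_integral (rho : R -> R) (w : T) : R := \int[stieltjes (l ^~ w)]_x rho x.

Let LF (rho : R -> R) := measurable_fun setT (path_integral rho) /\
  \int[P]_w expR (- path_integral rho w) =
  expR (- \int[nut]_(p in @jumps R) (1 - expR (- (p.2 * rho p.1)))).

Lemma path_integral_ge0 rho w : (forall x, 0 <= rho x) -> 0 <= path_integral rho w.
Proof. by move=> r0; apply: Rintegral_ge0. Qed.

Let measurable_jump_exp (rho : R -> R) (D : set (R * R)) : measurable_fun setT rho ->
  measurable_fun D (fun p : R * R => 1 - expR (- (p.2 * rho p.1))).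
Proof.
move=> mr; apply: measurable_funTS; apply: measurable_funB => //; apply: measurable_fun_exp.
apply: measurable_fun_opp; apply: measurable_funM => //.
exact: (measurableT_comp mr).
Qed.

Let LF_limit (rho_ : nat -> R -> R) (rho : R -> R) (M : R) :
  (forall n, measurable_fun setT (rho_ n)) -> (forall n x, 0 <= rho_ n x <= M) ->
  (forall x, rho_ n x @[n --> \oo] --> rho x) -> (forall n, LF (rho_ n)) -> LF rho.
Proof.
move=> mr rM rr Hr.
have M0 : 0 <= M by have /andP[] := rM 0%N 0; exact: le_trans.
have cI w : path_integral (rho_ n) w @[n --> \oo] --> path_integral rho w.
  apply: (dominated_cvgR (mu := stieltjes (l ^~ w)) (f_ := rho_) (g := cst M)) => //.
  - by move=> n x _; have /andP[r0 rM'] := rM n x; rewrite ger0_norm.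
  - by apply: (@path_integrable w (cst M) `|M|) => // x; rewrite ler_norm.
have mI : measurable_fun setT (path_integral rho).
  apply: (measurable_fun_cvg (h := fun n => path_integral (rho_ n))).
    by move=> n; case: (Hr n).
  by move=> w _; exact: cI.
split => //.
have c1 : \int[P]_w expR (- path_integral (rho_ n) w) @[n --> \oo] -->
    \int[P]_w expR (- path_integral rho w).
  apply: (dominated_cvgR (mu := P) (f_ := fun n w => expR (- path_integral (rho_ n) w))
     (g := cst 1)) => //.
  - by move=> n; have [mIn _] := Hr n; measurability.
  - by move=> w _; apply: continuous_cvg; [exact: continuous_expR|exact: cvgN].
  - move=> n w _; rewrite ger0_norm ?expR_ge0// expRN_le1// path_integral_ge0// => x.
    by case/andP: (rM n x).
  - exact: finite_measure_integrable_cst.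
have c2 : \int[nut]_(p in @jumps R) (1 - expR (- (p.2 * rho_ n p.1))) @[n --> \oo] -->
    \int[nut]_(p in @jumps R) (1 - expR (- (p.2 * rho p.1))).
  apply: (dominated_cvgR (mu := nut) (f_ := fun n p => 1 - expR (- (p.2 * rho_ n p.1)))
    (g := fun p => 1 - expR (- (M * p.2)))).
  - exact: measurable_jumps.
  - by move=> n; exact: measurable_jump_exp.
  - move=> p _; apply: cvgB; first exact: cvg_cst.
    by apply: continuous_cvg; [exact: continuous_expR|apply: cvgN; exact: cvgMr].
  - move=> n p [_ /=]; rewrite in_itv/= andbT => p0.
    have /andP[r0 rM'] := rM n p.1.
    rewrite ger0_norm ?subr_ge0 ?expRN_le1 ?mulr_ge0 ?(ltW p0)//.
    by rewrite lerB// ler_expR lerN2 mulrC ler_wpM2r// ltW.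
  - exact: integrable_jumps.
apply: (cvg_unique (@Rhausdorff R) c1).
rewrite (_ : (fun n => \int[P]_w expR (- path_integral (rho_ n) w)) =
  (fun n => expR (- \int[nut]_(p in @jumps R) (1 - expR (- (p.2 * rho_ n p.1)))))).
  by apply: continuous_cvg; [exact: continuous_expR|exact: cvgN].
by apply/funext => n; case: (Hr n).
Qed.

Let Rintegral_sum_ord d' (T' : measurableType d') (m : {measure set T' -> \bar R})
  (D : set T') (N : nat) (f : nat -> T' -> R) : measurable D ->
  (forall i, m.-integrable D (EFin \o f i)) ->
  \int[m]_(x in D) (\sum_(i < N) f i x) = \sum_(i < N) \int[m]_(x in D) f i x.
Proof.
move=> mD If; have IS k : m.-integrable D (EFin \o (fun x => \sum_(i < k) f i x)).
  elim: k => [|k IH].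
    rewrite (_ : EFin \o _ = cst 0%E); first exact: integrable0.
    by apply/funext => x; rewrite /= big_ord0.
  rewrite (_ : (fun x => _) = (fun x => \sum_(i < k) f i x + f k x)); last first.
    by apply/funext => x; rewrite big_ord_recr.
  exact: integrable_addr.
elim: N => [|N IH].
  rewrite big_ord0; under eq_Rintegral do rewrite big_ord0.
  by rewrite Rintegral_cst// mul0r.
under eq_Rintegral do rewrite big_ord_recr/=.
rewrite RintegralD//; last exact: IS.
by rewrite IH big_ord_recr.
Qed.

Let step_jump n (v : R -> R) (p : R * R) : 1 - expR (- (p.2 * step_approx n v p.1)) =
  step_approx n (fun t => 1 - expR (- (v t * p.2))) p.1.
Proof.
have [h|h] := boolP (- n%:R < p.1 <= n%:R); last first.
  by rewrite !step_approx_out// mulr0 oppr0 expR0 subrr.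
have [i iN pi] := mem_grid_cell h.
by rewrite !(step_approx_in _ iN pi) mulrC.
Qed.

Let measurable_step n (v : R -> R) : measurable_fun setT (step_approx n v).
Proof.
rewrite /step_approx; elim: (grid_size n) => [|N IH].
  by under eq_fun do rewrite big_ord0; exact: measurable_cst.
under eq_fun do rewrite big_ord_recr/=.
apply: measurable_funD => //; apply: measurable_funM => //.
by apply: measurable_indic; exact: measurable_itv.
Qed.

Let path_integral_step n v w : path_integral (step_approx n v) w =
  \sum_(i < grid_size n) v (grid n i.+1) * (l (grid n i.+1) w - l (grid n i) w).
Proof.
have II i : (stieltjes (l ^~ w)).-integrable setT (EFin \o (\1_(grid_cell n i : set R) : R -> R)).
  apply: (@path_integrable w _ 1); first by apply: measurable_indic; exact: measurable_itv.
  by move=> x; rewrite indicE; case: (_ \in _); rewrite ?normr1 ?normr0.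
rewrite /path_integral /step_approx.
etransitivity.
  apply: (Rintegral_sum_ord (m := stieltjes (l ^~ w)) _ (f := fun i x => v (grid n i.+1) * \1_(grid_cell n i : set R) x)) => //.
  by move=> i; apply: integrable_mulrl.
apply: eq_bigr => i _; rewrite RintegralZl//; congr (_ * _).
have E : stieltjes (l ^~ w) (grid_cell n i) = (l (grid n i.+1) w - l (grid n i) w)%:E.
  by apply: stieltjes_itv => //; exact: le_grid.
rewrite /Rintegral integral_indic//; last exact: measurable_itv.
rewrite setIT; exact: (congr1 fine E).
Qed.

(** For a step function the integral is a linear combination of increments over grid
    cells, which are independent. *)
Let LF_step n (v : R -> R) (M : R) : (forall x, 0 <= v x <= M) -> LF (step_approx n v).
Proof.
move=> vM.
have ml' : measurable_fun setT (path_integral (step_approx n v)).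
  rewrite (funext (path_integral_step n v)); elim: (grid_size n) => [|N IH].
    by under eq_fun do rewrite big_ord0; exact: measurable_cst.
  under eq_fun do rewrite big_ord_recr/=.
  by apply: measurable_funD => //; apply: measurable_funM => //; exact: measurable_funB.
split => //.
pose Delta (i : 'I_(grid_size n)) w := l (grid n i.+1) w - l (grid n i) w.
(* The truncation at [0] does not change [phi] at the increments, and makes it
   bounded on the whole line. *)
pose phi (i : 'I_(grid_size n)) (x : R) := expR (- (v (grid n i.+1) * Num.max 0 x)).
have v0 x : 0 <= v x by case/andP: (vM x).
have Delta0 i w : 0 <= Delta i w by rewrite subr_ge0 (l_cum w).1// le_grid.
have phiE i w : phi i (Delta i w) = expR (- (v (grid n i.+1) * Delta i w)).
  by rewrite /phi max_r.
have := @independent_expectation_prod _ _ _ P (grid_size n) Delta phi (l_incr (@le_grid R n)).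
have -> : \int[P]_w (\prod_i phi i (Delta i w)) = \int[P]_w expR (- path_integral (step_approx n v) w).
  apply: eq_Rintegral => w _; rewrite path_integral_step -sumrN expR_sum.
  by apply: eq_bigr => i _; rewrite phiE.
move=> -> //; last 3 first.
- by move=> i; exact: measurable_funB.
- move=> i; apply: measurable_fun_exp; apply: measurable_fun_opp; apply: measurable_funM => //.
  exact: measurable_maxr.
- move=> i x; rewrite ger0_norm ?expR_ge0// expRN_le1// mulr_ge0// le_max lexx//.
have -> : \int[nut]_(p in @jumps R) (1 - expR (- (p.2 * step_approx n v p.1))) =
    \sum_(i < grid_size n) \int[nut]_(p in jump_cell (grid n i) (grid n i.+1))
      (1 - expR (- (v (grid n i.+1) * p.2))).
  under eq_Rintegral do rewrite step_jump.
  have patchE i p : (1 - expR (- (v (grid n i.+1) * p.2))) * \1_(grid_cell n i : set R) p.1 =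
      ((fun p : R * R => 1 - expR (- (v (grid n i.+1) * p.2))) \_ (grid_cell n i `*` setT)) p.
    rewrite patchE indicE; have [pc|pc] := pselect (grid_cell n i p.1).
      by rewrite !mem_set ?mulr1.
    by rewrite !memNset ?mulr0// => -[].
  have cellE i : @jumps R `&` (grid_cell n i `*` setT) = jump_cell (grid n i) (grid n i.+1).
    apply/seteqP; split => -[x y]; first by move=> [[_ ?] [? _]].
    by move=> [? ?]; do 2 split.
  etransitivity.
    apply: (Rintegral_sum_ord (m := nut) _ (f := fun i p =>
      (1 - expR (- (v (grid n i.+1) * p.2))) * \1_(grid_cell n i : set R) p.1)).
      exact: measurable_jumps.
    move=> i; apply: (integrable_le (mu := nut)
        (g := fun p => 1 - expR (- (v (grid n i.+1) * p.2)))).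
      + exact: measurable_jumps.
      + apply: measurable_funM => //; apply: measurable_funTS.
      have mi : measurable_fun setT (\1_(grid_cell n i : set R) : R -> R) by apply: measurable_indic; exact: measurable_itv.
      exact: (measurableT_comp mi measurable_fst).
      + move=> p [_ /=]; rewrite in_itv/= andbT => p0; rewrite normrM.
        rewrite [X in X * _]ger0_norm; last first.
          by rewrite subr_ge0 expRN_le1// mulr_ge0// ltW.
        rewrite ler_piMr//; first by rewrite subr_ge0 expRN_le1// mulr_ge0// ltW.
        by rewrite indicE; case: (_ \in _); rewrite ?normr1 ?normr0.
      + exact: integrable_jumps.
  apply: eq_bigr => i _; rewrite -cellE [RHS]Rintegral_mkcondr.
  by apply: eq_Rintegral => p _; rewrite patchE.
rewrite -sumrN expR_sum; apply: eq_bigr => i _.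
under eq_Rintegral do rewrite phiE.
by rewrite increment_laplace// le_grid.
Qed.

(** [LF] passes to bounded limits, so [bounded_measurable_class] reduces it to
    continuous functions, which are limits of step functions.  Composing with
    [Num.max 0] turns the class of nonnegative functions into a class that is
    defined for all functions. *)
Theorem laplace_functional_bounded (rho : R -> R) (M : R) : measurable_fun setT rho ->
  (forall x, 0 <= rho x <= M) ->
  measurable_fun setT (path_integral rho) /\
  \int[P]_w expR (- path_integral rho w) =
  expR (- \int[nut]_(p in @jumps R) (1 - expR (- (p.2 * rho p.1)))).
Proof.
move=> mr rM.
pose Cl (f : R -> R) := measurable_fun setT f /\ LF (fun x => Num.max 0 (f x)).
have posE (f : R -> R) (K : R) x : `|f x| <= K -> 0 <= Num.max 0 (f x) <= K.
  move=> fK; rewrite le_max lexx/= ge_max (le_trans _ fK)//=.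
  exact: le_trans (ler_norm _) fK.
have max_cvg (u : nat -> R) (a : R) : u n @[n --> \oo] --> a ->
    Num.max 0 (u n) @[n --> \oo] --> Num.max 0 a.
  move=> ua; have c : {for a, continuous (fun x : R => Num.max 0 x)}.
    by apply: (@continuous_max R R (cst 0) idfun); [exact: cvg_cst|exact: cvg_id].
  exact: (continuous_cvg _ c ua).
have : Cl rho.
  apply: (@bounded_measurable_class R Cl _ _ rho M mr) => //.
  - move=> f_ f K Hf fK ff; split.
      by apply: (measurable_fun_cvg (h := f_)) => // n; case: (Hf n).
    apply: (@LF_limit (fun n x => Num.max 0 (f_ n x)) _ K) => //.
    + by move=> n; apply: measurable_maxr => //; case: (Hf n).
    + by move=> n x; exact: posE.
    + by move=> x; exact: max_cvg.
    + by move=> n; case: (Hf n).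
  - move=> v cv [K vK]; split; first exact: continuous_measurable_fun.
    apply: (@LF_limit (fun n => step_approx n (fun x => Num.max 0 (v x))) _ K) => //.
    + move=> n x; have [[i iN xi]|->] := step_approx_cases n (fun x => Num.max 0 (v x)) x.
        by rewrite (step_approx_in _ iN xi) posE.
      by rewrite lexx (le_trans _ (vK 0)).
    + move=> x; apply: step_approx_cvg.
      by apply: (@continuous_max R R (cst 0) v); [exact: cvg_cst|exact: cv].
    + by move=> n; apply: (@LF_step n _ K) => x; exact: posE.
  - by move=> x; have /andP[r0 rM'] := rM x; rewrite ger0_norm.
move=> [_]; rewrite (_ : (fun x => Num.max 0 (rho x)) = rho)//.
by apply/funext => x; rewrite max_r//; case/andP: (rM x).
Qed.

End LaplaceFunctional.

(** * Unbounded integrands *)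

Lemma expRN_natl_cvg {R : realType} (a : R) : 0 < a ->
  expR (- (n.+1%:R * a)) @[n --> \oo] --> (0 : R).
Proof.
move=> a0; rewrite (_ : (fun n : nat => _) = (fun n : nat => (expR (- a)) ^+ n.+1)).
  rewrite (cvg_shiftS (fun n => (expR (- a)) ^+ n)).
  by apply: cvg_expr; rewrite ger0_norm ?expR_ge0// -expR0 ltr_expR oppr_lt0.
by apply/funext => n; rewrite -expRM_natl mulrN.
Qed.

Section UnboundedIntegrand.
Context {R : realType} {d : measure_display} {T : measurableType d}.
Variable P : probability T R.
Variables (l : R -> T -> R) (C : T -> R) (nut : {measure set (R * R) -> \bar R}).
Hypothesis hl : driving_paths P l C nut.
Variable rho : R -> R.
Hypotheses (mrho : measurable_fun setT rho) (rho_ge0 : forall x, 0 <= rho x)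
  (rho_fin : forall lambda : R, 0 < lambda ->
    (\int[nut]_(p in @jumps R) (1 - expR (- (lambda * p.2 * rho p.1)))%:E < +oo)%E).

Let phi (lambda : R) (p : R * R) : R := 1 - expR (- (lambda * p.2 * rho p.1)).

Let phi_ge0 lambda p : 0 <= lambda -> @jumps R p -> 0 <= phi lambda p.
Proof.
move=> l0 [_ /=]; rewrite in_itv/= andbT => p0.
by rewrite subr_ge0 expRN_le1// !mulr_ge0// ltW.
Qed.

Let measurable_phi lambda (r : R -> R) (D : set (R * R)) : measurable_fun setT r ->
  measurable_fun D (fun p : R * R => 1 - expR (- (lambda * p.2 * r p.1))).
Proof.
move=> mr; apply: measurable_funTS; apply: measurable_funB => //; apply: measurable_fun_exp.
apply: measurable_fun_opp; apply: measurable_funM; first exact: measurable_funM.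
exact: (measurableT_comp mr).
Qed.

Let phi_int lambda : 0 < lambda -> nut.-integrable (@jumps R) (EFin \o phi lambda).
Proof.
move=> l0; apply/integrableP; split.
  by apply/measurable_EFinP; exact: measurable_phi.
rewrite (eq_integral (EFin \o phi lambda)); first exact: rho_fin.
by move=> p; rewrite inE => pj; rewrite /= ger0_norm// phi_ge0// ltW.
Qed.

Let trunc (n : nat) (x : R) : R := Num.min (rho x) n%:R.

Let trunc_bound n x : 0 <= trunc n x <= n%:R.
Proof. by rewrite le_min rho_ge0 ler0n/= ge_min lexx orbT. Qed.

Let measurable_trunc n : measurable_fun setT (trunc n).
Proof. exact: measurable_minr. Qed.

Let trunc_near x : \forall n \near \oo, trunc n x = rho x.
Proof.
near=> n; rewrite /trunc min_l//; near: n; exact: nbhs_infty_ger.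
Unshelve. all: by end_near. Qed.

Let I (n : nat) (w : T) : R := path_integral l (trunc n) w.
Let E (w : T) : \bar R := (\int[stieltjes (l ^~ w)]_x (rho x)%:E)%E.

Let trunc_norm n x : `|trunc n x| <= n%:R.
Proof. by have /andP[t0 tn] := trunc_bound n x; rewrite ger0_norm. Qed.

Let I_ge0 n w : 0 <= I n w.
Proof. by apply: path_integral_ge0 => x; case/andP: (trunc_bound n x). Qed.

Let E_ge0 w : (0 <= E w)%E.
Proof. by apply: integral_ge0 => x _; rewrite lee_fin. Qed.

Let I_cvg w : (I n w)%:E @[n --> \oo] --> E w.
Proof.
have -> : (fun n => (I n w)%:E) =
    (fun n => (\int[stieltjes (l ^~ w)]_x (trunc n x)%:E)%E).
  apply/funext => n; rewrite /I /path_integral fineK//; apply: integrable_fin_num => //.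
  exact: (path_integrable hl w (measurable_trunc n) (trunc_norm n)).
have -> : E w = (\int[stieltjes (l ^~ w)]_x limn (fun n => (trunc n x)%:E))%E.
  apply: eq_integral => x _; apply/esym/cvg_lim => //.
  by apply: cvg_near_cst; near=> n; congr EFin; near: n; exact: trunc_near.
apply: cvg_monotone_convergence => //.
- by move=> n; apply/measurable_EFinP; exact: measurable_trunc.
- by move=> n x _; rewrite lee_fin; case/andP: (trunc_bound n x).
- move=> x _ m n mn; rewrite lee_fin /trunc le_min ge_min lexx/= ge_min.
  by rewrite (ler_nat R) mn orbT.
Unshelve. all: by end_near. Qed.

Let measurable_I n : measurable_fun setT (I n).
Proof. by case: (laplace_functional_bounded hl (measurable_trunc n) (trunc_bound n)). Qed.

Lemma measurable_path_eintegral :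
  measurable_fun setT (fun w => \int[stieltjes (l ^~ w)]_x (rho x)%:E)%E.
Proof.
apply: (emeasurable_fun_cvg (fun n w => (I n w)%:E)).
  by move=> n; apply/measurable_EFinP; exact: measurable_I.
by move=> w _; exact: I_cvg.
Qed.

Lemma measurable_path_integral : measurable_fun setT (path_integral l rho).
Proof. exact: (measurableT_comp (fine_measurable measurableT) measurable_path_eintegral). Qed.

Let I_laplace n lambda : 0 <= lambda -> \int[P]_w expR (- (lambda * I n w)) =
  expR (- \int[nut]_(p in @jumps R) (1 - expR (- (lambda * p.2 * trunc n p.1)))).
Proof.
move=> l0.
have ml : measurable_fun setT (fun x => lambda * trunc n x).
  exact: measurable_funM.
have bl x : 0 <= lambda * trunc n x <= lambda * n%:R.
  by have /andP[t0 tn] := trunc_bound n x; rewrite mulr_ge0//= ler_wpM2l.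
have [_] := laplace_functional_bounded hl ml bl.
have -> : \int[P]_w expR (- path_integral l (fun x => lambda * trunc n x) w) =
    \int[P]_w expR (- (lambda * I n w)).
  apply: eq_Rintegral => w _; congr (expR (- _)); rewrite /path_integral RintegralZl//.
  exact: (path_integrable hl w (measurable_trunc n) (trunc_norm n)).
move=> ->; under eq_Rintegral do rewrite mulrCA mulrA.
by [].
Qed.

(** [e^(- lambda E)] with [e^(- oo) = 0]: the limit of the Laplace variables of the
    truncated integrals. *)
Let expE (lambda : R) (w : T) : R :=
  if (E w < +oo)%E then expR (- (lambda * fine (E w))) else 0.

Let expE_fin w : (E w < +oo)%E -> forall lambda, expE lambda w = expR (- (lambda * fine (E w))).
Proof. by move=> Ew lambda; rewrite /expE Ew. Qed.

Let expE_oo w : ~ (E w < +oo)%E -> forall lambda, expE lambda w = 0.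
Proof. by move=> Ew lambda; rewrite /expE ifF//; apply/negP. Qed.

Let expE_fin_cvg (u : nat -> R) (c : R) w : (E w < +oo)%E ->
  expR (- (u n * fine (E w))) @[n --> \oo] --> c -> expE (u n) w @[n --> \oo] --> c.
Proof. by move=> Ew; rewrite (funext (fun n => expE_fin Ew (u n))). Qed.

Let expE_oo_cvg (u : nat -> R) w : ~ (E w < +oo)%E -> expE (u n) w @[n --> \oo] --> (0:R).
Proof. by move=> Ew; rewrite (funext (fun n => expE_oo Ew (u n))); exact: cvg_cst. Qed.

Let expE_bound lambda w : 0 <= lambda -> 0 <= expE lambda w <= 1.
Proof.
move=> l0; rewrite /expE; case: ifP => _; last by rewrite lexx ler01.
by rewrite expR_ge0 expRN_le1// mulr_ge0// fine_ge0.
Qed.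

Let exp_I_cvg lambda w : 0 < lambda ->
  expR (- (lambda * I n w)) @[n --> \oo] --> expE lambda w.
Proof.
move=> l0; have Ic := @I_cvg w; rewrite /expE; case: ifPn => Efin.
  have Ef : E w \is a fin_num by rewrite ge0_fin_numE.
  have {}Ic : I n w @[n --> \oo] --> fine (E w).
    by move: Ic; rewrite -{1}(fineK Ef) => /fine_cvgP[].
  apply: continuous_cvg; first exact: continuous_expR.
  by apply: cvgN; exact: cvgMr.
have Eoo : E w = +oo%E by apply/eqP; move: Efin; rewrite ltNge leye_eq negbK.
rewrite Eoo in Ic.
apply/cvgrPdist_le => e e0; have /cvgeyPge/(_ (- ln e / lambda)) H := Ic.
near=> n; rewrite sub0r normrN ger0_norm ?expR_ge0//.
rewrite -[leRHS](@lnK R) ?posrE// ler_expR lerNl.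
by rewrite mulrC -ler_pdivrMr// -lee_fin; near: n; exact: H.
Unshelve. all: by end_near. Qed.

Let measurable_expE lambda : 0 < lambda -> measurable_fun setT (expE lambda).
Proof.
move=> l0; apply: (measurable_fun_cvg (h := fun n w => expR (- (lambda * I n w)))).
  by move=> n; have := measurable_I n; measurability.
by move=> w _; exact: exp_I_cvg.
Qed.

Let expE_laplace lambda : 0 < lambda ->
  \int[P]_w expE lambda w = expR (- \int[nut]_(p in @jumps R) phi lambda p).
Proof.
move=> l0.
have c1 : \int[P]_w expR (- (lambda * I n w)) @[n --> \oo] --> \int[P]_w expE lambda w.
  apply: (dominated_cvgR (mu := P) (f_ := fun n w => expR (- (lambda * I n w)))
     (g := cst 1)) => //.
  - by move=> n; have := measurable_I n; measurability.
  - by move=> w _; exact: exp_I_cvg.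
  - move=> n w _; rewrite ger0_norm ?expR_ge0// expRN_le1// mulr_ge0//.
    exact: ltW.
  - exact: finite_measure_integrable_cst.
have c2 : \int[nut]_(p in @jumps R) (1 - expR (- (lambda * p.2 * trunc n p.1)))
     @[n --> \oo] --> \int[nut]_(p in @jumps R) phi lambda p.
  apply: (dominated_cvgR (mu := nut)
    (f_ := fun n p => 1 - expR (- (lambda * p.2 * trunc n p.1))) (g := phi lambda)).
  - exact: measurable_jumps.
  - by move=> n; exact: measurable_phi.
  - move=> p _; apply: cvg_near_cst; near=> n; rewrite /phi; congr (1 - expR (- (_ * _))).
    by near: n; exact: trunc_near.
  - move=> n p [_ /=]; rewrite in_itv/= andbT => p0.
    have /andP[t0 tn] := trunc_bound n p.1.
    have lp : 0 <= lambda * p.2 by rewrite mulr_ge0// ltW.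
    rewrite ger0_norm; last by rewrite subr_ge0 expRN_le1// mulr_ge0.
    by rewrite lerB// ler_expR lerN2 ler_wpM2l// ge_min lexx.
  - exact: phi_int.
apply: (cvg_unique (@Rhausdorff R) c1).
rewrite (_ : (fun n => \int[P]_w expR (- (lambda * I n w))) =
  (fun n => expR (- \int[nut]_(p in @jumps R) (1 - expR (- (lambda * p.2 * trunc n p.1)))))).
  by apply: continuous_cvg; [exact: continuous_expR|exact: cvgN].
by apply/funext => n; rewrite I_laplace// ltW.
Unshelve. all: by end_near. Qed.

Let measurable_finite : measurable [set w | (E w < +oo)%E].
Proof.
by rewrite -[X in measurable X]setTI;
  exact: (emeasurable_fun_infty_o measurableT measurable_path_eintegral).
Qed.

Let indic_integral (A : set T) : measurable A -> \int[P]_w (\1_A w : R) = fine (P A).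
Proof. by move=> mA; rewrite /Rintegral integral_indic// setIT. Qed.

Let probability_one (A : set T) : measurable A -> fine (P A) = 1 -> {ae P, forall w, A w}.
Proof.
move=> mA PA; exists (~` A); split => //; first exact: measurableC.
rewrite probability_setC// -[X in (_ - X)%E]fineK ?fin_num_measure//.
by rewrite PA subee.
Qed.

(** As [lambda -> 0], [expE lambda] tends to the indicator of finiteness and the
    exponent tends to [0]. *)
Theorem path_eintegral_fin :
  {ae P, forall w, (\int[stieltjes (l ^~ w)]_x (rho x)%:E < +oo)%E}.
Proof.
apply: (@probability_one [set w | (E w < +oo)%E]); first exact: measurable_finite.
rewrite -indic_integral//.
have c1 : \int[P]_w expE (n.+1%:R^-1) w @[n --> \oo] -->
    \int[P]_w (\1_[set w | (E w < +oo)%E] w : R).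
  apply: (dominated_cvgR (mu := P) (f_ := fun n => expE n.+1%:R^-1) (g := cst 1)) => //.
  - by move=> n; apply: measurable_expE; rewrite invr_gt0.
  - move=> w _; rewrite indicE.
    have [Ew|Ew] := pselect (E w < +oo)%E; last first.
      by rewrite memNset//; exact: expE_oo_cvg.
    rewrite mem_set//; apply: expE_fin_cvg => //; rewrite -[X in _ --> X]expR0.
    apply: continuous_cvg; first exact: continuous_expR.
    rewrite -oppr0 -[X in - X](mul0r (fine (E w))); apply: cvgN; apply: cvgMl.
    exact: cvg_harmonic.
  - move=> n w _; have /andP[e0 e1] := @expE_bound n.+1%:R^-1 w (ltac:(by rewrite invr_ge0)).
    by rewrite ger0_norm.
  - exact: finite_measure_integrable_cst.
have c2 : \int[nut]_(p in @jumps R) phi n.+1%:R^-1 p @[n --> \oo] -->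
    \int[nut]_(p in @jumps R) (0:R).
  apply: (dominated_cvgR (mu := nut) (f_ := fun n => phi n.+1%:R^-1) (g := phi 1)).
  - exact: measurable_jumps.
  - by move=> n; exact: measurable_phi.
  - move=> p _; rewrite -(subrr (1:R)); apply: cvgB; first exact: cvg_cst.
    rewrite -[X in _ --> X]expR0; apply: continuous_cvg; first exact: continuous_expR.
    rewrite -oppr0; apply: cvgN; rewrite -[X in _ --> X](mul0r (rho p.1)); apply: cvgMl.
    rewrite -[X in _ --> X](mul0r p.2); apply: cvgMl; exact: cvg_harmonic.
  - move=> n p pj; have : @jumps R p by [].
    move=> [_ /=]; rewrite in_itv/= andbT => p0.
    rewrite ger0_norm ?phi_ge0 ?invr_ge0// lerB// ler_expR lerN2 ler_wpM2r//.
    by apply: ler_wpM2r; [exact: ltW|rewrite invf_le1// ler1n].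
  - exact: phi_int.
apply/esym; have <- : expR (- \int[nut]_(p in @jumps R) (0:R)) = 1.
  by rewrite Rintegral_cst ?mul0r ?oppr0 ?expR0//; exact: measurable_jumps.
apply: (cvg_unique (@Rhausdorff R) _ c1).
rewrite (_ : (fun n => _) = (fun n => expR (- \int[nut]_(p in @jumps R) phi n.+1%:R^-1 p))).
  by apply: continuous_cvg; [exact: continuous_expR|exact: cvgN].
by apply/funext => n; rewrite expE_laplace// invr_gt0.
Qed.

Theorem laplace_functional : \int[P]_w expR (- path_integral l rho w) =
  expR (- \int[nut]_(p in @jumps R) (1 - expR (- (p.2 * rho p.1)))).
Proof.
have := @expE_laplace 1 ltr01; rewrite /phi.
under [X in _ = expR (- X)]eq_Rintegral do rewrite mul1r.
move=> <-; rewrite /Rintegral; congr fine; apply: ae_eq_integral => //.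
- apply/measurable_EFinP; have := measurable_path_integral; measurability.
- by apply/measurable_EFinP; exact: measurable_expE.
- apply: filterS path_eintegral_fin => w Ew _; rewrite /expE Ew mul1r//.
Qed.

(** As [lambda -> oo], [expE lambda] tends to the indicator of [E = 0], while the
    exponent increases to the infinite mass of the intensity. *)
Theorem path_eintegral_gt0 : (forall x, 0 < rho x) -> nut (@jumps R) = +oo%E ->
  {ae P, forall w, (0 < \int[stieltjes (l ^~ w)]_x (rho x)%:E)%E}.
Proof.
move=> rho_gt0 nutoo.
pose A := [set w | (0 < E w)%E].
have mA : measurable A.
  by rewrite -[X in measurable X]setTI;
    exact: (emeasurable_fun_o_infty measurableT measurable_path_eintegral).
apply: (@probability_one A) => //.
have c1 : \int[P]_w expE (n.+1%:R) w @[n --> \oo] --> \int[P]_w (\1_(~` A) w : R).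
  apply: (dominated_cvgR (mu := P) (f_ := fun n => expE n.+1%:R) (g := cst 1)) => //.
  - by move=> n; exact: measurable_expE.
  - move=> w _; rewrite indicE.
    have [Aw|nAw] := pselect (A w).
      rewrite memNset; last by move=> /(_ Aw).
      have [Ew|Ew] := pselect (E w < +oo)%E; last exact: expE_oo_cvg.
      apply: expE_fin_cvg => //.
      have Ew0 : 0 < fine (E w) by apply: fine_gt0; rewrite Ew andbT.
      exact: expRN_natl_cvg.
    have Ew : E w = 0%E by apply/eqP; rewrite eq_le E_ge0 andbT leNgt; exact/negP.
    have Ew' : (E w < +oo)%E by rewrite Ew ltry.
    rewrite mem_set//; apply: expE_fin_cvg => //; rewrite Ew.
    apply: cvg_near_cst; apply: nearW => n.
    by rewrite mulr0 oppr0 expR0.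
  - move=> n w _; have /andP[e0 e1] := @expE_bound n.+1%:R w (ler0n _ _).
    by rewrite ger0_norm.
  - exact: finite_measure_integrable_cst.
have c2 : (\int[nut]_(p in @jumps R) (phi n.+1%:R p)%:E)%E @[n --> \oo] --> +oo%E.
  rewrite -[X in _ --> X]nutoo -[X in _ --> X]mul1e -integral_cst; last exact: measurable_jumps.
  rewrite [X in _ --> X](_ : _ = (\int[nut]_(p in @jumps R) limn (fun n => (phi n.+1%:R p)%:E))%E).
    apply: cvg_monotone_convergence => //.
    + exact: measurable_jumps.
    + by move=> n; apply/measurable_EFinP; exact: measurable_phi.
    + by move=> n p pj; rewrite lee_fin phi_ge0.
    + move=> p [_ /=]; rewrite in_itv/= andbT => p0 m n mn.
      rewrite lee_fin lerB// ler_expR lerN2 ler_wpM2r//.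
      by apply: ler_wpM2r; [exact: ltW|rewrite ler_nat].
  apply: eq_integral => p; rewrite inE => -[_ /=]; rewrite in_itv/= andbT => p0.
  apply/esym/cvg_lim => //; apply: cvg_EFin; first exact: nearW.
  rewrite /= -[X in _ --> X]subr0; apply: cvgB; first exact: cvg_cst.
  rewrite (_ : (fun n : nat => _) = (fun n : nat => expR (- (n.+1%:R * (p.2 * rho p.1))))).
    by apply: expRN_natl_cvg; rewrite mulr_gt0.
  by apply/funext => n; rewrite mulrA.
have c3 : \int[P]_w expE (n.+1%:R) w @[n --> \oo] --> (0:R).
  rewrite (_ : (fun n => _) = (fun n => expR (- \int[nut]_(p in @jumps R) phi n.+1%:R p))); last first.
    by apply/funext => n; rewrite expE_laplace.
  apply/cvgrPdist_le => e e0; have /cvgeyPge/(_ (- ln e)) H := c2.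
  near=> n.
  rewrite sub0r normrN ger0_norm ?expR_ge0//.
  rewrite -[leRHS](@lnK R) ?posrE// ler_expR lerNl -lee_fin.
  rewrite /Rintegral fineK; last first.
    by apply: integrable_fin_num; [exact: measurable_jumps|exact: phi_int].
  by near: n; exact: H.
have := cvg_unique (@Rhausdorff R) c1 c3.
rewrite indic_integral; last exact: measurableC.
rewrite probability_setC// -[X in (_ - X)%E]fineK ?fin_num_measure//=.
by move=> /(_ _)/eqP; rewrite subr_eq0 => /eqP.
Unshelve. all: by end_near. Qed.

End UnboundedIntegrand.

(** * The time change and the intensity measure *)

Section DistributionFunction.
Context {R : realType}.
Variables (alpha : {measure set R -> \bar R}) (a : R).
Hypothesis alphaT : alpha setT = a%:E.

Let ray_fin x : alpha `]-oo, x]%classic \is a fin_num.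
Proof.
rewrite ge0_fin_numE//; apply: le_lt_trans (ltry a); rewrite -alphaT.
by apply: le_measure; rewrite ?inE//; exact: measurable_itv.
Qed.

Lemma distribution_function_ge0 x : 0 <= distribution_function alpha x.
Proof. exact: fine_ge0. Qed.

Lemma distribution_function_le x : distribution_function alpha x <= a.
Proof.
rewrite -lee_fin fineK// -alphaT.
by apply: le_measure; rewrite ?inE//; exact: measurable_itv.
Qed.

Lemma distribution_function_nondecreasing :
  nondecreasing_fun (distribution_function alpha).
Proof.
move=> x y xy; rewrite -lee_fin !fineK//.
apply: le_measure; rewrite ?inE; [exact: measurable_itv|exact: measurable_itv|].
by move=> z /=; rewrite !in_itv/= => /le_trans; apply.
Qed.

Let cvg_decreasing (u : nat -> R) (S : set R) : measurable S -> {homo u : m n / (m <= n)%N >-> n <= m} ->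
  \bigcap_n `]-oo, u n]%classic = S ->
  distribution_function alpha (u n) @[n --> \oo] --> fine (alpha S).
Proof.
move=> mS ud uS; apply: fine_cvg; rewrite fineK; last first.
  rewrite ge0_fin_numE//; apply: le_lt_trans (ltry a); rewrite -alphaT.
  by apply: le_measure; rewrite ?inE.
rewrite -uS; apply: nonincreasing_cvg_mu => //.
- by rewrite -ge0_fin_numE.
- by rewrite uS.
- move=> m n mn; apply/subsetPset => x /=; rewrite !in_itv/= => /le_trans; apply.
  exact: ud.
Qed.

Lemma distribution_function_right_continuous :
  right_continuous (distribution_function alpha).
Proof.
move=> x; apply/cvgrPdist_le => e e0.
have : distribution_function alpha (x + n.+1%:R^-1) @[n --> \oo] -->
    distribution_function alpha x.
  apply: cvg_decreasing; first exact: measurable_itv.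
    by move=> m n mn; rewrite lerD2l lef_pV2 ?posrE// ler_nat.
  by rewrite -itvNycEbigcap.
move=> /cvgrPdist_le/(_ _ e0)[].
move=> N _ /(_ N (leqnn N)) /=; rewrite distrC ger0_norm; last first.
  by rewrite subr_ge0 distribution_function_nondecreasing// lerDl.
move=> HN; near=> y.
have xy : x <= y by apply: ltW; near: y; exact: nbhs_right_gt.
rewrite distrC ger0_norm ?subr_ge0 ?distribution_function_nondecreasing//.
apply: le_trans HN; rewrite lerB// distribution_function_nondecreasing//.
by apply: ltW; near: y; apply: nbhs_right_lt; rewrite ltrDl.
Unshelve. all: by end_near. Qed.

Lemma distribution_function_cvgNy : distribution_function alpha x @[x --> -oo] --> (0 : R).
Proof.
apply/cvgrPdist_le => e e0.
have : distribution_function alpha (- n%:R) @[n --> \oo] --> (0 : R).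
  rewrite -[X in _ --> X](_ : fine (alpha set0) = 0); last by rewrite measure0.
  apply: cvg_decreasing => //.
    by move=> m n mn; rewrite lerN2 ler_nat.
  rewrite -subset0 => t tn; have [n _ /(_ n (leqnn n)) /= nt] := nbhs_infty_gtr (- t).
  by have := tn n I; rewrite /= in_itv/= leNgt ltrNl nt.
move=> /cvgrPdist_le/(_ _ e0)[].
move=> N _ /(_ N (leqnn N)) /=.
rewrite !sub0r !normrN ger0_norm ?distribution_function_ge0// => HN; near=> y.
rewrite sub0r normrN ger0_norm ?distribution_function_ge0//.
apply: le_trans HN; apply: distribution_function_nondecreasing.
by near: y; apply: nbhs_ninfty_le; rewrite num_real.
Unshelve. all: by end_near. Qed.

End DistributionFunction.

Section AlmostSureTransfer.
Context {R : realType} {d : measure_display} {T : measurableType d}.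
Variable P : probability T R.

Lemma probability_ae_eq (A B : set T) : measurable A -> measurable B ->
  {ae P, forall w, A w <-> B w} -> P A = P B.
Proof.
move=> mA mB [N [mN PN sN]].
have good w : ~ N w -> (A w <-> B w).
  by move=> nN; apply: contrapT => bad; apply: nN; exact: sN.
have le (A' B' : set T) : measurable A' -> measurable B' ->
    (forall w, ~ N w -> A' w -> B' w) -> (P A' <= P B')%E.
  move=> mA' mB' AB; apply: (@le_trans _ _ (P (B' `|` N))).
    apply: le_measure; rewrite ?inE//; first exact: measurableU.
    by move=> w Aw; have [Nw|nNw] := pselect (N w); [right|left; exact: AB].
  apply: le_trans (measureU2 _ mB' mN) _.
  by rewrite -[leRHS]adde0; apply: leeD => //; rewrite -PN.
by apply/eqP; rewrite eq_le; apply/andP; split; apply: le => // w /good[].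
Qed.

Lemma mutually_independent_ae (n : nat) (X Y : 'I_n -> T -> R) :
  (forall i, measurable_fun setT (X i)) -> (forall i, measurable_fun setT (Y i)) ->
  {ae P, forall w, forall i, X i w = Y i w} ->
  mutually_independent P X -> mutually_independent P Y.
Proof.
move=> mX mY XY indX B mB.
have pre (Z : T -> R) C : measurable_fun setT Z -> measurable C -> measurable (Z @^-1` C).
  by move=> mZ mC; rewrite -[X in measurable X]setTI; exact: mZ.
transitivity (P (\bigcap_(i in [set: 'I_n]) (X i @^-1` B i))).
  apply: probability_ae_eq.
  - by apply: fin_bigcap_measurable => // i _; exact: pre.
  - by apply: fin_bigcap_measurable => // i _; exact: pre.
  - by apply: filterS XY => w XYw; split => H i iT; have := H i iT; rewrite /= XYw.
rewrite indX//; apply: eq_bigr => i _; apply: probability_ae_eq; [exact: pre|exact: pre|].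
by apply: filterS XY => w XYw; rewrite /= XYw.
Qed.

End AlmostSureTransfer.

Section PoissonIntensity.
Context {R : realType}.

Lemma measurable_jump_ray (x : R) : measurable (jump_ray x).
Proof. by apply: measurableX; exact: measurable_itv. Qed.

Variables (nu : R -> {measure set R -> \bar R}) (nut : {measure set (R * R) -> \bar R}).
Hypothesis hnut : poisson_intensity nu nut.

(** [nu x] is the image under the second projection of the intensity restricted to
    [jump_ray x]. *)
Lemma integral_jump_ray x (f : R -> R) : measurable_fun setT f ->
  (forall v, 0 < v -> 0 <= f v) ->
  (\int[nut]_(p in jump_ray x) (f p.2)%:E =
   \int[nu x]_(v in `]0%R, +oo[) (f v)%:E)%E.
Proof.
move=> mf f0.
pose m := mrestr nut (measurable_jump_ray x).
transitivity (\int[m]_(p in jump_ray x) (f p.2)%:E)%E.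
  apply: eq_measure_integral => A mA Ar; rewrite /m /mrestr.
  by congr (nut _); apply/esym/setIidPl.
transitivity (\int[m]_(p in snd @^-1` `]0%R, +oo[%classic) (f p.2)%:E)%E.
  have -> : jump_ray x = snd @^-1` `]0%R, +oo[%classic `\` (`]x, +oo[%classic `*` setT).
    apply/seteqP; split => -[y v]; rewrite /jump_ray/= !in_itv/= !andbT.
      by move=> [yx v0]; split => // -[xy _]; move: (le_lt_trans yx xy); rewrite ltxx.
    move=> [v0 H]; split => //; rewrite leNgt; apply/negP => xy; exact: H.
  apply/esym; apply: ge0_negligible_integral.
  - by apply: measurableX => //; exact: measurable_itv.
  - rewrite -[X in measurable X]setTI; apply: measurable_snd => //; exact: measurable_itv.
  - by apply: measurable_funTS; apply/measurable_EFinP; exact: measurableT_comp.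
  - by move=> [y v] /=; rewrite in_itv/= andbT lee_fin => v0; exact: f0.
  - transitivity (nut set0); last exact: measure0.
    congr (nut _); apply/seteqP; split => // -[y v].
    by rewrite /jump_ray/= !in_itv/= !andbT => -[[xy _] [yx _]]; move: (le_lt_trans yx xy); rewrite ltxx.
transitivity (\int[pushforward m (snd : R * R -> R)]_(v in `]0%R, +oo[) (f v)%:E)%E.
  rewrite ge0_integral_pushforward//.
  - by apply: measurable_funTS; apply/measurable_EFinP.
  - by move=> v; rewrite inE/= in_itv/= andbT => v0; rewrite lee_fin f0.
apply: eq_measure_integral => A mA A0; rewrite /pushforward /m /mrestr -hnut//.
congr (nut _); apply/seteqP; split => -[y v]; rewrite /jump_ray/=.
  by move=> [Av [yx _]].
by move=> [yx Av]; split => //; split => //; exact: A0.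
Qed.

End PoissonIntensity.

(** * A version of the driving process with regular paths *)

Section GoodPaths.
Context {R : realType} {d : measure_display} {T : measurableType d}.
Variables (P : probability T R) (a : R) (alpha : {measure set R -> \bar R}).
Hypothesis halpha : alpha setT = a%:E.
Variables (L : R -> {RV P >-> R}).
Hypothesis hL : increasing_additive_process L.
Variable LA : R -> T -> R.
Hypothesis hLA : forall x w, LA x w = L (distribution_function alpha x) w.
Variable nu : R -> {measure set R -> \bar R}.
Hypotheses (hnu : forall x, levy_measure (nu x)) (hlaplace : laplace_exponents P LA nu).
Variable nut : {measure set (R * R) -> \bar R}.
Hypothesis hnut : poisson_intensity nu nut.

Let A := distribution_function alpha.
Let A_ge0 := distribution_function_ge0 alpha.
Let A_nd := distribution_function_nondecreasing halpha.

Let levy_exp_integrable (x lambda : R) : 0 <= lambda ->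
  (nu x).-integrable `]0%R, +oo[%classic (EFin \o (fun v : R => 1 - expR (- (lambda * v)))).
Proof.
move=> l0.
have v0 (v : R) : `]0%R, +oo[%classic v -> 0 <= v by rewrite /= in_itv/= andbT; exact: ltW.
apply: (integrable_le (mu := nu x) (g := fun v : R => (1 + lambda) * Num.min 1 v)).
- exact: measurable_itv.
- apply: measurable_funTS; apply: measurable_funB => //; apply: measurable_fun_exp.
  by apply: measurable_fun_opp; exact: measurable_funM.
- by move=> v /v0 vp; exact: one_sub_exp_le_min1.
apply: integrable_mulrl; first exact: measurable_itv.
apply/integrableP; split.
  by apply: measurable_funTS; apply/measurable_EFinP; exact: measurable_minr.
rewrite (eq_integral (fun v : R => (Num.min 1 v)%:E)); first exact: hnu.
by move=> v; rewrite inE => /v0 vp; rewrite /= ger0_norm// le_min ler01.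
Qed.

Let jump_exp_integral (x lambda : R) : 0 <= lambda ->
  (\int[nut]_(p in jump_ray x) (1 - expR (- (lambda * p.2)))%:E =
   \int[nu x]_(v in `]0%R, +oo[) (1 - expR (- (lambda * v)))%:E)%E.
Proof.
move=> l0; apply: (integral_jump_ray hnut x (f := fun v : R => 1 - expR (- (lambda * v)))).
- apply: measurable_funB => //; apply: measurable_fun_exp.
  by apply: measurable_fun_opp; exact: measurable_funM.
- by move=> v v0; rewrite subr_ge0 expRN_le1// mulr_ge0// ltW.
Qed.

Let jump_exp_integrable (x lambda : R) : 0 <= lambda ->
  nut.-integrable (jump_ray x) (EFin \o (fun p : R * R => 1 - expR (- (lambda * p.2)))).
Proof.
move=> l0; apply/integrableP; split.
  apply: measurable_funTS; apply/measurable_EFinP; apply: measurable_funB => //.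
  by apply: measurable_fun_exp; apply: measurable_fun_opp; exact: measurable_funM.
rewrite (eq_integral (fun p : R * R => (1 - expR (- (lambda * p.2)))%:E)); last first.
  move=> [y v]; rewrite inE /jump_ray/= !in_itv/= andbT => -[_ v0].
  by rewrite ger0_norm// subr_ge0 expRN_le1// mulr_ge0// ltW.
rewrite jump_exp_integral// -ge0_fin_numE.
  by apply: integrable_fin_num; [exact: measurable_itv|exact: levy_exp_integrable].
apply: integral_ge0 => v; rewrite /= in_itv/= andbT => v0.
by rewrite lee_fin subr_ge0 expRN_le1// mulr_ge0// ltW.
Qed.

Let LA_laplace (x lambda : R) : 0 <= lambda -> \int[P]_w expR (- (lambda * L (A x) w)) =
  expR (- \int[nut]_(p in jump_ray x) (1 - expR (- (lambda * p.2)))).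
Proof.
move=> l0; have := hlaplace x l0; rewrite unlock -jump_exp_integral//.
rewrite -[in RHS](fineK (integrable_fin_num _ (jump_exp_integrable x l0)))/=; last first.
  exact: measurable_jump_ray.
move=> /(congr1 fine) /= <-; rewrite /Rintegral; congr fine; apply: eq_integral => w _.
by rewrite hLA.
Qed.

(** Right limits suffice, since the time change is right-continuous and
    nondecreasing and so approaches its limits from above. *)
Let cvg_above (F : set_system R) (FF : ProperFilter F) (u : R -> R) (y : R) w :
  (L z w @[z --> y^'+] --> L y w) -> (\forall s \near F, y <= u s) -> u s @[s --> F] --> y ->
  L (u s) w @[s --> F] --> L y w.
Proof.
move=> /cvgrPdist_le Ly uy ucv; apply/cvgrPdist_le => e e0.
have [d' /= d0 dL] := Ly e e0.
near=> s; have ys : y <= u s by near: s.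
move: ys; rewrite le_eqVlt => /predU1P[<-|ys]; first by rewrite subrr normr0 ltW.
apply: dL => //=; near: s; move/cvgrPdist_lt : ucv; exact.
Unshelve. all: by end_near. Qed.

(** The process is set to [0] on a null set that contains the three exceptional sets
    of its path properties.  Independence, [path_laplace_split] included, is
    transferred from the increments of [L] at the times [A (t i)]; the extra time [0],
    where [L] vanishes, exhibits [l a] itself as an increment. *)
Theorem exists_driving_paths : exists (l : R -> T -> R) (C : T -> R),
  driving_paths P l C nut /\ {ae P, forall w, l ^~ w = LA ^~ w}.
Proof.
have [N [mN PN]] : P.-negligible (~` [set w | [/\ L 0 w = 0,
    (forall y z : R, 0 <= y -> y <= z -> L y w <= L z w) &
    (forall y : R, 0 <= y -> L z w @[z --> y^'+] --> L y w)]]).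
  have := iap_start hL; apply: filterS3 (iap_nondecreasing hL) (iap_right_continuous hL).
  by move=> w ? ? ?; split.
move=> sN.
have good w : ~ N w -> [/\ L 0 w = 0,
    (forall y z : R, 0 <= y -> y <= z -> L y w <= L z w) &
    (forall y : R, 0 <= y -> L z w @[z --> y^'+] --> L y w)].
  by move=> nN; apply: contrapT => bad; apply: nN; exact: sN.
have mNC : measurable (~` N) by exact: measurableC.
pose l (t : R) (w : T) : R := L (A t) w * \1_(~` N) w.
have l_on t w : ~ N w -> l t w = L (A t) w by move=> nN; rewrite /l indicE mem_set// mulr1.
have l_off t w : N w -> l t w = 0 by move=> Nw; rewrite /l indicE memNset ?mulr0// => /(_ Nw).
have m_on (X : T -> R) : measurable_fun setT X -> measurable_fun setT (fun w => X w * \1_(~` N) w).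
  by move=> mX; apply: measurable_funM.
have ml t : measurable_fun setT (l t) by apply: m_on.
have lae : {ae P, forall w, ~ N w}.
  by exists N; split => // w /= /contrapT.
have indep (n : nat) (t : nat -> R) (Y : 'I_n -> T -> R) : 0 <= t 0%N ->
    {homo t : i j / (i <= j)%N >-> i <= j} -> (forall i, measurable_fun setT (Y i)) ->
    (forall (i : 'I_n) w, ~ N w -> L (t i.+1) w - L (t i) w = Y i w) ->
    mutually_independent P Y.
  move=> t0 th mY XY; apply: (mutually_independent_ae (X := fun (i : 'I_n) w => L (t i.+1) w - L (t i) w) _ mY).
  - by move=> i; exact: measurable_funB.
  - by apply: filterS lae => w nN i; exact: XY.
  - exact: (iap_independent_increments hL).
exists l, (fun w => L a w * \1_(~` N) w); split; last first.
  by apply: filterS lae => w nN; apply/funext => x; rewrite l_on// hLA.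
split.
- move=> w; have [Nw|nN] := pselect (N w).
    rewrite (_ : l ^~ w = cst 0); last by apply/funext => t; rewrite l_off.
    by split => // x; exact: cvg_cst.
  rewrite (_ : l ^~ w = (fun t => L (A t) w)); last by apply/funext => t; rewrite l_on.
  have [_ nd rc] := good w nN; split.
    by move=> x y xy; apply: nd => //; exact: A_nd.
  move=> x; apply: cvg_above; first by apply: rc.
    near=> s; apply: A_nd; apply: ltW; near: s; exact: nbhs_right_gt.
  exact: (@distribution_function_right_continuous _ _ _ halpha x).
- move=> w; have [Nw|nN] := pselect (N w).
    rewrite (_ : l ^~ w = cst 0); last by apply/funext => t; rewrite l_off.
    exact: cvg_cst.
  rewrite (_ : l ^~ w = (fun t => L (A t) w)); last by apply/funext => t; rewrite l_on.
  have [L0 nd rc] := good w nN; rewrite -L0; apply: cvg_above; first exact: rc.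
    exact: nearW.
  exact: (distribution_function_cvgNy halpha).
- move=> t w; rewrite /l indicE; have [Nw|nN] := pselect (N w).
    by rewrite memNset ?mulr0// => /(_ Nw).
  rewrite mem_set// !mulr1; have [_ nd _] := good w nN; apply: nd => //.
  exact: (distribution_function_le halpha).
- exact: m_on.
- exact: ml.
- move=> n t th; apply: (indep n (A \o t)) => //=.
  + by move=> i j ij; apply: A_nd; exact: th.
  + by move=> i; exact: measurable_funB.
  + by move=> i w nN; rewrite !l_on.
- move=> x y lambda xy l0.
  pose t (i : nat) : R := if i is i'.+1 then (if i' is 0%N then A x else A y) else 0.
  pose Y (i : 'I_2) w := if val i is 0%N then l x w else l y w - l x w.
  have mY i : measurable_fun setT (Y i).
    by rewrite /Y; case: (val i) => [|_] //; exact: measurable_funB.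
  have indY : mutually_independent P Y.
    apply: (indep 2%N t) => //.
    + move=> [|[|i]] [|[|j]] //= _; exact: A_nd.
    + move=> [[|[|//]] i2] w nN; rewrite /Y /t/=; last by rewrite !l_on.
      by have [L0 _ _] := good w nN; rewrite L0 subr0 l_on.
  have l_ge0 w : 0 <= l x w.
    have [Nw|nN] := pselect (N w); first by rewrite l_off.
    have [L0 nd _] := good w nN; rewrite l_on// -L0; exact: nd.
  have l_le w : l x w <= l y w.
    have [Nw|nN] := pselect (N w); first by rewrite !l_off.
    by have [L0 nd _] := good w nN; rewrite !l_on//; apply: nd => //; exact: A_nd.
  (* The truncation at [0] makes [phi] bounded on the whole line. *)
  pose phi (v : R) := expR (- (lambda * Num.max 0 v)).
  have phiE v : 0 <= v -> phi v = expR (- (lambda * v)) by move=> v0; rewrite /phi max_r.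
  have prod2 (F : 'I_2 -> R) : \prod_(i < 2) F i = F ord0 * F (lift ord0 ord0).
    by rewrite !big_ord_recl big_ord0 mulr1.
  have E : \int[P]_w (\prod_(i < 2) phi (Y i w)) = \prod_(i < 2) \int[P]_w phi (Y i w).
    apply: (independent_expectation_prod (phi := fun=> phi) indY) => // _.
      apply: measurable_fun_exp; apply: measurable_fun_opp; apply: measurable_funM => //.
      exact: measurable_maxr.
    by move=> v; rewrite ger0_norm ?expR_ge0// expRN_le1// mulr_ge0// le_max lexx.
  transitivity (\int[P]_w (\prod_(i < 2) phi (Y i w))).
    apply: eq_Rintegral => w _; rewrite prod2 /Y/=.
    by rewrite !phiE ?subr_ge0// -expRD; congr expR; ring.
  have Y0 w : phi (Y ord0 w) = expR (- (lambda * l x w)) by rewrite /Y phiE.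
  have Y1 w : phi (Y (lift ord0 ord0) w) = expR (- (lambda * (l y w - l x w))).
    by rewrite /Y/= phiE// subr_ge0.
  rewrite E prod2; under eq_Rintegral do rewrite Y0.
  by under [X in _ * X]eq_Rintegral do rewrite Y1.
- by move=> x lambda l0; exact: jump_exp_integrable.
- move=> x lambda l0; rewrite -(LA_laplace x l0) /Rintegral; congr fine; apply: ae_eq_integral => //.
  + by apply/measurable_EFinP; have := ml x; measurability.
  + by apply/measurable_EFinP; measurability.
  + by apply: filterS lae => w nN _; rewrite l_on.
Unshelve. all: by end_near. Qed.

End GoodPaths.

(** * The characteristic function of a signed linear functional *)

Section SignedIntegrand.
Context {R : realType} {d : measure_display} {T : measurableType d}.
Variable P : probability T R.
Variables (l : R -> T -> R) (C : T -> R) (nut : {measure set (R * R) -> \bar R}).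
Hypothesis hl : driving_paths P l C nut.
Variable f : R -> R.
Hypotheses (mf : measurable_fun setT f) (f_fin : forall lambda : R, 0 < lambda ->
  (\int[nut]_(p in @jumps R) (1 - expR (- (lambda * p.2 * `|f p.1|)))%:E < +oo)%E).

Let fp (x : R) : R := Num.max (f x) 0.
Let fn (x : R) : R := Num.max (- f x) 0.

Let mfp : measurable_fun setT fp. Proof. exact: measurable_maxr. Qed.
Let mfn : measurable_fun setT fn.
Proof. by apply: measurable_maxr => //; exact: measurable_fun_opp. Qed.
Let fp0 x : 0 <= fp x. Proof. by rewrite le_max lexx orbT. Qed.
Let fn0 x : 0 <= fn x. Proof. by rewrite le_max lexx orbT. Qed.
Let fp_le x : fp x <= `|f x|. Proof. by rewrite ge_max ler_norm normr_ge0. Qed.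
Let fn_le x : fn x <= `|f x|. Proof. by rewrite ge_max -normrN ler_norm normr_ge0. Qed.

Let parts x : (fp x = f x /\ fn x = 0) \/ (fp x = 0 /\ fn x = - f x).
Proof.
have /orP[f0|f0] := le_total 0 (f x); rewrite /fp /fn.
  by left; split; [rewrite max_l|rewrite max_r// oppr_le0].
by right; split; [rewrite max_r|rewrite max_l// oppr_ge0].
Qed.

Let jump_gt0 (p : R * R) : @jumps R p -> 0 < p.2.
Proof. by case=> _ /=; rewrite in_itv/= andbT. Qed.

Let mjump (D : set (R * R)) (r : R -> R) : measurable_fun setT r ->
  measurable_fun D (fun p : R * R => p.2 * r p.1).
Proof.
by move=> mr; apply: measurable_funTS; apply: measurable_funM => //; exact: (measurableT_comp mr).
Qed.

Let dominated_fin (r : R -> R) (c : R) : 0 <= c -> measurable_fun setT r ->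
  (forall x, 0 <= r x <= c * `|f x|) -> forall lambda : R, 0 < lambda ->
  (\int[nut]_(p in @jumps R) (1 - expR (- (lambda * p.2 * r p.1)))%:E < +oo)%E.
Proof.
move=> c0 mr rc lambda l0; have c1 : 0 < c + 1 by rewrite ltr_wpDl.
apply: le_lt_trans (f_fin (mulr_gt0 l0 c1)).
have mint (q : R -> R) (k : R) : measurable_fun setT q ->
    measurable_fun (@jumps R) (fun p : R * R => (1 - expR (- (k * p.2 * q p.1)))%:E).
  move=> mq; apply/measurable_EFinP; apply: measurable_funB => //; apply: measurable_fun_exp.
  apply: measurable_fun_opp; under eq_fun do rewrite -mulrA.
  by apply: measurable_funM => //; exact: mjump.
apply: ge0_le_integral.
- exact: measurable_jumps.
- move=> p /jump_gt0 p0; have /andP[r0 _] := rc p.1.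
  by rewrite lee_fin subr_ge0 expRN_le1//; apply: mulr_ge0 => //; apply: mulr_ge0; exact: ltW.
- exact: (mint r lambda mr).
- apply: (mint (fun x => `|f x|) (lambda * (c + 1))); exact: measurable_fun_norm.
- move=> p /jump_gt0 p0; have /andP[r0 rle] := rc p.1.
  rewrite lee_fin lerB// ler_expR lerN2.
  have h1 := mulr_gt0 l0 p0; have h2 := normr_ge0 (f p.1); have h3 := ltW (mulr_gt0 l0 p0).
  have : lambda * p.2 * r p.1 <= lambda * p.2 * (c * `|f p.1|) by exact: ler_wpM2l.
  have : 0 <= lambda * p.2 * `|f p.1| by exact: mulr_ge0.
  lra.
Qed.

Let U := path_integral l fp.
Let V := path_integral l fn.

Let fp_fin := dominated_fin (r := fp) ler01 mfp
  (fun x => introT andP (conj (fp0 x) (eq_ind_r (fun y => fp x <= y) (fp_le x) (mul1r _)))).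
Let fn_fin := dominated_fin (r := fn) ler01 mfn
  (fun x => introT andP (conj (fn0 x) (eq_ind_r (fun y => fn x <= y) (fn_le x) (mul1r _)))).

Let path_int_parts (r : R -> R) : measurable_fun setT r -> (forall x, 0 <= r x) ->
  (forall lambda : R, 0 < lambda ->
   (\int[nut]_(p in @jumps R) (1 - expR (- (lambda * p.2 * r p.1)))%:E < +oo)%E) ->
  {ae P, forall w, (stieltjes (l ^~ w)).-integrable setT (EFin \o r)}.
Proof.
move=> mr r0 rfin; apply: filterS (path_eintegral_fin hl mr r0 rfin) => w fin.
apply/integrableP; split; first by apply/measurable_EFinP.
suff -> : (\int[stieltjes (l ^~ w)]_x `|(EFin \o r) x| =
  \int[stieltjes (l ^~ w)]_x (r x)%:E)%E by [].
by apply: eq_integral => x _; rewrite /= ger0_norm.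
Qed.

Let levy_int (r : R -> R) : measurable_fun setT r -> (forall x, 0 <= r x) ->
  (forall lambda : R, 0 < lambda ->
   (\int[nut]_(p in @jumps R) (1 - expR (- (lambda * p.2 * r p.1)))%:E < +oo)%E) ->
  nut.-integrable (@jumps R) (EFin \o (fun p : R * R => 1 - expR (- (p.2 * r p.1)))).
Proof.
move=> mr r0 rfin; apply/integrableP; split.
  apply/measurable_EFinP; apply: measurable_funB => //; apply: measurable_fun_exp.
  by apply: measurable_fun_opp; exact: mjump.
rewrite (eq_integral (fun p : R * R => (1 - expR (- (1 * p.2 * r p.1)))%:E)); first exact: rfin.
move=> p; rewrite inE => /jump_gt0 p0; rewrite mul1r /= ger0_norm//.
by rewrite subr_ge0 expRN_le1// mulr_ge0// ltW.
Qed.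

Let wp (p : R * R) : R := p.2 * fp p.1.
Let wn (p : R * R) : R := p.2 * fn p.1.

Let mwp : measurable_fun (@jumps R) wp. Proof. exact: mjump. Qed.
Let mwn : measurable_fun (@jumps R) wn. Proof. exact: mjump. Qed.
Let wp0 p : @jumps R p -> 0 <= wp p. Proof. by move=> /jump_gt0 p0; rewrite mulr_ge0// ltW. Qed.
Let wn0 p : @jumps R p -> 0 <= wn p. Proof. by move=> /jump_gt0 p0; rewrite mulr_ge0// ltW. Qed.
Let iwp := levy_int mfp fp0 fp_fin.
Let iwn := levy_int mfn fn0 fn_fin.

(** At each point one of the two parts vanishes, so the exponent of
    [l1 * fp + l2 * fn] is the sum of the exponents of [l1 * fp] and [l2 * fn]. *)
Let joint_laplace (l1 l2 : R) : 0 <= l1 -> 0 <= l2 ->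
  \int[P]_w (expR (- (l2 * V w)) * expR (- (l1 * U w))) =
  expR (- \int[nut]_(p in @jumps R) (1 - expR (- (l2 * wn p)))) *
  expR (- \int[nut]_(p in @jumps R) (1 - expR (- (l1 * wp p)))).
Proof.
move=> l10 l20; pose r x := l1 * fp x + l2 * fn x.
have mr : measurable_fun setT r by apply: measurable_funD; exact: measurable_funM.
have r0 x : 0 <= r x by rewrite addr_ge0// mulr_ge0.
have rfin : forall lambda : R, 0 < lambda ->
    (\int[nut]_(p in @jumps R) (1 - expR (- (lambda * p.2 * r p.1)))%:E < +oo)%E.
  apply: (dominated_fin (c := l1 + l2)) => //; first exact: addr_ge0.
  by move=> x; rewrite r0/= mulrDl lerD// ler_wpM2l.
transitivity (\int[P]_w expR (- path_integral l r w)).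
  rewrite /Rintegral; congr fine; apply: ae_eq_integral => //.
  - apply/measurable_EFinP; have mU : measurable_fun setT U := measurable_path_integral hl mfp fp0.
    have mV : measurable_fun setT V := measurable_path_integral hl mfn fn0.
    by measurability.
  - apply/measurable_EFinP; have := measurable_path_integral hl mr r0; measurability.
  - have h1 := path_int_parts mfp fp0 fp_fin; have h2 := path_int_parts mfn fn0 fn_fin.
    apply: filterS2 h1 h2 => w ip i_n _; congr EFin.
    rewrite -expRD /path_integral RintegralD//; last 2 first.
    + exact: integrable_mulrl.
    + exact: integrable_mulrl.
    rewrite !RintegralZl// /U /V /path_integral; congr expR; ring.
rewrite (laplace_functional hl mr r0 rfin) -expRD -opprD -RintegralD.
- congr (expR (- _)); apply: eq_Rintegral => p _; rewrite /wp /wn /r.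
  have [[-> ->]|[-> ->]] := parts p.1; rewrite !mulr0 ?oppr0 ?expR0 subrr ?add0r ?addr0.
  + by congr (1 - expR (- _)); ring.
  + by congr (1 - expR (- _)); ring.
- exact: measurable_jumps.
- exact: (integrable_levy_exp measurable_jumps mwn wn0 iwn).
- exact: (integrable_levy_exp measurable_jumps mwp wp0 iwp).
Qed.

(** [fourier_of_laplace] is applied to [U] with the weight [e^(- l2 V)], then to [V]
    with the weights [cos (s U)] and [sin (s U)]; the addition formulas for
    [sin (s U - s V)] reassemble the result. *)
Theorem expectation_sin_path_integral (s : R) :
  \int[P]_w sin (s * (path_integral l fp w - path_integral l fn w)) =
  expR (\int[nut]_(p in @jumps R) (cos (s * p.2 * f p.1) - 1)) *
  sin (\int[nut]_(p in @jumps R) sin (s * p.2 * f p.1)).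
Proof.
have mU : measurable_fun setT U := measurable_path_integral hl mfp fp0.
have mV : measurable_fun setT V := measurable_path_integral hl mfn fn0.
have U0 w : 0 <= U w by exact: path_integral_ge0.
have V0 w : 0 <= V w by exact: path_integral_ge0.
have mE (lambda : R) : measurable_fun setT (fun w => expR (- (lambda * V w))) by measurability.
have E1 (lambda : R) : 0 <= lambda -> forall w, `|expR (- (lambda * V w))| <= 1.
  by move=> l0 w; rewrite ger0_norm ?expR_ge0// expRN_le1// mulr_ge0.
pose Ap := \int[nut]_(p in @jumps R) (1 - cos (s * wp p)).
pose An := \int[nut]_(p in @jumps R) (1 - cos (s * wn p)).
pose bp := \int[nut]_(p in @jumps R) sin (s * wp p).
pose bn := \int[nut]_(p in @jumps R) sin (s * wn p).
have stepU (l2 : R) : 0 < l2 ->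
    \int[P]_w (expR (- (l2 * V w)) * cos (s * U w)) =
      expR (- \int[nut]_(p in @jumps R) (1 - expR (- (l2 * wn p)))) * expR (- Ap) * cos bp /\
    \int[P]_w (expR (- (l2 * V w)) * sin (s * U w)) =
      expR (- \int[nut]_(p in @jumps R) (1 - expR (- (l2 * wn p)))) * expR (- Ap) * sin bp.
  move=> l20; apply: (fourier_of_laplace (mE l2) (E1 l2 (ltW l20)) mU U0 measurable_jumps mwp wp0 iwp).
  by move=> l1 l10; apply: joint_laplace; exact: ltW.
have mcos : measurable_fun setT (fun w => cos (s * U w)) by measurability.
have msin : measurable_fun setT (fun w => sin (s * U w)) by measurability.
have lcos (l2 : R) : 0 < l2 -> \int[P]_w (cos (s * U w) * expR (- (l2 * V w))) =
    expR (- Ap) * cos bp * expR (- \int[nut]_(p in @jumps R) (1 - expR (- (l2 * wn p)))).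
  move=> l20; rewrite [RHS]mulrC mulrA -(stepU l2 l20).1.
  by apply: eq_Rintegral => w _; exact: mulrC.
have lsin (l2 : R) : 0 < l2 -> \int[P]_w (sin (s * U w) * expR (- (l2 * V w))) =
    expR (- Ap) * sin bp * expR (- \int[nut]_(p in @jumps R) (1 - expR (- (l2 * wn p)))).
  move=> l20; rewrite [RHS]mulrC mulrA -(stepU l2 l20).2.
  by apply: eq_Rintegral => w _; exact: mulrC.
have [_ cs] := fourier_of_laplace mcos (fun w => normr_cos_le1 (s * U w)) mV V0
  measurable_jumps mwn wn0 iwn lcos s.
have [sc _] := fourier_of_laplace msin (fun w => normr_sin_le1 (s * U w)) mV V0
  measurable_jumps mwn wn0 iwn lsin s.
have ib (X Y : T -> R) : measurable_fun setT X -> measurable_fun setT Y ->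
    (forall w, `|X w| <= 1) -> (forall w, `|Y w| <= 1) ->
    P.-integrable setT (EFin \o (fun w => X w * Y w)).
  move=> mX mY X1 Y1; apply: (integrable_le (mu := P) (g := cst 1)) => //.
  - exact: measurable_funM.
  - by move=> w _; rewrite normrM mulr_ile1.
  - exact: finite_measure_integrable_cst.
have -> : \int[P]_w sin (s * (path_integral l fp w - path_integral l fn w)) =
    \int[P]_w (sin (s * U w) * cos (s * V w)) - \int[P]_w (cos (s * U w) * sin (s * V w)).
  rewrite -RintegralB//; last 2 first.
  - apply: ib; [exact: msin|by measurability|by move=> w; exact: normr_sin_le1|
      by move=> w; exact: normr_cos_le1].
  - apply: ib; [exact: mcos|by measurability|by move=> w; exact: normr_cos_le1|
      by move=> w; exact: normr_sin_le1].
  by apply: eq_Rintegral => w _; rewrite mulrBr sinB.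
rewrite sc cs -/An -/bn.
have isin (w : R * R -> R) : measurable_fun (@jumps R) w -> (forall p, @jumps R p -> 0 <= w p) ->
    nut.-integrable (@jumps R) (EFin \o (fun p => 1 - expR (- w p))) ->
    nut.-integrable (@jumps R) (EFin \o (fun p => sin (s * w p))).
  move=> mw w0 iw; apply: (integrable_le_min1 measurable_jumps mw w0 iw (C := 1 + `|s|)).
    by measurability.
  by move=> p pj; apply: sin_le_min1; exact: w0.
have icos (w : R * R -> R) : measurable_fun (@jumps R) w -> (forall p, @jumps R p -> 0 <= w p) ->
    nut.-integrable (@jumps R) (EFin \o (fun p => 1 - expR (- w p))) ->
    nut.-integrable (@jumps R) (EFin \o (fun p => 1 - cos (s * w p))).
  move=> mw w0 iw; apply: (integrable_le_min1 measurable_jumps mw w0 iw (C := 2 + `|s|)).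
    by measurability.
  by move=> p pj; apply: one_sub_cos_le_min1; exact: w0.
have -> : \int[nut]_(p in @jumps R) (cos (s * p.2 * f p.1) - 1) = - (Ap + An).
  rewrite /Ap /An -RintegralD; [|exact: measurable_jumps|exact: icos|exact: icos].
  rewrite -[RHS]mulN1r -RintegralZl; [|exact: measurable_jumps|]; last first.
    by apply: integrable_addr; [exact: measurable_jumps|exact: icos|exact: icos].
  apply: eq_Rintegral => p _; rewrite /wp /wn.
  have [[-> ->]|[-> ->]] := parts p.1; rewrite !mulr0 cos0.
    by rewrite mulrA; ring.
  by rewrite -(cosN (s * (p.2 * - f p.1))) !mulrN opprK mulrA; ring.
have -> : \int[nut]_(p in @jumps R) sin (s * p.2 * f p.1) = bp - bn.
  rewrite /bp /bn -RintegralB; [|exact: measurable_jumps|exact: isin|exact: isin].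
  apply: eq_Rintegral => p _; rewrite /wp /wn.
  have [[-> ->]|[-> ->]] := parts p.1; rewrite !mulr0 sin0.
    by rewrite mulrA subr0.
  by rewrite !mulrN sinN opprK mulrA add0r.
rewrite sinB opprD expRD.
move: (expR (- Ap)) (expR (- An)) (sin bp) (cos bp) (sin bn) (cos bn) => u v a b c e; ring.
Qed.

End SignedIntegrand.

(** * The distribution function of the mean *)

Section CdfLimit.
Context {R : realType} {d : measure_display} {T : measurableType d}.
Variables (P : probability T R) (M : {RV P >-> R}).

Let m_le x : measurable [set w | M w <= x].
Proof.
have -> : [set w | M w <= x] = M @^-1` `]-oo, x]%classic.
  by apply/seteqP; split => w /=; rewrite in_itv.
by rewrite -[X in measurable X]setTI; apply: (measurable_funPT M) => //; exact: measurable_itv.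
Qed.

Let m_lt x : measurable [set w | M w < x].
Proof.
have -> : [set w | M w < x] = M @^-1` `]-oo, x[%classic.
  by apply/seteqP; split => w /=; rewrite in_itv.
by rewrite -[X in measurable X]setTI; apply: (measurable_funPT M) => //; exact: measurable_itv.
Qed.

Lemma cdf_left_limit (sigma : R) :
  fine (P [set w | M w <= x]) @[x --> sigma^'-] --> fine (P [set w | M w < sigma]).
Proof.
have le_fine (A B : set T) : measurable A -> measurable B -> A `<=` B -> fine (P A) <= fine (P B).
  by move=> mA mB AB; apply: fine_le; rewrite ?fin_num_measure//; apply: le_measure; rewrite ?inE.
apply/cvgrPdist_le => e e0.
have : fine (P [set w | M w <= sigma - n.+1%:R^-1]) @[n --> \oo] -->
    fine (P [set w | M w < sigma]).
  apply: fine_cvg; rewrite fineK ?fin_num_measure//.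
  have -> : [set w | M w < sigma] = \bigcup_n [set w | M w <= sigma - n.+1%:R^-1].
    apply/seteqP; split => w /=; last first.
      by move=> [n _ /le_lt_trans]; apply; rewrite ltrBlDr ltrDl invr_gt0.
    rewrite -subr_gt0 => h; have [n _ hn] := near_infty_natSinv_lt (PosNum h).
    exists n => //=; have : n.+1%:R^-1 < sigma - M w := hn n (leqnn n).
    by move: (n.+1%:R^-1) => q; lra.
  apply: nondecreasing_cvg_mu => //; first exact: bigcup_measurable.
  move=> m n mn; apply/subsetPset => w /= /le_trans; apply.
  by rewrite lerD2l lerN2 lef_pV2 ?posrE// ler_nat.
move=> /cvgrPdist_le/(_ _ e0)[N _ /(_ N (leqnn N)) /=].
rewrite ger0_norm; last first.
  by rewrite subr_ge0; apply: le_fine => // w /= /le_lt_trans; apply;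
     rewrite ltrBlDr ltrDl invr_gt0.
move=> HN; near=> y.
have ys : y < sigma by near: y; exact: nbhs_left_lt.
rewrite ger0_norm; last by rewrite subr_ge0; apply: le_fine => // w /= /le_lt_trans; exact.
apply: le_trans HN; rewrite lerB//; apply: le_fine => // w /= /le_trans; apply.
apply: ltW; near: y; apply: nbhs_left_gt; rewrite ltrBlDr ltrDl invr_gt0//.
Unshelve. all: by end_near. Qed.

End CdfLimit.

Section MeanInversion.
Context {R : realType} {d : measure_display} {T : measurableType d}.
Variable P : probability T R.
Variables (l : R -> T -> R) (C : T -> R) (nut : {measure set (R * R) -> \bar R}).
Hypothesis hl : driving_paths P l C nut.
Variables (k : R -> R -> R) (g : R -> R).
Hypotheses (hk : normalizing_kernel k nut) (hac : forall x, absolutely_continuous (k ^~ x))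
  (hg : measurable_fun setT g) (hfin : forall x, (htilde g k x < +oo)%E)
  (hint : forall lambda : R, 0 < lambda ->
      (\int[nut]_(p in @jumps R)
         (1 - expR (- (lambda * p.2 * fine (htilde g k p.1))))%:E < +oo)%E).
Variable sigma : R.

Let mk := kernel_measurable hk.
Let k_nd := kernel_nondecreasing hk.
Let k_y := kernel_cvgy hk.
Let k_rc := kernel_right_continuous hk.
Let k_Ny := kernel_cvgNy hk.
Let kb := kbar k.
Let ht (x : R) : R := fine (htilde g k x).
Let f (x : R) : R := h g k x - sigma * kb x.

Let mkb : measurable_fun setT kb. Proof. exact: (measurable_kbar mk k_y). Qed.
Let mh : measurable_fun setT (h g k).
Proof. exact: (measurable_h mk k_nd k_rc k_Ny k_y hac hg). Qed.
Let mht : measurable_fun setT ht.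
Proof.
exact: (measurableT_comp (fine_measurable measurableT)
  (measurable_htilde mk k_nd k_rc k_Ny k_y hac hg)).
Qed.
Let ht0 x : 0 <= ht x. Proof. by apply: fine_ge0; exact: integral_ge0. Qed.
Let htE x : htilde g k x = (ht x)%:E.
Proof.
by rewrite /ht fineK// ge0_fin_numE; [exact: hfin|exact: integral_ge0].
Qed.
Let kb0 x : 0 <= kb x. Proof. exact/ltW/(kbar_gt0 hk). Qed.
Let h_le x : `|h g k x| <= ht x.
Proof. exact: (normr_h_le mk k_nd k_rc k_Ny k_y hac hg hfin x). Qed.

Let mf : measurable_fun setT f.
Proof. by apply: measurable_funB => //; exact: measurable_funM. Qed.

Let f_le x : `|f x| <= ht x + (`|sigma| + 1) * kb x.
Proof.
rewrite (le_trans (ler_normB _ _))// lerD// normrM (ger0_norm (kb0 x)).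
by rewrite ler_wpM2r// lerDl.
Qed.

Let jump_gt0 (p : R * R) : @jumps R p -> 0 < p.2.
Proof. by case=> _ /=; rewrite in_itv/= andbT. Qed.

(** From [|f| <= htilde + (|sigma| + 1) * kbar] and the subadditivity
    [1 - e^(- (a + b)) <= (1 - e^(- a)) + (1 - e^(- b))]. *)
Let f_fin (lambda : R) : 0 < lambda ->
  (\int[nut]_(p in @jumps R) (1 - expR (- (lambda * p.2 * `|f p.1|)))%:E < +oo)%E.
Proof.
move=> l0; have s0 : 0 < `|sigma| + 1 by rewrite ltr_wpDl.
pose u (r : R -> R) (c : R) (p : R * R) := 1 - expR (- (c * p.2 * r p.1)).
have mu (r : R -> R) (c : R) : measurable_fun setT r -> measurable_fun (@jumps R) (u r c).
  move=> mr; apply: measurable_funTS; apply: measurable_funB => //; apply: measurable_fun_exp.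
  apply: measurable_fun_opp; apply: measurable_funM; first exact: measurable_funM.
  exact: (measurableT_comp mr).
have u0 (r : R -> R) (c : R) (p : R * R) : 0 < c -> (forall x, 0 <= r x) -> @jumps R p ->
    0 <= u r c p.
  move=> c0 r0 /jump_gt0 p0; rewrite subr_ge0 expRN_le1// mulr_ge0// mulr_ge0//; exact: ltW.
have l1 : 0 < lambda * (`|sigma| + 1) by exact: mulr_gt0.
apply: (@le_lt_trans _ _ (\int[nut]_(p in @jumps R) ((u ht lambda p)%:E +
    (u kb (lambda * (`|sigma| + 1)) p)%:E))%E).
  apply: ge0_le_integral.
  - exact: measurable_jumps.
  - move=> p pj; rewrite lee_fin; exact: (u0 (fun x => `|f x|) lambda).
  - apply/measurable_EFinP; apply: (mu (fun x => `|f x|)); exact: measurable_fun_norm.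
  - by apply/measurable_EFinP; apply: measurable_funD; exact: mu.
  - move=> p pj; rewrite -EFinD lee_fin /u.
    have p0 := jump_gt0 pj.
    set A := lambda * p.2 * ht p.1; set B := lambda * (`|sigma| + 1) * p.2 * kb p.1.
    have A0 : 0 <= A by rewrite mulr_ge0// mulr_ge0// ltW.
    have B0 : 0 <= B by rewrite mulr_ge0// mulr_ge0// ltW.
    have fAB : lambda * p.2 * `|f p.1| <= A + B.
      have -> : A + B = lambda * p.2 * (ht p.1 + (`|sigma| + 1) * kb p.1).
        by rewrite /A /B; ring.
      by apply: ler_wpM2l => //; rewrite mulr_ge0// ltW.
    have eAB : expR (- (A + B)) <= expR (- (lambda * p.2 * `|f p.1|)).
      by rewrite ler_expR lerN2.
    have := mulr_ge0 (_ : 0 <= 1 - expR (- A)) (_ : 0 <= 1 - expR (- B)).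
    rewrite !subr_ge0 !expRN_le1// => /(_ isT isT).
    move: eAB; rewrite opprD expRD; lra.
rewrite ge0_integralD//.
- by apply: lte_add_pinfty; [exact: hint|exact: (kbar_integrable hk)].
- exact: measurable_jumps.
- by move=> p pj; rewrite lee_fin; apply: u0.
- by apply/measurable_EFinP; exact: mu.
- by move=> p pj; rewrite lee_fin; apply: u0.
- by apply/measurable_EFinP; exact: mu.
Qed.

Let Y (w : T) : R := path_integral l (fun x => Num.max (f x) 0) w -
  path_integral l (fun x => Num.max (- f x) 0) w.

Let mY : measurable_fun setT Y.
Proof.
apply: measurable_funB; apply: (measurable_path_integral hl).
- exact: measurable_maxr.
- by move=> x; rewrite le_max lexx orbT.
- by apply: measurable_maxr => //; exact: measurable_fun_opp.
- by move=> x; rewrite le_max lexx orbT.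
Qed.

(** Hence the sign of [Y] decides on which side of [sigma] the mean lies. *)
Lemma mean_ratio : {ae P, forall w, exists2 S : R, 0 < S &
  mean g (normalized_df k (l ^~ w)) = Y w / S + sigma}.
Proof.
have e1 := path_eintegral_fin hl mkb kb0 (kbar_integrable hk).
have e2 := path_eintegral_gt0 hl mkb kb0 (kbar_integrable hk) (kbar_gt0 hk) (infinite_intensity hk).
have e3 := path_eintegral_fin hl mht ht0 hint.
apply: filterS3 e1 e2 e3 => w kfin kpos hfinw.
have int_htE : (\int[stieltjes (l ^~ w)]_x htilde g k x =
    \int[stieltjes (l ^~ w)]_x (ht x)%:E)%E.
  by apply: eq_integral => x _; rewrite htE.
have Hfin : (\int[stieltjes (l ^~ w)]_x htilde g k x < +oo)%E by rewrite int_htE.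
have -> := mean_normalized_df hk hac hg hfin (path_cumulative hl w) (path_cvgNy hl w)
  (fun t => path_le hl t w) kpos kfin Hfin.
have int_ge0 (r : R -> R) : measurable_fun setT r -> (forall x, 0 <= r x) ->
    (\int[stieltjes (l ^~ w)]_x (r x)%:E < +oo)%E ->
    (stieltjes (l ^~ w)).-integrable setT (EFin \o r).
  move=> mr r0 fin; apply/integrableP; split; first by apply/measurable_EFinP.
  suff -> : (\int[stieltjes (l ^~ w)]_x `|(EFin \o r) x| =
    \int[stieltjes (l ^~ w)]_x (r x)%:E)%E by [].
  by apply: eq_integral => x _; rewrite /= ger0_norm.
have ikb := int_ge0 kb mkb kb0 kfin.
have iht := int_ge0 ht mht ht0 hfinw.
have ih : (stieltjes (l ^~ w)).-integrable setT (EFin \o h g k).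
  by apply: (integrable_le (mu := stieltjes (l ^~ w)) (g := ht)) => //.
have i_f : (stieltjes (l ^~ w)).-integrable setT (EFin \o f).
  by apply: integrable_subr => //; exact: integrable_mulrl.
pose S := \int[stieltjes (l ^~ w)]_x kb x.
have S0 : 0 < S by apply: fine_gt0; apply/andP.
exists S => //.
have -> : Y w = \int[stieltjes (l ^~ w)]_x f x.
  rewrite /Y /path_integral -RintegralB//; last 2 first.
  - apply: (integrable_le (mu := stieltjes (l ^~ w)) (g := fun x => `|f x|)) => //.
    + exact: measurable_maxr.
    + by move=> x _; rewrite ger0_norm ?le_max ?lexx ?orbT// ge_max ler_norm normr_ge0.
    + exact: (integrable_norm i_f).
  - apply: (integrable_le (mu := stieltjes (l ^~ w)) (g := fun x => `|f x|)) => //.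
    + by apply: measurable_maxr => //; exact: measurable_fun_opp.
    + by move=> x _; rewrite ger0_norm ?le_max ?lexx ?orbT// ge_max -normrN ler_norm normr_ge0.
    + exact: (integrable_norm i_f).
  apply: eq_Rintegral => x _; have /orP[f0|f0] := le_total 0 (f x).
    by rewrite max_l// max_r ?oppr_le0// subr0.
  by rewrite max_r// max_l ?oppr_ge0// sub0r opprK.
rewrite /f RintegralB//; last exact: integrable_mulrl.
rewrite RintegralZl// -/S mulrBl mulfK ?gt_eqF// subrK//.
Qed.

(** The inversion formula at [0] for [Y], whose sine transform is the integrand. *)
Theorem mean_inversion (M : {RV P >-> R})
    (hM : {ae P, forall w, M w = mean g (normalized_df k (l ^~ w))}) :
  let phase (s : R) (p : R * R) : R :=
    s * p.2 * (h g k p.1 - sigma * kbar k p.1) in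
  let integrand (s : R) : R :=
    s^-1 * expR (\int[nut]_(p in @jumps R) (cos (phase s p) - 1))
         * sin (\int[nut]_(p in @jumps R) sin (phase s p)) in
  let J (eps U : R) : R := \int[lebesgue_measure]_(s in `[eps, U]) integrand s in
  [/\ forall U : R, 0 < U -> cvg (J eps U @[eps --> 0^'+]),
      cvg (lim (J eps U @[eps --> 0^'+]) @[U --> +oo]) &
      2^-1 * (fine (P [set w | M w <= sigma]) + fine (P [set w | M w < sigma])) =
      2^-1 - pi^-1 * lim (lim (J eps U @[eps --> 0^'+]) @[U --> +oo])].
Proof.
move=> phase integrand J.
have [c1 c2 c3] := gil_pelaez_inversion P mY.
have JE : J = (fun eps U : R => \int[lebesgue_measure]_(s in `[eps, U])
    (s^-1 * \int[P]_w sin (s * Y w))).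
  apply/funext => eps; apply/funext => U; apply: eq_Rintegral => s _.
  by rewrite /integrand -mulrA -(expectation_sin_path_integral hl mf f_fin s).
rewrite JE; split; [exact: c1|exact: c2|].
have pre (X : T -> R) (b : R) (c : bool) : measurable_fun setT X ->
    measurable (X @^-1` [set` Interval -oo%O (BSide c b)]).
  by move=> mX; rewrite -[X in measurable X]setTI; apply: mX => //; exact: measurable_itv.
have preE (X : T -> R) (b : R) : ([set w | X w <= b] = X @^-1` `]-oo, b]%classic) *
    ([set w | X w < b] = X @^-1` `]-oo, b[%classic).
  by split; apply/seteqP; split => w /=; rewrite in_itv.
have mM : measurable_fun setT M by exact: measurable_funPT.
have Ple : P [set w | M w <= sigma] = P [set w | Y w <= 0].
  apply: probability_ae_eq; [by rewrite (preE M sigma).1; exact: pre|by rewrite (preE Y 0).1; exact: pre|].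
  apply: filterS2 hM mean_ratio => w Mw [S S0 E].
  by rewrite /= Mw E gerDr pmulr_lle0 ?invr_gt0.
have Plt : P [set w | M w < sigma] = P [set w | Y w < 0].
  apply: probability_ae_eq; [by rewrite (preE M sigma).2; exact: pre|by rewrite (preE Y 0).2; exact: pre|].
  apply: filterS2 hM mean_ratio => w Mw [S S0 E].
  by rewrite /= Mw E gtrDr pmulr_llt0 ?invr_gt0.
rewrite c3 Ple Plt; have pi0 : pi != 0 :> R by rewrite gt_eqF// pi_gt0.
move: (fine (P [set w | Y w <= 0])) (fine (P [set w | Y w < 0])) => p q.
by move: (pi : R) pi0 => c c0; field.
Qed.

End MeanInversion.

Theorem proposition2 (R : realType) (d : measure_display) (T : measurableType d)
    (P : probability T R)
    (a : R) (ha : 0 < a)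
    (alpha : {measure set R -> \bar R})
    (halpha : alpha setT = a%:E) (hnd : nondegenerate_measure alpha)
    (L : R -> {RV P >-> R}) (hL : increasing_additive_process L)
    (LA : R -> T -> R)
    (hLA : forall x w, LA x w = L (distribution_function alpha x) w)
    (nu : R -> {measure set R -> \bar R}) (hnu : forall x, levy_measure (nu x))
    (hlaplace : laplace_exponents P LA nu)
    (nut : {measure set (R * R) -> \bar R}) (hnut : poisson_intensity nu nut)
    (k : R -> R -> R) (hk : normalizing_kernel k nut)
    (hac : forall x, absolutely_continuous (k ^~ x))
    (g : R -> R) (hg : measurable_fun setT g)
    (hfin : forall x, (htilde g k x < +oo)%E)
    (hint : forall lambda : R, 0 < lambda ->
      (\int[nut]_(p in jumps)
         (1 - expR (- (lambda * p.2 * fine (htilde g k p.1))))%:E < +oo)%E)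
    (M : {RV P >-> R})
    (hM : {ae P, forall w, M w = mean g (normalized_df k (LA ^~ w))})
    (FF : R -> R) (hFF : forall x, FF x = fine (cdf M x))
    (sigma : R) :
  let phase (s : R) (p : R * R) : R :=
    s * p.2 * (h g k p.1 - sigma * kbar k p.1) in
  let integrand (s : R) : R :=
    s^-1 * expR (\int[nut]_(p in jumps) (cos (phase s p) - 1))
         * sin (\int[nut]_(p in jumps) sin (phase s p)) in
  let J (eps U : R) : R := \int[lebesgue_measure]_(s in `[eps, U]) integrand s in
  [/\ forall U : R, 0 < U -> cvg (J eps U @[eps --> 0^'+]),
      cvg (lim (J eps U @[eps --> 0^'+]) @[U --> +oo]) &
      2^-1 * (FF sigma + lim (FF x @[x --> sigma^'-])) =
      2^-1 - pi^-1 * lim (lim (J eps U @[eps --> 0^'+]) @[U --> +oo])].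
Proof.
have [l [C [hl lLA]]] := exists_driving_paths halpha hL hLA hnu hlaplace hnut.
have hM' : {ae P, forall w, M w = mean g (normalized_df k (l ^~ w))}.
  by apply: filterS2 hM lLA => w -> ->.
have FFE x : FF x = fine (P [set w | M w <= x]).
  rewrite hFF; have -> : [set w | M w <= x] = M @^-1` `]-oo, x]%classic; last by [].
  by apply/seteqP; split => w /=; rewrite in_itv.
have -> : lim (FF x @[x --> sigma^'-]) = fine (P [set w | M w < sigma]).
  apply/cvg_lim => //; rewrite (funext FFE); exact: cdf_left_limit.
rewrite FFE. have H := @mean_inversion _ _ _ P _ _ _ hl _ _ hk hac hg hfin hint sigma M hM'. exact: H.
Qed.
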